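(* Let $k$ be a commutative ring, $d\ge0$ an integer and $(\mathcal K,\mathcal P,\mathcal I)$ a $d$-precluster tilting triple. The connective exact dg category $\mathcal B'=\tau_{\le0}\mathcal B^{(d+1)}_{\mathcal K,\mathcal P,\mathcal I}$ is abelian if and only if the following conditions hold: (a) The dg category $\mathcal K$ is concentrated in non-negative degrees (in particular, the dg category $\mathcal P$ is concentrated in degree zero), and the category $\mathcal P$ admits weak kernels. (b) For every complex in $H^0(\mathcal K)$ $$(\ast)\quad 0\to K_{d+1}\to P_d\to P_{d-1}\to\cdots\to P_1\to P_0$$ with $K_{d+1}\in H^0(\mathcal K)$ and $P_i\in H^0(\mathcal P)$ for $0\le i\le d$: the induced complex of Hom spaces in $H^0(\mathcal K)$ $$(P_0,I)\to(P_1,I)\to\cdots\to(P_{d-1},I)\to(P_d,I)\to(K_{d+1},I)\to0$$ is exact for each $I\in\mathcal I$ if and only if the corresponding complex of Hom spaces in $H^0(\mathcal K)$ $$(\ast\ast)\quad 0\to(P,K_{d+1})\to(P,P_d)\to(P,P_{d-1})\to\cdots\to(P,P_1)\to(P,P_0)$$ is exact for each $P\in\mathcal P$. (c) Each morphism $P_1\to P_0$ in $H^0(\mathcal P)$ can be completed to a complex of the form $(\ast)$, with $K_{d+1}\in H^0(\mathcal K)$ and $P_i\in H^0(\mathcal P)$ for $0\le i\le d$, such that the corresponding complex $(\ast\ast)$ is exact for each $P\in\mathcal P$. In other words, the functor $F:\mathcal B'\hookrightarrow\mathrm{mod}\,\mathcal P$, $X\mapsto\mathrm{Hom}_{\mathcal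 B'}(-,X)|_{\mathcal P}$, is dense.
   Context: All dg categories are small dg $k$-categories. $\tau_{\le 0}\mathcal A$ has the same objects as $\mathcal A$ and morphism complexes $\tau_{\le 0}\mathcal A(X,Y)$. A dg category $\mathcal A$ is additive if $H^0(\mathcal A)$ is additive; connective if $H^i\mathcal A(X,Y)=0$ for all $i>0$; concentrated in degree zero (resp. in non-negative degrees) if $H^i\mathcal A(X,Y)=0$ for $i\ne0$ (resp. $i<0$), for all objects $X,Y$. A dg category concentrated in degree zero is identified with the category $H^0(\mathcal A)$. Additive subcategories are closed under direct summands; a full dg subcategory $\mathcal P\subseteq\mathcal K$ is additive if $H^0(\mathcal P)$ is an additive subcategory of $H^0(\mathcal K)$. $\mathrm{mod}\,\mathcal P$ is the category of finitely presented right $\mathcal P$-modules ($k$-linear functors $\mathcal P^{op}\to k\text{-Mod}$). $\mathrm{pretr}(\mathcal K)$ is the pretriangulated hull and $\mathrm{tr}(\mathcal K)=H^0(\mathrm{pretr}(\mathcal K))$ the triangulated hull, with suspension $\Sigma$; $\mathrm{Ext}^i(X,Y)=\mathrm{Hom}_{\mathrm{tr}(\mathcal K)}(X,\Sigma^iY)$. For full dg subcategories $\mathcal X,\mathcal Y$ of $\mathrm{pretr}(\mathcal K)$, $\mathcal X\ast\mathcal Y$ is the full dg subcategory of objects $Z$ admitting a triangle $X\to Z\to Y\to\Sigma X$ in $\mathrm{tr}(\mathcal K)$ with $X\in\mathcal X$, $Y\in\mathcal Y$; $\mathcal X$ is extension-closed if $\mathcal X\ast\mathcal X\subseteq\mathcal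 X$ (up to isomorphism). A subcategory $\mathcal Y\subseteq\mathcal C$ is covariantly finite if every $X\in\mathcal C$ has a morphism $X\to Y$ with $Y\in\mathcal Y$ through which every morphism from $X$ to an object of $\mathcal Y$ factors. For an additive dg category $\mathcal K$, connective additive full dg subcategories $\mathcal I\subseteq\mathcal P\subseteq\mathcal K$ and $n\ge0$, $\mathcal B^{(n)}_{\mathcal K,\mathcal P,\mathcal I}$ is the full dg subcategory of $\mathrm{pretr}(\mathcal K)$ on the objects $X\in\mathcal K\ast\Sigma\mathcal K\ast\cdots\ast\Sigma^n\mathcal K$ with $\mathrm{Ext}^i(X,I)=0$ for all $i\ge1$, $I\in\mathcal I$. For $\mathcal K$ additive and $\mathcal I\subseteq\mathcal P\subseteq\mathcal K$ full additive dg subcategories, $(\mathcal K,\mathcal P,\mathcal I)$ is a $d$-precluster tilting triple if: (1) $\mathcal P$ is connective; (2) $H^0(\mathcal I)$ is covariantly finite in $H^0(\mathcal B^{(d)}_{\mathcal K,\mathcal P,\mathcal I})$; (3) $\mathcal K$ is extension-closed in $\mathrm{tr}(\mathcal K)$; (4) $\mathrm{Hom}_{\mathrm{tr}(\mathcal K)}(P,\Sigma^iK)=0=\mathrm{Hom}_{\mathrm{tr}(\mathcal K)}(K,\Sigma^iP)$ for all $i\ge1$, $P\in\mathcal P$, $K\in\mathcal K$; (5) for each $K\in\mathcal K$ there is a triangle $K'\to P\to K\to\Sigma K'$ in $\mathrm{tr}(\mathcal K)$ with $P\in\mathcal P$, $K'\in\mathcal K$. For such a triple, $\mathcal B^{(d+1)}_{\mathcal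 K,\mathcal P,\mathcal I}$ is extension-closed in $\mathrm{pretr}(\mathcal K)$ and it and its truncation $\mathcal B'$ inherit an exact dg structure, whose conflations are given by the triangles of $\mathrm{tr}(\mathcal K)$ with all three terms in it. ''$\mathcal B'$ is abelian'' means that $\mathcal B'$ is concentrated in degree zero and, as an exact category with this exact structure, is an abelian category with all short exact sequences as conflations.
   Formalization: Condition (c) is read as density of F; given (a) and (b), its first form is shown equivalent to this for d≥2, and for d=1 if K is closed under direct summands in tr(K); otherwise the first form can fail (d=1) or has no meaning (d=0). *)

(* Defs.v *)
From HB Require Import structures.
From mathcomp Require Import all_boot all_order all_algebra ring_quotient.
From mathcomp Require Import zify.
From mathcomp Require Import boolp.

Set Implicit Arguments.
Unset Strict Implicit.
Unset Printing Implicit Defensive.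
Set Warnings "-redundant-canonical-projection,-projection-no-head-constant".

Import Order.TTheory GRing.Theory Num.Theory.
Local Open Scope ring_scope.

(* (-1)^n for an integer n *)
Definition sg (k : comPzRingType) (n : int) : k := (-1) ^+ `|n|%N.

Section Sign.
Variable k : comPzRingType.
Notation sg := (@sg k).

Lemma sg0 : sg 0 = 1. Proof. by []. Qed.

Lemma sgD m n : sg (m + n) = sg m * sg n.
Proof.
rewrite /Defs.sg -exprD -[LHS]signr_odd -[RHS]signr_odd; congr ((-1) ^+ nat_of_bool _).
lia.
Qed.

Lemma sgN n : sg (- n) = sg n.
Proof. by rewrite /Defs.sg abszN. Qed.

Lemma sgS n m : n + 1 = m -> sg m = - sg n.
Proof. by move=> <-; rewrite sgD /Defs.sg expr1 mulrN1. Qed.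

Lemma sgK n : sg n * sg n = 1.
Proof. by rewrite -sgD /Defs.sg -signr_odd (_ : odd _ = false) //; lia. Qed.
End Sign.

(* k-linear categories *)

Record lincat (k : comPzRingType) := LinCat {
  cob :> Type;
  chom : cob -> cob -> lmodType k;
  ccomp : forall X Y Z, chom Y Z -> chom X Y -> chom X Z;
  cid : forall X, chom X X;
  ccomp_linl : forall X Y Z (g : chom X Y), linear (fun f : chom Y Z => ccomp f g);
  ccomp_linr : forall X Y Z (f : chom Y Z), linear (fun g : chom X Y => ccomp f g);
  ccompA : forall X Y Z T (f : chom Z T) (g : chom Y Z) (h : chom X Y),
    ccomp (ccomp f g) h = ccomp f (ccomp g h);
  ccomp1l : forall X Y (f : chom X Y), ccomp (cid Y) f = f;
  ccomp1r : forall X Y (f : chom X Y), ccomp f (cid X) = f }.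

Arguments cid {k l} X.
Notation "g \oc f" := (ccomp g f) (at level 40, left associativity).

Record linfun (k : comPzRingType) (C D : lincat k) := LinFun {
  lf_ob :> C -> D;
  lf_hom : forall X Y, chom X Y -> chom (lf_ob X) (lf_ob Y);
  lf_linear : forall X Y, linear (@lf_hom X Y);
  lf_comp : forall X Y Z (f : chom Y Z) (g : chom X Y),
    lf_hom (f \oc g) = lf_hom f \oc lf_hom g;
  lf_id : forall X, lf_hom (cid X) = cid (lf_ob X) }.

Section Categories.
Variables (k : comPzRingType) (C : lincat k).
Implicit Types X Y Z : C.

Definition is_inverse X Y (f : chom X Y) (g : chom Y X) :=
  g \oc f = cid X /\ f \oc g = cid Y.

Definition is_iso X Y (f : chom X Y) := exists g, is_inverse f g.

Definition isomorphic X Y := exists f : chom X Y, is_iso f.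

Definition is_zero_object X := cid X = 0.

Definition is_biproduct X Y Z :=
  exists (iX : chom X Z) (iY : chom Y Z) (pX : chom Z X) (pY : chom Z Y),
    [/\ pX \oc iX = cid X, pY \oc iY = cid Y, pX \oc iY = 0, pY \oc iX = 0
      & iX \oc pX + iY \oc pY = cid Z].

Definition additive_cat :=
  (exists X, is_zero_object X) /\ (forall X Y, exists Z, is_biproduct X Y Z).

Definition closed_under_summands (S : C -> Prop) :=
  forall X Y Z, is_biproduct X Y Z -> S Z -> S X.

(* full additive subcategories, given by their objects *)
Definition additive_subcat (S : C -> Prop) :=
  [/\ exists2 X, S X & is_zero_object X,
      forall X Y Z, S X -> S Y -> is_biproduct X Y Z -> S Z
    & closed_under_summands S].

Definition covariantly_finite (S : C -> Prop) :=
  forall X, exists2 Y, S Y & exists f : chom X Y,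
    forall Y', S Y' -> forall g : chom X Y', exists h : chom Y Y', g = h \oc f.

Definition is_weak_kernel X Y Z (f : chom X Y) (g : chom Y Z) :=
  g \oc f = 0 /\
  forall T (h : chom T Y), g \oc h = 0 -> exists u : chom T X, h = f \oc u.

Definition has_weak_kernels :=
  forall Y Z (g : chom Y Z), exists X (f : chom X Y), is_weak_kernel f g.

Definition is_kernel X Y Z (f : chom X Y) (g : chom Y Z) :=
  g \oc f = 0 /\
  forall T (h : chom T Y), g \oc h = 0 -> exists! u : chom T X, h = f \oc u.

Definition is_cokernel X Y Z (f : chom X Y) (g : chom Y Z) :=
  g \oc f = 0 /\
  forall T (h : chom Y T), h \oc f = 0 -> exists! u : chom Z T, h = u \oc g.

Definition is_mono X Y (f : chom X Y) :=
  forall T (u v : chom T X), f \oc u = f \oc v -> u = v.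

Definition is_epi X Y (f : chom X Y) :=
  forall T (u v : chom Y T), u \oc f = v \oc f -> u = v.

Definition abelian_cat :=
  [/\ additive_cat,
      forall Y Z (g : chom Y Z), exists X (f : chom X Y), is_kernel f g,
      forall X Y (f : chom X Y), exists Z (g : chom Y Z), is_cokernel f g,
      forall X Y (f : chom X Y), is_mono f -> exists Z (g : chom Y Z), is_kernel f g
    & forall Y Z (g : chom Y Z), is_epi g -> exists X (f : chom X Y), is_cokernel f g].

Definition short_exact X Y Z (f : chom X Y) (g : chom Y Z) :=
  is_kernel f g /\ is_cokernel f g.

End Categories.

(* Right modules over a k-linear category C, i.e. k-linear functors from the
   opposite of C to k-modules *)
Record rmodule (k : comPzRingType) (C : lincat k) := RModule {
  rm_ob :> C -> lmodType k;
  rm_act : forall X Y, rm_ob Y -> chom X Y -> rm_ob X;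
  rm_linl : forall X Y (f : chom X Y), linear (fun m => rm_act m f);
  rm_linr : forall X Y (m : rm_ob Y), linear (@rm_act X Y m);
  rm_comp : forall X Y Z (m : rm_ob Z) (f : chom Y Z) (g : chom X Y),
    rm_act m (f \oc g) = rm_act (rm_act m f) g;
  rm_id : forall X (m : rm_ob X), rm_act m (cid X) = m }.

Definition exact_at (U V W : nmodType) (f : U -> V) (g : V -> W) :=
  forall y, g y = 0 <-> exists x, y = f x.

Section Modules.
Variables (k : comPzRingType) (C : lincat k).

Record rm_morph (M N : rmodule C) := RMMorph {
  rm_map :> forall X, M X -> N X;
  rm_map_linear : forall X, linear (@rm_map X);
  rm_map_nat : forall X Y (m : M Y) (f : chom X Y),
    rm_map (rm_act m f) = rm_act (rm_map m) f }.

Definition rm_isomorphic (M N : rmodule C) :=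
  exists phi : rm_morph M N, forall X, bijective (@phi X).

(* the restriction of D(-,Y) along F : C -> D *)
Definition restr_hom (D : lincat k) (F : linfun C D) (Y : D) : rmodule C.
Proof.
refine (@RModule k C (fun X => chom (F X) Y)
  (fun X X' m f => m \oc lf_hom F f) _ _ _ _).
- by move=> X X' f; apply: ccomp_linl.
- by move=> X X' m a f g /=; rewrite lf_linear ccomp_linr.
- by move=> X X' X'' m f g; rewrite lf_comp ccompA.
- by move=> X m; rewrite lf_id ccomp1r.
Defined.

Definition id_functor : linfun C C.
Proof. by refine (@LinFun k C C id (fun _ _ => id) _ _ _). Defined.

Definition representable (Y : C) : rmodule C := restr_hom id_functor Y.

(* over an additive category C: M is the cokernel of a map of representables *)
Definition finitely_presented (M : rmodule C) :=
  exists (P1 P0 : C) (f : chom P1 P0) (p : rm_morph (representable P0) M),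
    forall X, (forall m : M X, exists g, m = p X g) /\
      exact_at (fun g : chom X P1 => f \oc g) (p X).

End Modules.

(* Families of elements of modules ("matrices") *)
Definition fam (k : comPzRingType) (I J : Type) (M : I -> J -> lmodType k) :=
  forall i j, M i j.

Section Families.
Variables (k : comPzRingType) (I J : Type) (M : I -> J -> lmodType k).
Notation T := (fam M).

Lemma famP (f g : T) : (forall i j, f i j = g i j) -> f = g.
Proof. by move=> fg; apply: functional_extensionality_dep => i;
  apply: functional_extensionality_dep => j. Qed.

HB.instance Definition _ := gen_eqMixin T.
HB.instance Definition _ := gen_choiceMixin T.

Definition fam0 : T := fun _ _ => 0.
Definition famN (f : T) : T := fun i j => - f i j.
Definition famD (f g : T) : T := fun i j => f i j + g i j.
Definition famZ (a : k) (f : T) : T := fun i j => a *: f i j.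

Lemma famDA : associative famD.
Proof. by move=> f g h; apply: famP => i j; apply: addrA. Qed.
Lemma famDC : commutative famD.
Proof. by move=> f g; apply: famP => i j; apply: addrC. Qed.
Lemma fam0D : left_id fam0 famD.
Proof. by move=> f; apply: famP => i j; apply: add0r. Qed.
Lemma famND : left_inverse fam0 famN famD.
Proof. by move=> f; apply: famP => i j; apply: addNr. Qed.

HB.instance Definition _ := GRing.isZmodule.Build T famDA famDC fam0D famND.

Lemma famZA a b f : famZ a (famZ b f) = famZ (a * b) f.
Proof. by apply: famP => i j; apply: scalerA. Qed.
Lemma fam1Z : left_id 1 famZ.
Proof. by move=> f; apply: famP => i j; apply: scale1r. Qed.
Lemma famZDr : right_distributive famZ +%R.
Proof. by move=> a f g; apply: famP => i j; apply: scalerDr. Qed.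
Lemma famZDl f : {morph famZ^~ f : a b / a + b}.
Proof. by move=> a b; apply: famP => i j; apply: scalerDl. Qed.

HB.instance Definition _ :=
  GRing.Zmodule_isLmodule.Build k T famZA fam1Z famZDr famZDl.
End Families.

(* dg categories.  Degrees are tracked by explicit equations so that no transport
   between the graded pieces of the morphism complexes is needed: the
   composition of a morphism of degree i after one of degree j lands in the
   piece of index n for any n with a proof of i + j = n, and likewise for
   the differential and the identities. *)
Record dgcat (k : comPzRingType) := DGCat {
  dob :> Type;
  dhom : dob -> dob -> int -> lmodType k;
  diff : forall X Y i j, i + 1 = j -> dhom X Y i -> dhom X Y j;
  dcomp : forall X Y Z i j n, i + j = n -> dhom Y Z i -> dhom X Y j -> dhom X Z n;
  dunit : forall X n, n = 0 -> dhom X X n;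
  diff_lin : forall X Y i j (e : i + 1 = j), linear (@diff X Y i j e);
  diffK : forall X Y i j n (e : i + 1 = j) (e' : j + 1 = n) (f : dhom X Y i),
    diff e' (diff e f) = 0;
  dcomp_linl : forall X Y Z i j n (e : i + j = n) (g : dhom X Y j),
    linear (fun f : dhom Y Z i => dcomp e f g);
  dcomp_linr : forall X Y Z i j n (e : i + j = n) (f : dhom Y Z i),
    linear (fun g : dhom X Y j => dcomp e f g);
  dcompA : forall X Y Z T i j l ij jl n
      (e1 : i + j = ij) (e2 : ij + l = n) (e3 : j + l = jl) (e4 : i + jl = n)
      (f : dhom Z T i) (g : dhom Y Z j) (h : dhom X Y l),
    dcomp e2 (dcomp e1 f g) h = dcomp e4 f (dcomp e3 g h);
  dcomp1l : forall X Y i n (e0 : i = 0) (e : i + n = n) (f : dhom X Y n),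
    dcomp e (dunit Y e0) f = f;
  dcomp1r : forall X Y i n (e0 : i = 0) (e : n + i = n) (f : dhom X Y n),
    dcomp e f (dunit X e0) = f;
  diff1 : forall X i j (e0 : i = 0) (e : i + 1 = j), diff e (dunit X e0) = 0;
  leibniz : forall X Y Z i j n i' j' n'
      (e : i + j = n) (en : n + 1 = n') (ei : i + 1 = i') (ej : j + 1 = j')
      (e1 : i' + j = n') (e2 : i + j' = n') (f : dhom Y Z i) (g : dhom X Y j),
    diff en (dcomp e f g) = dcomp e1 (diff ei f) g + sg k i *: dcomp e2 f (diff ej g) }.

Arguments diff {k d X Y i j} e f.
Arguments dcomp {k d X Y Z i j n} e f g.
Arguments dunit {k d} X {n} e.

Record dgfun (k : comPzRingType) (A B : dgcat k) := DGFun {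
  df_ob :> A -> B;
  df_hom : forall X Y n, dhom X Y n -> dhom (df_ob X) (df_ob Y) n;
  df_lin : forall X Y n, linear (@df_hom X Y n);
  df_diff : forall X Y i j (e : i + 1 = j) (f : dhom X Y i),
    df_hom (diff e f) = diff e (df_hom f);
  df_comp : forall X Y Z i j n (e : i + j = n) (f : dhom Y Z i) (g : dhom X Y j),
    df_hom (dcomp e f g) = dcomp e (df_hom f) (df_hom g);
  df_one : forall X n (e : n = 0), df_hom (dunit X e) = dunit (df_ob X) e }.

Section LinearHelpers.
Variables (k : comPzRingType) (U V : lmodType k) (f : U -> V).
Hypothesis fL : linear f.
Lemma linf0 : f 0 = 0.
Proof. by have := fL (-1) 0 0; rewrite scaler0 addr0 scaleN1r addNr. Qed.
Lemma linfD x y : f (x + y) = f x + f y.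
Proof. by have := fL 1 x y; rewrite !scale1r. Qed.
Lemma linfZ a x : f (a *: x) = a *: f x.
Proof. by have := fL a x 0; rewrite !addr0 linf0 addr0. Qed.
Lemma linfN x : f (- x) = - f x.
Proof. by rewrite -scaleN1r linfZ scaleN1r. Qed.
Lemma linfB x y : f (x - y) = f x - f y.
Proof. by rewrite linfD linfN. Qed.
Lemma linf_sum I (r : seq I) (P : pred I) (F : I -> U) :
  f (\sum_(i <- r | P i) F i) = \sum_(i <- r | P i) f (F i).
Proof. by apply: (big_morph f linfD linf0). Qed.
End LinearHelpers.

Lemma lin_shuffle (k : comPzRingType) (U : lmodType k) (a s : k) (A B C D E F : U) :
  a *: A + B + (a *: C + D) - s *: (a *: E + F) =
  a *: (A + C - s *: E) + (B + D - s *: F).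
Proof.
rewrite scalerBr !scalerDr !scalerA (mulrC s) opprD.
by rewrite [X in X + _ = _]addrACA [LHS]addrACA.
Qed.

Section DGBasics.
Variables (k : comPzRingType) (A : dgcat k).
Implicit Types X Y Z : A.

Section OneDiff.
Variables (X Y : A) (i j : int) (e : i + 1 = j).
Lemma diff0 : diff e (0 : dhom X Y i) = 0. Proof. exact: (linf0 (diff_lin e)). Qed.
Lemma diffD (f g : dhom X Y i) : diff e (f + g) = diff e f + diff e g.
Proof. exact: (linfD (diff_lin e)). Qed.
Lemma diffZ a (f : dhom X Y i) : diff e (a *: f) = a *: diff e f.
Proof. exact: (linfZ (diff_lin e)). Qed.
Lemma diffN (f : dhom X Y i) : diff e (- f) = - diff e f.
Proof. exact: (linfN (diff_lin e)). Qed.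
Lemma diff_sum I (r : seq I) (P : pred I) (F : I -> dhom X Y i) :
  diff e (\sum_(i <- r | P i) F i) = \sum_(i <- r | P i) diff e (F i).
Proof. exact: (linf_sum (diff_lin e)). Qed.
End OneDiff.

Section OneComp.
Variables (X Y Z : A) (i j n : int) (e : i + j = n).
Implicit Types (f : dhom Y Z i) (g : dhom X Y j).
Lemma dcomp0l g : dcomp e (0 : dhom Y Z i) g = 0.
Proof. exact: (linf0 (dcomp_linl e g)). Qed.
Lemma dcompDl f f' g : dcomp e (f + f') g = dcomp e f g + dcomp e f' g.
Proof. exact: (linfD (dcomp_linl e g)). Qed.
Lemma dcompZl a f g : dcomp e (a *: f) g = a *: dcomp e f g.
Proof. exact: (linfZ (dcomp_linl e g)). Qed.
Lemma dcompNl f g : dcomp e (- f) g = - dcomp e f g.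
Proof. exact: (linfN (dcomp_linl e g)). Qed.
Lemma dcomp_suml I (r : seq I) (P : pred I) (F : I -> dhom Y Z i) g :
  dcomp e (\sum_(i <- r | P i) F i) g = \sum_(i <- r | P i) dcomp e (F i) g.
Proof. exact: (linf_sum (dcomp_linl e g)). Qed.
Lemma dcomp0r f : dcomp e f (0 : dhom X Y j) = 0.
Proof. exact: (linf0 (dcomp_linr e f)). Qed.
Lemma dcompDr f g g' : dcomp e f (g + g') = dcomp e f g + dcomp e f g'.
Proof. exact: (linfD (dcomp_linr e f)). Qed.
Lemma dcompZr a f g : dcomp e f (a *: g) = a *: dcomp e f g.
Proof. exact: (linfZ (dcomp_linr e f)). Qed.
Lemma dcompNr f g : dcomp e f (- g) = - dcomp e f g.
Proof. exact: (linfN (dcomp_linr e f)). Qed.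
Lemma dcomp_sumr I (r : seq I) (P : pred I) f (F : I -> dhom X Y j) :
  dcomp e f (\sum_(i <- r | P i) F i) = \sum_(i <- r | P i) dcomp e f (F i).
Proof. exact: (linf_sum (dcomp_linr e f)). Qed.
End OneComp.

Lemma dunit_comp (X : A) i j n (e : i + j = n) (ei : i = 0) (ej : j = 0) (en : n = 0) :
  dcomp e (dunit X ei) (dunit X ej) = dunit X en.
Proof.
subst i; subst j; subst n; rewrite (Prop_irrelevance en erefl).
exact: dcomp1l.
Qed.
End DGBasics.

(* Cohomology of the morphism complexes *)
Section Cohomology.
Variables (k : comPzRingType) (A : dgcat k) (X Y : A) (n : int).

Definition cocycle : {pred dhom X Y n} := fun f => diff (erefl (n + 1)) f == 0.

Lemma cocycle_submod : submod_closed cocycle.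
Proof.
split=> [|a f g]; rewrite !unfold_in ?diff0 // => /eqP f0 /eqP g0.
by rewrite diffD diffZ f0 g0 scaler0 addr0.
Qed.
HB.instance Definition _ := GRing.isSubmodClosed.Build k (dhom X Y n) cocycle
  cocycle_submod.

Record cocycles := Cocycle { cval :> dhom X Y n; cvalP : cval \in cocycle }.
HB.instance Definition _ := [isSub for cval].
HB.instance Definition _ := [Choice of cocycles by <:].
HB.instance Definition _ := [SubChoice_isSubLmodule of cocycles by <:].

Definition coboundary : {pred cocycles} :=
  fun z => `[< exists m (e : m + 1 = n) (f : dhom X Y m), cval z = diff e f >].

Lemma coboundary_submod : submod_closed coboundary.
Proof.
split=> [|a x y].
  rewrite unfold_in; apply/asboolP; have e : n - 1 + 1 = n by rewrite subrK.
  by exists (n - 1), e, 0; rewrite diff0.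
rewrite !unfold_in => /asboolP[m [e [f xE]]] /asboolP[m' [e' [f' yE]]].
apply/asboolP; have em : m' = m by lia.
subst m'; rewrite (Prop_irrelevance e' e) in yE.
by exists m, e, (a *: f + f'); rewrite diffD diffZ -xE -yE.
Qed.
HB.instance Definition _ := GRing.isSubmodClosed.Build k cocycles coboundary
  coboundary_submod.

Definition cohom := Quotient.quot coboundary.
HB.instance Definition _ := Choice.on cohom.
HB.instance Definition _ := GRing.Zmodule.on cohom.

Definition cls (z : cocycles) : cohom := \pi_(Quotient.quot coboundary)%qT z.

Lemma clsP (x : cohom) : exists z, x = cls z.
Proof. by exists (repr x); rewrite /cls reprK. Qed.

Lemma cls_eq (y z : cocycles) : cls y = cls z <->
  exists m (e : m + 1 = n) (f : dhom X Y m), cval y - cval z = diff e f.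
Proof.
split.
  by move/eqP; rewrite -Quotient.idealrBE unfold_in => /asboolP.
by move=> h; apply/eqP; rewrite -Quotient.idealrBE unfold_in; apply/asboolP.
Qed.

Lemma clsD y z : cls (y + z) = cls y + cls z.
Proof. by rewrite /cls Quotient.pi_add. Qed.

Definition cohom_scale (a : k) (x : cohom) : cohom := cls (a *: repr x).

Lemma cls_scale a z : cohom_scale a (cls z) = cls (a *: z).
Proof.
have : cls (repr (cls z)) = cls z by rewrite /cls reprK.
case/cls_eq => m [e [f zE]]; apply/cls_eq.
by exists m, e, (a *: f); rewrite diffZ -zE -scalerBr.
Qed.

Fact cohom_scaleA a b x :
  cohom_scale a (cohom_scale b x) = cohom_scale (a * b) x.
Proof. by have [z ->] := clsP x; rewrite !cls_scale scalerA. Qed.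
Fact cohom_scale1 : left_id 1 cohom_scale.
Proof. by move=> x; have [z ->] := clsP x; rewrite cls_scale scale1r. Qed.
Fact cohom_scaleDr : right_distributive cohom_scale +%R.
Proof.
move=> a x y; have [z ->] := clsP x; have [t ->] := clsP y.
by rewrite -clsD !cls_scale -clsD scalerDr.
Qed.
Fact cohom_scaleDl x : {morph cohom_scale^~ x : a b / a + b}.
Proof.
by move=> a b; have [z ->] := clsP x; rewrite !cls_scale -clsD scalerDl.
Qed.
HB.instance Definition _ := GRing.Zmodule_isLmodule.Build k cohom
  cohom_scaleA cohom_scale1 cohom_scaleDr cohom_scaleDl.

Lemma cls_linear : linear cls.
Proof. by move=> a y z; rewrite clsD -cls_scale. Qed.
End Cohomology.

Arguments cls {k A X Y n} z.

Section H0.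
Variables (k : comPzRingType) (A : dgcat k).
Implicit Types X Y Z : A.

Lemma cocycleP X Y n m (e : n + 1 = m) (f : dhom X Y n) :
  (f \in @cocycle k A X Y n) = (diff e f == 0).
Proof. by subst m. Qed.

Lemma cval_closed X Y n m (e : n + 1 = m) (z : cocycles X Y n) :
  diff e (cval z) = 0.
Proof. by apply/eqP; rewrite -cocycleP cvalP. Qed.

Lemma cval_inj X Y n (y z : cocycles X Y n) : cval y = cval z -> y = z.
Proof. exact: val_inj. Qed.

Fact zcomp_subproof X Y Z (f : cocycles Y Z 0) (g : cocycles X Y 0) :
  dcomp (addr0 0) (cval f) (cval g) \in @cocycle k A X Z 0.
Proof.
rewrite unfold_in (leibniz _ _ (erefl (0 + 1)) (erefl (0 + 1)) erefl erefl).
by rewrite !cval_closed dcomp0l dcomp0r scaler0 addr0.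
Qed.
Definition zcomp X Y Z (f : cocycles Y Z 0) (g : cocycles X Y 0) :=
  Cocycle (zcomp_subproof f g).

Fact zunit_subproof X : dunit X erefl \in @cocycle k A X X 0.
Proof. by rewrite unfold_in diff1. Qed.
Definition zunit X := Cocycle (zunit_subproof X).

Definition H0hom X Y : lmodType k := cohom X Y 0.

Definition H0comp X Y Z (x : H0hom Y Z) (y : H0hom X Y) : H0hom X Z :=
  cls (zcomp (repr x) (repr y)).

Lemma cls_comp X Y Z (f : cocycles Y Z 0) (g : cocycles X Y 0) :
  H0comp (cls f) (cls g) = cls (zcomp f g).
Proof.
have : cls (repr (cls f)) = cls f by rewrite /cls reprK.
have : cls (repr (cls g)) = cls g by rewrite /cls reprK.
rewrite /H0comp; move: (repr (cls g)) (repr (cls f)) => g' f'.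
case/cls_eq=> m [e [h gE]] /cls_eq[m' [e' [h' fE]]].
have em : m' = m by lia.
subst m'; rewrite (Prop_irrelevance e' e) in fE; apply/cls_eq => /=.
have e1 : m + 0 = m by rewrite addr0.
have e2 : 0 + m = m by rewrite add0r.
exists m, e, (dcomp e1 h' (cval g') + dcomp e2 (cval f) h).
rewrite diffD (leibniz e1 e e (add0r 1) (addr0 0) e).
have e3 : 1 + m = 0 by rewrite addrC.
rewrite (leibniz e2 e (add0r 1) e e3 (addr0 0)).
rewrite !cval_closed dcomp0r scaler0 addr0 dcomp0l add0r sg0 scale1r -gE -fE.
rewrite (linfB (dcomp_linr _ _)) (linfB (dcomp_linl _ _)).
by rewrite addrA subrK.
Qed.

Definition H0 : lincat k.
Proof.
refine (@LinCat k A H0hom H0comp (fun X => cls (zunit X)) _ _ _ _ _).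
- move=> X Y Z y a x x'; have [f ->] := clsP x; have [f' ->] := clsP x'.
  have [g ->] := clsP y; rewrite -cls_linear !cls_comp -cls_linear; congr cls.
  by apply: cval_inj; apply: dcomp_linl.
- move=> X Y Z y a x x'; have [f ->] := clsP x; have [f' ->] := clsP x'.
  have [g ->] := clsP y; rewrite -cls_linear !cls_comp -cls_linear; congr cls.
  by apply: cval_inj; apply: dcomp_linr.
- move=> X Y Z T x y z; have [f ->] := clsP x; have [g ->] := clsP y.
  have [h ->] := clsP z; rewrite !cls_comp; congr cls.
  by apply: cval_inj; apply: dcompA.
- move=> X Y x; have [f ->] := clsP x; rewrite cls_comp; congr cls.
  by apply: cval_inj; apply: dcomp1l.
- move=> X Y x; have [f ->] := clsP x; rewrite cls_comp; congr cls.
  by apply: cval_inj; apply: dcomp1r.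
Defined.

End H0.

Arguments zunit {k A} X.

Section H0Functor.
Variables (k : comPzRingType) (A B : dgcat k) (F : dgfun A B).

Fact zmap_subproof (X Y : A) (f : cocycles X Y 0) :
  df_hom F (cval f) \in @cocycle k B (F X) (F Y) 0.
Proof. by rewrite unfold_in -df_diff cval_closed (linf0 (@df_lin _ _ _ F _ _ _)). Qed.
Definition zmap X Y (f : cocycles X Y 0) := Cocycle (zmap_subproof f).

Definition H0map (X Y : A) (x : @chom k (H0 A) X Y) : @chom k (H0 B) (F X) (F Y) :=
  cls (zmap (repr x)).

Lemma cls_map X Y (f : cocycles X Y 0) : H0map (cls f) = cls (zmap f).
Proof.
have : cls (repr (cls f)) = cls f by rewrite /cls reprK.
case/cls_eq => m [e [h fE]]; apply/cls_eq; exists m, e, (df_hom F h).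
by rewrite -df_diff -fE (linfB (@df_lin _ _ _ F _ _ _)).
Qed.

Definition H0fun : linfun (H0 A) (H0 B).
Proof.
refine (@LinFun k (H0 A) (H0 B) F H0map _ _ _).
- move=> X Y a x y; have [f ->] := clsP x; have [g ->] := clsP y.
  rewrite -cls_linear !cls_map -cls_linear; congr cls.
  by apply: cval_inj; apply: df_lin.
- move=> X Y Z x y; have [f ->] := clsP x; have [g ->] := clsP y.
  by rewrite [X in H0map X]cls_comp !cls_map [RHS]cls_comp; congr cls;
    apply: cval_inj; apply: df_comp.
- move=> X; rewrite /= cls_map; congr cls.
  by apply: cval_inj; apply: df_one.
Defined.
End H0Functor.

Section Subcategories.
Variables (k : comPzRingType) (A : dgcat k).

Definition fullsub (S : A -> Prop) : dgcat k.
Proof.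
refine (@DGCat k {X | S X} (fun X Y n => dhom (sval X) (sval Y) n)
  (fun X Y i j e f => diff e f) (fun X Y Z i j n e f g => dcomp e f g)
  (fun X n e => dunit (sval X) e) _ _ _ _ _ _ _ _ _) => *.
- exact: diff_lin.
- exact: diffK.
- exact: dcomp_linl.
- exact: dcomp_linr.
- exact: dcompA.
- exact: dcomp1l.
- exact: dcomp1r.
- exact: diff1.
- exact: leibniz.
Defined.

Definition fullsub_incl (S : A -> Prop) : dgfun (fullsub S) A.
Proof. by refine (@DGFun k (fullsub S) A sval (fun X Y n f => f) _ _ _ _). Defined.

Definition vanishing (X Y : A) (n : int) := forall x : cohom X Y n, x = 0.

Definition connective := forall (X Y : A) n, n > 0 -> vanishing X Y n.
Definition concentrated_in_degree_zero :=
  forall (X Y : A) n, n != 0 -> vanishing X Y n.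
Definition concentrated_in_nonneg_degrees :=
  forall (X Y : A) n, n < 0 -> vanishing X Y n.
Definition additive_dgcat := additive_cat (H0 A).
End Subcategories.

(* The smart truncation: everything in negative degrees, cocycles in degree
   zero, nothing in positive degrees *)
Section Truncation.
Variables (k : comPzRingType) (A : dgcat k).

Definition trunc_pred (X Y : A) n : {pred dhom X Y n} := fun f =>
  [|| n < 0, (n == 0) && (diff (erefl (n + 1)) f == 0) | f == 0].

Lemma trunc_submod X Y n : submod_closed (@trunc_pred X Y n).
Proof.
split=> [|a f g]; rewrite !unfold_in; first by rewrite eqxx !orbT.
case: (n < 0) => //=; case: (n == 0) => /=; last first.
  by move=> /eqP-> /eqP->; rewrite scaler0 addr0.
have h (x : dhom X Y n) : (diff (erefl (n + 1)) x == 0) || (x == 0) ->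
    diff (erefl (n + 1)) x = 0.
  by case/orP=> /eqP // ->; rewrite diff0.
by move=> /h f0 /h g0; rewrite diffD diffZ f0 g0 scaler0 addr0 eqxx.
Qed.
HB.instance Definition _ X Y n :=
  GRing.isSubmodClosed.Build k (dhom X Y n) (@trunc_pred X Y n)
    (@trunc_submod X Y n).

Record trunc_hom (X Y : A) (n : int) :=
  Trunc { tval :> dhom X Y n; tvalP : tval \in @trunc_pred X Y n }.
HB.instance Definition _ X Y n := [isSub for @tval X Y n].
HB.instance Definition _ X Y n := [Choice of trunc_hom X Y n by <:].
HB.instance Definition _ X Y n := [SubChoice_isSubLmodule of trunc_hom X Y n by <:].

Lemma tval_inj X Y n (f g : trunc_hom X Y n) : tval f = tval g -> f = g.
Proof. exact: val_inj. Qed.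

Lemma tval_pos X Y n (f : trunc_hom X Y n) : n > 0 -> tval f = 0.
Proof.
move=> n0; have := tvalP f; rewrite unfold_in.
by rewrite (gt_eqF n0) ltNge (ltW n0) /= => /eqP.
Qed.

Lemma tval_zero X Y n m (e : n + 1 = m) (f : trunc_hom X Y n) :
  n >= 0 -> diff e (tval f) = 0.
Proof.
move=> n0; have := tvalP f; rewrite unfold_in ltNge n0 /= => /orP[/andP[_]|].
  by subst m => /eqP.
by move=> /eqP->; rewrite diff0.
Qed.

Fact trunc_diff_subproof X Y i j (e : i + 1 = j) (f : trunc_hom X Y i) :
  diff e (tval f) \in @trunc_pred X Y j.
Proof.
rewrite unfold_in; case: (ltrP i 0) => i0; last by rewrite tval_zero // eqxx !orbT.
rewrite diffK eqxx andbT; case: (ltrP j 0) => //= j0.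
by apply/orP; left; apply/eqP; lia.
Qed.
Definition trunc_diff X Y i j (e : i + 1 = j) f : trunc_hom X Y j :=
  Trunc (@trunc_diff_subproof X Y i j e f).

Fact trunc_comp_subproof X Y Z i j n (e : i + j = n) (f : trunc_hom Y Z i)
  (g : trunc_hom X Y j) : dcomp e (tval f) (tval g) \in @trunc_pred X Z n.
Proof.
rewrite unfold_in.
case: (ltrP 0 i) => i0; first by rewrite tval_pos // dcomp0l eqxx !orbT.
case: (ltrP 0 j) => j0; first by rewrite [tval g]tval_pos // dcomp0r eqxx !orbT.
case: (ltrP n 0) => //= n0; have i00 : i = 0 by lia.
have j00 : j = 0 by lia.
have e1 : i + 1 + j = n + 1 by lia.
have e2 : i + (j + 1) = n + 1 by lia.
apply/orP; left; apply/andP; split; first by apply/eqP; lia.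
rewrite (leibniz e erefl erefl erefl e1 e2).
by rewrite !tval_zero ?i00 ?j00 // dcomp0l dcomp0r scaler0 addr0.
Qed.
Definition trunc_comp X Y Z i j n (e : i + j = n) f g : trunc_hom X Z n :=
  Trunc (@trunc_comp_subproof X Y Z i j n e f g).

Fact trunc_unit_subproof X n (e : n = 0) : dunit X e \in @trunc_pred X X n.
Proof. by rewrite unfold_in diff1 eqxx andbT (introT eqP e) orbT. Qed.
Definition trunc_unit X n (e : n = 0) := Trunc (@trunc_unit_subproof X n e).

Definition trunc_le0 : dgcat k.
Proof.
refine (@DGCat k A (fun X Y n => trunc_hom X Y n) trunc_diff trunc_comp trunc_unit
  _ _ _ _ _ _ _ _ _).
- by move=> X Y i j e a f g; apply: tval_inj; apply: diff_lin.
- by move=> *; apply: tval_inj; apply: diffK.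
- by move=> X Y Z i j n e g a f f'; apply: tval_inj; apply: dcomp_linl.
- by move=> X Y Z i j n e f a g g'; apply: tval_inj; apply: dcomp_linr.
- by move=> *; apply: tval_inj; apply: dcompA.
- by move=> *; apply: tval_inj; apply: dcomp1l.
- by move=> *; apply: tval_inj; apply: dcomp1r.
- by move=> *; apply: tval_inj; apply: diff1.
- by move=> *; apply: tval_inj; apply: leibniz.
Defined.

Definition trunc_incl : dgfun trunc_le0 A.
Proof. by refine (@DGFun k trunc_le0 A id tval _ _ _ _). Defined.
End Truncation.

(* Formal shifts: (X, s) stands for X[s].  The composition is that of A, and the
   differential on morphisms X[s] -> Y[t] is (-1)^t times that of A. *)
Section Shifts.
Variables (k : comPzRingType) (A : dgcat k).

Lemma shift_diff_eq (s t i j : int) : i + 1 = j -> i + t - s + 1 = j + t - s.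
Proof. lia. Qed.
Lemma shift_comp_eq (s t u i j n : int) :
  i + j = n -> (i + u - t) + (j + t - s) = n + u - s.
Proof. lia. Qed.
Lemma shift_unit_eq (s n : int) : n = 0 -> n + s - s = 0.
Proof. lia. Qed.

Definition shifts : dgcat k.
Proof.
refine (@DGCat k (A * int)%type (fun X Y n => dhom X.1 Y.1 (n + Y.2 - X.2))
  (fun X Y i j e f => sg k Y.2 *: diff (shift_diff_eq _ _ e) f)
  (fun X Y Z i j n e f g => dcomp (shift_comp_eq _ _ _ e) f g)
  (fun X n e => dunit X.1 (shift_unit_eq X.2 e)) _ _ _ _ _ _ _ _ _).
- by move=> X Y i j e a f g; rewrite diffD diffZ scalerDr !scalerA mulrC.
- by move=> X Y i j n e e' f; rewrite diffZ diffK !scaler0.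
- by move=> X Y Z i j n e g; apply: dcomp_linl.
- by move=> X Y Z i j n e g; apply: dcomp_linr.
- by move=> *; apply: dcompA.
- by move=> X Y i n e0 e f; exact: dcomp1l.
- by move=> X Y i n e0 e f; exact: dcomp1r.
- by move=> X i j e0 e; rewrite diff1 scaler0.
- move=> X Y Z i j n i' j' n' e en ei ej e1 e2 f g.
  rewrite (leibniz _ _ (shift_diff_eq _ _ ei) (shift_diff_eq _ _ ej)
     (shift_comp_eq _ _ _ e1) (shift_comp_eq _ _ _ e2)).
  rewrite scalerDr dcompZl dcompZr !scalerA; congr (_ + _ *: _).
  rewrite !sgD sgN -mulrA mulrCA; congr (_ * _).
  by rewrite mulrA sgK mul1r.
Defined.
End Shifts.

(* One-sided twisted complexes over A, indexed by a finite type; the entry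
   tw i j is the component from the j-th to the i-th term, and one-sidedness
   refers to some ordering of the terms (given by a height function) *)
Section Twisted.
Variables (k : comPzRingType) (A : dgcat k).

Lemma deg11 : (1 + 1 : int) = 2. Proof. by []. Qed.

Record twcx := TwCx {
  tix : finType;
  tob :> tix -> A;
  tw : forall i j, dhom (tob j) (tob i) 1;
  maurer_cartan : forall i j,
    diff deg11 (tw i j) + \sum_l dcomp deg11 (tw i l) (tw l j) = 0;
  one_sided : exists h : tix -> nat, forall i j, (h j <= h i)%N -> tw i j = 0 }.

Definition tw_hom (X Y : twcx) (n : int) : lmodType k :=
  fam (fun (i : tix Y) (j : tix X) => dhom (X j) (Y i) n).

Lemma degl (n m : int) : n + 1 = m -> 1 + n = m.
Proof. by rewrite addrC. Qed.

Definition tw_diff X Y n m (e : n + 1 = m) (f : tw_hom X Y n) : tw_hom X Y m :=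
  fun i j => diff e (f i j) + \sum_l dcomp (degl e) (tw i l) (f l j)
             - sg k n *: \sum_l dcomp e (f i l) (tw l j).

Definition tw_comp X Y Z a b n (e : a + b = n)
    (f : tw_hom Y Z a) (g : tw_hom X Y b) : tw_hom X Z n :=
  fun i j => \sum_l dcomp e (f i l) (g l j).

Definition tw_kron (X : twcx) n (e : n = 0) (i j : tix X) : dhom (X j) (X i) n :=
  match @eqP _ i j with
  | ReflectT E => eq_rect i (fun j' => dhom (X j') (X i) n) (dunit (X i) e) j E
  | ReflectF _ => 0
  end.

Definition tw_unit (X : twcx) n (e : n = 0) : tw_hom X X n := tw_kron e.

Lemma tw_kron_eq X n (e : n = 0) (i : tix X) : tw_kron e i i = dunit (X i) e.
Proof.
rewrite /tw_kron; case: eqP => // E.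
by rewrite (eq_irrelevance E erefl).
Qed.

Lemma tw_kron_neq X n (e : n = 0) (i j : tix X) : i != j -> tw_kron e i j = 0.
Proof. by rewrite /tw_kron; case: eqP. Qed.

Lemma tw_kron_suml X (Y : A) a b n (e0 : a = 0) (e : a + b = n) (i : tix X)
  (f : forall l, dhom Y (X l) b) :
  \sum_l dcomp e (tw_kron e0 i l) (f l) = dcomp e (dunit (X i) e0) (f i).
Proof.
rewrite (bigD1 i) //= big1 ?addr0 ?tw_kron_eq // => l li.
by rewrite tw_kron_neq ?dcomp0l // eq_sym.
Qed.

Lemma tw_kron_sumr X (Y : A) a b n (e0 : b = 0) (e : a + b = n) (j : tix X)
  (f : forall l, dhom (X l) Y a) :
  \sum_l dcomp e (f l) (tw_kron e0 l j) = dcomp e (f j) (dunit (X j) e0).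
Proof.
rewrite (bigD1 j) //= big1 ?addr0 ?tw_kron_eq // => l lj.
by rewrite tw_kron_neq ?dcomp0r.
Qed.

Lemma tw_kron_diff X i j (e0 : i = 0) (e : i + 1 = j) (a b : tix X) :
  diff e (tw_kron e0 a b) = 0.
Proof.
case: (eqVneq a b) => [<-|ab]; first by rewrite tw_kron_eq diff1.
by rewrite tw_kron_neq // diff0.
Qed.

Lemma tw_diff_lin X Y n m (e : n + 1 = m) : linear (@tw_diff X Y n m e).
Proof.
move=> a f g; apply: famP => i j.
rewrite /tw_diff [LHS]/= -[(a *: f + g : tw_hom X Y n) i j]/(a *: f i j + g i j).
rewrite diff_lin.
under eq_bigr => l _ do
  rewrite -[(a *: f + g : tw_hom X Y n) l j]/(a *: f l j + g l j) dcomp_linr.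
under [X in _ - sg k n *: X]eq_bigr => l _ do
  rewrite -[(a *: f + g : tw_hom X Y n) i l]/(a *: f i l + g i l) dcomp_linl.
rewrite !big_split /= -!scaler_sumr.
rewrite -[RHS]/(a *: (diff e (f i j) + \sum_l dcomp (degl e) (tw i l) (f l j)
             - sg k n *: \sum_l dcomp e (f i l) (tw l j)) +
  (diff e (g i j) + \sum_l dcomp (degl e) (tw i l) (g l j)
             - sg k n *: \sum_l dcomp e (g i l) (tw l j))).
exact: lin_shuffle.
Qed.

Lemma tw_comp_linl X Y Z a b n (e : a + b = n) (g : tw_hom X Y b) :
  linear (fun f : tw_hom Y Z a => tw_comp e f g).
Proof.
move=> c f f'; apply: famP => i j.
rewrite -[RHS]/(c *: (\sum_l dcomp e (f i l) (g l j)) + \sum_l dcomp e (f' i l) (g l j)).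
by rewrite scaler_sumr -big_split; apply: eq_bigr => l _; apply: dcomp_linl.
Qed.

Lemma tw_comp_linr X Y Z a b n (e : a + b = n) (f : tw_hom Y Z a) :
  linear (fun g : tw_hom X Y b => tw_comp e f g).
Proof.
move=> c g g'; apply: famP => i j.
rewrite -[RHS]/(c *: (\sum_l dcomp e (f i l) (g l j)) + \sum_l dcomp e (f i l) (g' l j)).
by rewrite scaler_sumr -big_split; apply: eq_bigr => l _; apply: dcomp_linr.
Qed.

Lemma tw_compA X Y Z T i j l ij jl n
      (e1 : i + j = ij) (e2 : ij + l = n) (e3 : j + l = jl) (e4 : i + jl = n)
      (f : tw_hom Z T i) (g : tw_hom Y Z j) (h : tw_hom X Y l) :
    tw_comp e2 (tw_comp e1 f g) h = tw_comp e4 f (tw_comp e3 g h).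
Proof.
apply: famP => a b; rewrite /tw_comp.
under eq_bigr => c _ do rewrite dcomp_suml.
under [RHS]eq_bigr => c _ do rewrite dcomp_sumr.
rewrite exchange_big; apply: eq_bigr => c _; apply: eq_bigr => c' _.
exact: dcompA.
Qed.

Lemma tw_diffK X Y i j n (e : i + 1 = j) (e' : j + 1 = n) (f : tw_hom X Y i) :
  tw_diff e' (tw_diff e f) = 0.
Proof.
apply: famP => a b; rewrite /tw_diff -[RHS]/(0 : dhom _ _ _).
have e2 : 1 + j = n by rewrite addrC.
have e3 : (2 : int) + i = n by lia.
have e4 : i + (2 : int) = n by lia.
rewrite diffD diffD diffN diffZ diffK add0r diff_sum diff_sum.
under eq_bigr => c _ do rewrite (leibniz (degl e) e' deg11 e e3 (degl e')).
under [X in _ - sg k i *: X + _ - _]eq_bigr => c _ do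
  rewrite (leibniz e e' e deg11 e' e4).
under [X in _ + X - _]eq_bigr => c _ do
  rewrite dcompDr dcompDr dcompNr dcompZr !dcomp_sumr.
under [X in _ - _ *: X]eq_bigr => c _ do
  rewrite dcompDl dcompDl dcompNl dcompZl !dcomp_suml.
rewrite !big_split /= !sumrN -!scaler_sumr (sgS k e) (sgS k (add0r 1)) sg0.
set S1 := \sum_c dcomp e3 (diff _ (tw a c)) (f c b).
set S2 := \sum_c dcomp (degl e') (tw a c) (diff e (f c b)).
set S3 := \sum_c dcomp e' (diff e (f a c)) (tw c b).
set S4 := \sum_c dcomp e4 (f a c) (diff _ (tw c b)).
set S5 := \sum_c \sum_l _.
set S6 := \sum_c \sum_l _.
set S7 := \sum_c \sum_l _.
set S8 := \sum_c \sum_l _.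
have E1 : S1 + S5 = 0.
  rewrite /S1 /S5 [X in _ + X]exchange_big -big_split big1 // => c _ /=.
  under eq_bigr => l _ do rewrite -(dcompA deg11 e3).
  by rewrite -dcomp_suml -dcompDl maurer_cartan dcomp0l.
have E2 : S4 + S8 = 0.
  rewrite /S4 /S8 [X in _ + X]exchange_big -big_split big1 // => c _ /=.
  under eq_bigr => l _ do rewrite (dcompA _ _ deg11 e4).
  by rewrite -dcomp_sumr -dcompDr maurer_cartan dcomp0r.
have E3 : S6 = S7.
  rewrite /S6 /S7 exchange_big; apply: eq_bigr => c _; apply: eq_bigr => l _.
  by rewrite (dcompA _ _ e (degl e')).
move: E1 E2 => /eqP; rewrite addr_eq0 => /eqP-> /eqP; rewrite addr_eq0 => /eqP->.
rewrite -E3 -[- (sg k i *: S8)]scalerN scaleN1r scaleNr opprK !scalerDr.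
rewrite -[- S5 - S2]opprD (addrC S5) [sg k i *: S3 + _ + _]addrAC.
rewrite -opprD -[LHS]addrA [X in _ + X = _]addrACA addNr addr0.
exact: addNr.
Qed.

Lemma tw_leibniz X Y Z i j n i' j' n'
    (e : i + j = n) (en : n + 1 = n') (ei : i + 1 = i') (ej : j + 1 = j')
    (e1 : i' + j = n') (e2 : i + j' = n') (f : tw_hom Y Z i) (g : tw_hom X Y j) :
  tw_diff en (tw_comp e f g) =
  tw_comp e1 (tw_diff ei f) g + sg k i *: tw_comp e2 f (tw_diff ej g).
Proof.
apply: famP => a b.
rewrite -[RHS]/((\sum_l dcomp e1 (tw_diff ei f a l) (g l b)) +
  sg k i *: (\sum_l dcomp e2 (f a l) (tw_diff ej g l b))).
rewrite /tw_diff /tw_comp diff_sum.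
under eq_bigr => l _ do rewrite (leibniz e en ei ej e1 e2).
under [X in _ + X - _]eq_bigr => l _ do rewrite dcomp_sumr.
under [X in _ - _ *: X = _]eq_bigr => l _ do rewrite dcomp_suml.
under [X in _ = X + _]eq_bigr => l _ do
  rewrite dcompDl dcompDl dcompNl dcompZl !dcomp_suml.
under [X in _ = _ + _ *: X]eq_bigr => l _ do
  rewrite dcompDr dcompDr dcompNr dcompZr !dcomp_sumr.
rewrite !big_split /= !sumrN -!scaler_sumr.
set SA := \sum_l dcomp e1 (diff ei _) _; set SB := \sum_l dcomp e2 _ (diff ej _).
set SP := \sum_l _; set SN := \sum_l _; set SP' := \sum_l _.
set SQ := \sum_l _; set SQ' := \sum_l _; set SN' := \sum_l _.
have -> : SP = SP'.
  rewrite /SP /SP' exchange_big; apply: eq_bigr => c _; apply: eq_bigr => l _.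
  by rewrite (dcompA (degl ei) e1 e (degl en)).
have -> : SN = SN'.
  rewrite /SN /SN' exchange_big; apply: eq_bigr => c _; apply: eq_bigr => l _.
  by rewrite (dcompA e en ej e2).
have -> : SQ = SQ'.
  rewrite /SQ /SQ' exchange_big; apply: eq_bigr => c _; apply: eq_bigr => l _.
  by rewrite (dcompA ei e1 (degl ej) e2).
rewrite -e sgD -scalerA scalerBr scalerDr.
rewrite [RHS]addrA (addrC (sg k i *: SB)) [X in _ = X - _]addrA subrK.
by rewrite [X in X - _ = _]addrAC.
Qed.

Definition twisted : dgcat k.
Proof.
refine (@DGCat k twcx tw_hom tw_diff tw_comp tw_unit tw_diff_lin tw_diffK
  tw_comp_linl tw_comp_linr tw_compA _ _ _ tw_leibniz).
- move=> X Y i n e0 e f; apply: famP => a b.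
  by rewrite /tw_comp /tw_unit tw_kron_suml dcomp1l.
- move=> X Y i n e0 e f; apply: famP => a b.
  by rewrite /tw_comp /tw_unit tw_kron_sumr dcomp1r.
- move=> X i j e0 e; apply: famP => a b.
  rewrite /tw_diff /tw_unit tw_kron_diff tw_kron_suml tw_kron_sumr.
  subst j; subst i; rewrite sg0 scale1r; apply/eqP; rewrite subr_eq0; apply/eqP.
  by apply: etrans (etrans (add0r _) (dcomp1r _ _ _)) (esym (dcomp1l _ _ _)).
Defined.
End Twisted.

Section Pretriangulated.
Variables (k : comPzRingType) (K : dgcat k).
Notation Sh := (shifts K).

Definition pretr : dgcat k := twisted Sh.
Definition tr : lincat k := H0 pretr.

(* the canonical closed isomorphisms X -> X[a] and X[a] -> X, of degrees -a
   and a, given by the identity of X *)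
Definition Shift (a : int) (X : Sh) : Sh := (X.1, X.2 + a).

Lemma deg_to (a s : int) : - a + (s + a) - s = 0. Proof. lia. Qed.
Lemma deg_of (a s : int) : a + s - (s + a) = 0. Proof. lia. Qed.
Definition to_shift (a : int) (X : Sh) : dhom X (Shift a X) (- a) :=
  dunit X.1 (deg_to a X.2).
Definition of_shift (a : int) (X : Sh) : dhom (Shift a X) X a :=
  dunit X.1 (deg_of a X.2).

Lemma of_to_shift a X n (e : a - a = n) (e0 : n = 0) :
  dcomp e (of_shift a X) (to_shift a X) = dunit X e0.
Proof. exact: (@dunit_comp k K X.1 _ _ _ (shift_comp_eq _ _ _ e)). Qed.

Lemma to_of_shift a X n (e : - a + a = n) (e0 : n = 0) :
  dcomp e (to_shift a X) (of_shift a X) = dunit (Shift a X) e0.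
Proof. exact: (@dunit_comp k K X.1 _ _ _ (shift_comp_eq _ _ _ e)). Qed.

Lemma diff_to_shift a X n (e : - a + 1 = n) : diff e (to_shift a X) = 0.
Proof. by rewrite /= diff1 scaler0. Qed.
Lemma diff_of_shift a X n (e : a + 1 = n) : diff e (of_shift a X) = 0.
Proof. by rewrite /= diff1 scaler0. Qed.

Section ShiftTw.
Variables (a : int) (X : pretr).

Lemma degs (n : int) : - a + (n + a) = n. Proof. lia. Qed.

Definition conj_shift (Y Z : Sh) n (f : dhom Y Z n) :
    dhom (Shift a Y) (Shift a Z) n :=
  dcomp (degs n) (to_shift a Z) (dcomp (erefl (n + a)) f (of_shift a Y)).

Lemma conj_diff Y Z n m (e : n + 1 = m) (f : dhom Y Z n) :
  diff e (conj_shift f) = sg k a *: conj_shift (diff e f).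
Proof.
have e1 : n + a + 1 = m + a by lia.
have e2 : - a + 1 + (n + a) = m by lia.
have e3 : n + (a + 1) = m + a by lia.
rewrite /conj_shift (leibniz (degs n) e erefl e1 e2 (degs m)).
rewrite diff_to_shift dcomp0l add0r sgN; congr (_ *: dcomp _ _ _).
rewrite (leibniz erefl e1 e erefl erefl e3) diff_of_shift dcomp0r scaler0.
exact: addr0.
Qed.

Lemma conj_comp (Y Z T : Sh) i j n (e : i + j = n) (f : dhom Z T i) (g : dhom Y Z j) :
  dcomp e (conj_shift f) (conj_shift g) = conj_shift (dcomp e f g).
Proof.
rewrite /conj_shift.
have e1 : i + a + j = n + a by lia.
rewrite (dcompA _ _ e1 (degs n)); congr dcomp.
have e2 : a + j = a + j by [].
have e3 : i + (a + j) = n + a by lia.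
rewrite (dcompA _ _ e2 e3).
have e4 : a - a = 0 by rewrite subrr.
have e5 : 0 + (j + a) = a + j by lia.
rewrite -(dcompA e4 e5) (of_to_shift _ _ erefl).
have e6 : 0 + j = j by rewrite add0r.
have e7 : j + a = a + j by rewrite addrC.
rewrite -(dcompA e6 e7) dcomp1l.
by rewrite -(dcompA e erefl).
Qed.

Lemma conj_shift_lin (Y Z : Sh) n : linear (@conj_shift Y Z n).
Proof. by move=> c f g; rewrite /conj_shift dcomp_linl dcomp_linr. Qed.

(* the suspension: on the shift, the differential of the terms changes
   by the sign (-1)^a, hence so does the twisting element *)
Definition Sigma : pretr.
Proof.
refine (@TwCx k Sh (tix X) (fun i => Shift a (X i))
  (fun i j => sg k a *: conj_shift (tw i j)) _ _).
- move=> i j; rewrite diffZ conj_diff scalerA sgK scale1r.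
  under eq_bigr => l _ do
    rewrite dcompZl dcompZr scalerA sgK scale1r conj_comp.
  rewrite -(linf_sum (@conj_shift_lin _ _ _)) -(linfD (@conj_shift_lin _ _ _)).
  by rewrite maurer_cartan (linf0 (@conj_shift_lin _ _ _)).
- have [h hP] := one_sided X; exists h => i j /hP ->.
  by rewrite (linf0 (@conj_shift_lin _ _ _)) scaler0.
Defined.
End ShiftTw.

Section Cone.
Variables (X Y : pretr) (f : cocycles X Y 0).

Definition cone_ob (i : tix Y + tix X) : Sh :=
  match i with inl i => Y i | inr i => Sigma 1 X i end.

Definition cone_tw (i j : tix Y + tix X) : dhom (cone_ob j) (cone_ob i) 1 :=
  match i, j return dhom (cone_ob j) (cone_ob i) 1 with
  | inl i, inl j => tw i j
  | inl i, inr j => dcomp (add0r 1) (cval f i j) (of_shift 1 (X j))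
  | inr i, inl j => 0
  | inr i, inr j => @tw k Sh (Sigma 1 X) i j
  end.

Definition cone : pretr.
Proof.
refine (@TwCx k Sh (tix Y + tix X)%type cone_ob cone_tw _ _).
- case=> i; case=> j; rewrite big_sumType; cbv beta iota delta [cone_tw cone_ob].
  + rewrite [X in _ + (_ + X)]big1 ?addr0; last by move=> l _; rewrite dcomp0r.
    exact: maurer_cartan.
  + have e1 : 1 + (1 : int) = 2 by [].
    have e2 : (0 : int) + 2 = 2 by [].
    rewrite (leibniz (add0r 1) deg11 (add0r 1) e1 e1 e2) diff_of_shift dcomp0r.
    rewrite scaler0 addr0.
    under eq_bigr => l _ do rewrite -(dcompA (addr0 1) e1).
    under [X in _ + (_ + X)]eq_bigr => l _ do
      rewrite dcompZr /conj_shift (dcompA (add0r 1) deg11 e1 e2)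
       -[dcomp e1 _ (dcomp (degs 1 1) _ _)](dcompA (subrr 1) e2 (degs 1 1) e1)
       (of_to_shift _ _ erefl) dcomp1l -(dcompA (add0r 1) e1).
    rewrite -scaler_sumr -!dcomp_suml -dcompZl -!dcompDl.
    rewrite [X in dcomp _ X _](_ : _ = 0) ?dcomp0l //.
    apply: etrans (congr1 (fun g : tw_hom X Y 1 => g i j) (cval_closed (add0r 1) f)).
    rewrite -[RHS]/(diff (add0r 1) (cval f i j) +
      \sum_l dcomp (degl (add0r 1)) (tw i l) (cval f l j) -
      sg k 0 *: \sum_l dcomp (add0r 1) (cval f i l) (tw l j)).
    rewrite (Prop_irrelevance (degl _) (addr0 1)) (sgS k (add0r 1)) sg0.
    by rewrite scaleN1r scale1r addrA.
  + rewrite diff0 add0r !big1 => [|l _|l _];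
      by [exact: addr0 | rewrite dcomp0r | rewrite dcomp0l].
  + rewrite [X in _ + (X + _)]big1 ?add0r; last by move=> l _; rewrite dcomp0l.
    exact: (@maurer_cartan k Sh (Sigma 1 X)).
- have [h hP] := one_sided Y; have [g gP] := one_sided (Sigma 1 X).
  pose m := (\max_i h i).+1.
  exists (fun i => match i with inl i => h i | inr i => m + g i end)%N.
  case=> i; case=> j //=.
  + exact: hP.
  + move=> le_mh; have : (h i < m)%N by rewrite ltnS; exact: leq_bigmax.
    by move=> /(leq_ltn_trans le_mh); rewrite ltnNge leq_addr.
  + by rewrite leq_add2l; exact: gP.
Defined.

Definition cone_incl_hom : tw_hom Y cone 0 := fun i j =>
  match i return dhom (Y j) (cone_ob i) 0 with
  | inl i => tw_kron erefl i j
  | inr i => 0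
  end.

Fact cone_incl_closed : cone_incl_hom \in @cocycle k pretr Y cone 0.
Proof.
apply/eqP/famP => i j.
rewrite -[LHS]/(@diff k Sh (Y j) (cone_ob i) _ _ (erefl (0 + 1)) (cone_incl_hom i j) +
  \sum_l dcomp (degl (erefl (0 + 1))) (cone_tw i l) (cone_incl_hom l j) -
  sg k 0 *: \sum_l @dcomp k Sh (Y j) (Y l) (cone_ob i) _ _ _ (erefl (0 + 1))
     (cone_incl_hom i l) (tw l j)).
rewrite -[RHS]/(0 : dhom (Y j) (cone_ob i) (0 + 1)).
rewrite big_sumType sg0 scale1r; case: i => i;
  cbv beta iota delta [cone_incl_hom cone_tw cone_ob].
  rewrite tw_kron_diff tw_kron_suml tw_kron_sumr.
  rewrite [X in _ + (_ + X)]big1; last by move=> l _; rewrite dcomp0r.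
  apply/eqP; rewrite subr_eq0; apply/eqP.
  apply: etrans (esym (dcomp1l _ _ _)); apply: etrans (add0r _) _.
  by apply: etrans (addr0 _) _; exact: dcomp1r.
rewrite diff0 !big1 => [|l _|l _|l _];
  by [apply: etrans (subr0 _) _; apply: etrans (add0r _) _; exact: addr0
     | rewrite ?dcomp0l ?dcomp0r].
Qed.

Definition cone_incl : cocycles Y cone 0 := Cocycle cone_incl_closed.

Definition cone_proj_hom : tw_hom cone (Sigma 1 X) 0 := fun i j =>
  match j return dhom (cone_ob j) (Sigma 1 X i) 0 with
  | inl j => 0
  | inr j => @tw_kron k Sh (Sigma 1 X) 0 erefl i j
  end.

Fact cone_proj_closed : cone_proj_hom \in @cocycle k pretr cone (Sigma 1 X) 0.
Proof.
apply/eqP/famP => i j.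
rewrite -[LHS]/(@diff k Sh (cone_ob j) (Sigma 1 X i) _ _ (erefl (0 + 1)) (cone_proj_hom i j) +
  \sum_l @dcomp k Sh (cone_ob j) (Sigma 1 X l) (Sigma 1 X i) _ _ _ (degl (erefl (0 + 1))) (@tw k Sh (Sigma 1 X) i l) (cone_proj_hom l j) -
  sg k 0 *: \sum_l dcomp (erefl (0 + 1)) (cone_proj_hom i l) (cone_tw l j)).
rewrite -[RHS]/(0 : dhom (cone_ob j) (Sigma 1 X i) (0 + 1)).
rewrite [X in _ - _ *: X]big_sumType sg0 scale1r; case: j => j;
  cbv beta iota delta [cone_proj_hom cone_tw cone_ob].
  rewrite diff0 !big1 => [|l _|l _|l _];
    by [apply: etrans (subrr _) _ | rewrite ?dcomp0l ?dcomp0r].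
rewrite tw_kron_diff tw_kron_suml tw_kron_sumr.
rewrite [X in _ - (X + _)]big1; last by move=> l _; rewrite dcomp0l.
apply/eqP; rewrite subr_eq0; apply/eqP.
apply: etrans (add0r _) _; apply: etrans (dcomp1r _ _ _) _.
by apply: etrans (esym (dcomp1l _ _ _)) (esym (add0r _)).
Qed.

Definition cone_proj : cocycles cone (Sigma 1 X) 0 := Cocycle cone_proj_closed.
End Cone.

(* Distinguished triangles of tr K: those isomorphic to a standard triangle
   X -> Y -> cone f -> Sigma X, where the isomorphism may be taken to be the
   identity on X and Y. *)
Definition triangle (X Y Z : tr) (f : chom X Y) (g : chom Y Z)
    (h : chom Z (Sigma 1 X : tr)) :=
  exists f0 : cocycles (X : pretr) (Y : pretr) 0, f = cls f0 /\
  exists c : chom Z (cone f0 : tr),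
    [/\ is_iso c, c \oc g = (cls (cone_incl f0) : chom Y (cone f0 : tr))
      & h = (cls (cone_proj f0) : chom (cone f0 : tr) (Sigma 1 X : tr)) \oc c].

(* K as a full dg subcategory of its pretriangulated hull *)
Definition stalk (X : K) : pretr.
Proof.
refine (@TwCx k Sh unit (fun _ => (X, 0)) (fun _ _ => 0) _ _).
- by move=> i j; rewrite diff0 big1 ?addr0 // => l _; rewrite dcomp0l.
- by exists (fun _ => 0%N).
Defined.

Lemma deg_stalk (n : int) : 0 + n = n + 0 - 0. Proof. lia. Qed.

Definition stalk_hom (X Y : K) n (f : dhom X Y n) :
    @dhom k pretr (stalk X) (stalk Y) n :=
  fun _ _ => dcomp (deg_stalk n) (dunit Y erefl) f.

Definition embed : dgfun K pretr.
Proof.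
refine (@DGFun k K pretr stalk stalk_hom _ _ _ _).
- move=> X Y n a f g; apply: famP => i j.
  exact: (dcomp_linr (deg_stalk n) (dunit Y erefl) a f g).
- move=> X Y n m e f; apply: famP => i j.
  rewrite -[RHS]/(sg k 0 *: diff (shift_diff_eq 0 0 e)
      (dcomp (deg_stalk n) (dunit Y erefl) f) +
    \sum_l @dcomp k Sh (X, 0) (Y, 0) (Y, 0) _ _ _ (degl e) 0 (stalk_hom f l j) -
    sg k n *: \sum_l @dcomp k Sh (X, 0) (X, 0) (Y, 0) _ _ _ e (stalk_hom f i l) 0).
  rewrite [X in _ + X - _]big1; last by move=> l _; rewrite dcomp0l.
  rewrite [X in _ - _ *: X]big1; last by move=> l _; rewrite dcomp0r.
  rewrite scaler0 subr0 addr0 sg0 scale1r.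
  have e1 : 0 + 1 + n = m + 0 - 0 by lia.
  rewrite (leibniz _ _ erefl e e1 (deg_stalk m)) diff1 dcomp0l add0r sg0 scale1r.
  by [].
- move=> X Y Z i j n e f g; apply: famP => a b.
  rewrite -[RHS]/(\sum_l dcomp (shift_comp_eq 0 0 0 e) (stalk_hom f a l) (stalk_hom g l b)).
  rewrite (bigD1 tt) //= big1 ?addr0; last by case.
  rewrite /stalk_hom.
  have e1 : i + (j + 0 - 0) = n by lia.
  rewrite (dcompA _ _ e1 (deg_stalk n)) -(dcompA (addr0 i) e) dcomp1r.
  exact: esym (addr0 _).
- move=> X n e; apply: famP => i j.
  rewrite -[RHS]/(@tw_kron k Sh (stalk X) n e i j); case: i; case: j.
  rewrite tw_kron_eq.
  exact: (@dunit_comp k K X _ _ _ (deg_stalk n) erefl e (shift_unit_eq 0 e)).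
Defined.
End Pretriangulated.

Definition dgfun_comp (k : comPzRingType) (A B C : dgcat k)
  (G : dgfun B C) (F : dgfun A B) : dgfun A C.
Proof.
refine (@DGFun k A C (fun X => G (F X)) (fun X Y n f => df_hom G (df_hom F f)) _ _ _ _).
- by move=> X Y n a f g /=; rewrite !df_lin.
- by move=> *; rewrite !df_diff.
- by move=> *; rewrite !df_comp.
- by move=> *; rewrite !df_one.
Defined.

(* Full subcategories of tr K are given by predicates on objects *)
Section Stars.
Variables (k : comPzRingType) (K : dgcat k).
Implicit Types S T : tr K -> Prop.

Definition in_K (Z : tr K) := exists X : K, isomorphic Z (stalk X : tr K).

Definition in_shift (n : int) S (Z : tr K) :=
  exists X, S X /\ isomorphic Z (Sigma n X : tr K).

Definition star S T (Z : tr K) :=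
  exists (X Y : tr K) (f : chom X Z) (g : chom Z Y) (h : chom Y (Sigma 1 X : tr K)),
    [/\ S X, T Y & triangle f g h].

Definition extension_closed S := forall Z, star S S Z -> S Z.

(* K * Sigma K * ... * Sigma^n K *)
Fixpoint star_K (n : nat) : tr K -> Prop :=
  if n is m.+1 then star (star_K m) (in_shift n%:Z in_K) else in_K.

Definition ext_vanish (X Y : tr K) (i : nat) :=
  forall x : chom X (Sigma i%:Z Y : tr K), x = 0.

End Stars.

Section Precluster.
Variables (k : comPzRingType) (K : dgcat k) (P I : K -> Prop).

Definition in_B (n : nat) (X : pretr K) :=
  star_K n X /\
  forall (i : nat) (J : K), (1 <= i)%N -> I J -> @ext_vanish k K X (stalk J) i.

Definition B (n : nat) : dgcat k := fullsub (in_B n).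

Record precluster_tilting_triple (d : nat) : Prop := PreclusterTilting {
  pct_additive : additive_dgcat K;
  pct_P_additive : @additive_subcat k (H0 K) P;
  pct_I_additive : @additive_subcat k (H0 K) I;
  pct_IP : forall X, I X -> P X;
  pct_connective : connective (fullsub P);
  pct_cov_finite : @covariantly_finite k (H0 (B d))
    (fun X => exists2 J : K, I J & sval X = stalk J);
  pct_ext_closed : extension_closed (@in_K k K);
  pct_orthogonal : forall (i : nat) (Q X : K), (1 <= i)%N -> P Q ->
    @ext_vanish k K (stalk Q) (stalk X) i /\ @ext_vanish k K (stalk X) (stalk Q) i;
  pct_cover : forall X : K, exists (X' Q : K), P Q /\
    exists (f : chom (stalk X' : tr K) (stalk Q : tr K)) (g : chom _ (stalk X : tr K))
      (h : chom _ (Sigma 1 (stalk X') : tr K)), triangle f g h }.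

Definition B' (d : nat) : dgcat k := trunc_le0 (B d.+1).

Definition B'_incl (d : nat) : linfun (H0 (B' d)) (tr K) :=
  H0fun (dgfun_comp (fullsub_incl _) (trunc_incl _)).

Definition conflation (d : nat) (X Y Z : H0 (B' d)) (f : chom X Y) (g : chom Y Z) :=
  exists h, triangle (lf_hom (B'_incl d) f) (lf_hom (B'_incl d) g) h.

Definition B'_abelian (d : nat) :=
  [/\ concentrated_in_degree_zero (B' d), abelian_cat (H0 (B' d))
    & forall (X Y Z : H0 (B' d)) (f : chom X Y) (g : chom Y Z),
        conflation f g <-> short_exact f g].

Definition H0P : lincat k := H0 (fullsub P).

Definition P_incl : linfun H0P (tr K) := H0fun (dgfun_comp (embed K) (fullsub_incl P)).

(* H^0(B') is a full subcategory of tr K, whence morphisms from objects of P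
   are taken in tr K *)
Definition F (d : nat) (X : B' d) : rmodule H0P := restr_hom P_incl (B'_incl d X).

Definition F_dense (d : nat) :=
  forall M : rmodule H0P, finitely_presented M ->
    exists X : B' d, rm_isomorphic (F X) M.

Definition condition_a :=
  concentrated_in_nonneg_degrees K /\ has_weak_kernels H0P.

(* 0 -> X (d+1) -> X d -> ... -> X 1 -> X 0 with terms in P except possibly for
   X (d+1); the values of X and D beyond these are irrelevant *)
Definition P_complex (d : nat) (X : nat -> H0 K) (D : forall i, chom (X i.+1) (X i)) :=
  (forall i, (i <= d)%N -> P (X i)) /\
  (forall i, (i < d)%N -> D i \oc D i.+1 = 0).

Definition exact_on_I (d : nat) (X : nat -> H0 K) (D : forall i, chom (X i.+1) (X i)) :=
  forall J : H0 K, I J ->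
    (forall i, (i < d)%N ->
      exact_at (fun u : chom (X i) J => u \oc D i)
               (fun v : chom (X i.+1) J => v \oc D i.+1)) /\
    (forall v : chom (X d.+1) J, exists u : chom (X d) J, v = u \oc D d).

Definition exact_on_P (d : nat) (X : nat -> H0 K) (D : forall i, chom (X i.+1) (X i)) :=
  forall Q : H0 K, P Q ->
    (forall v : chom Q (X d.+1), D d \oc v = 0 -> v = 0) /\
    (forall i, (i < d)%N ->
      exact_at (fun u : chom Q (X i.+2) => D i.+1 \oc u)
               (fun v : chom Q (X i.+1) => D i \oc v)).

Definition condition_b (d : nat) :=
  forall (X : nat -> H0 K) (D : forall i, chom (X i.+1) (X i)),
    P_complex d D -> (exact_on_I d D <-> exact_on_P d D).

Definition arrow : Type := {XY : H0 K * H0 K & chom XY.1 XY.2}.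
Definition Arrow (X Y : H0 K) (f : chom X Y) : arrow :=
  existT (fun XY : H0 K * H0 K => chom XY.1 XY.2 : Type) (X, Y) f.

(* Each morphism of P is the last differential of a complex that is exact on P.
   This is of interest for d >= 1 only: for d = 0 the complexes have no
   term X 1 in P. *)
Definition completable (d : nat) :=
  forall (P1 P0 : H0 K) (f : chom P1 P0), P P1 -> P P0 ->
    exists (X : nat -> H0 K) (D : forall i, chom (X i.+1) (X i)),
      [/\ Arrow (D 0%N) = Arrow f, P_complex d D & exact_on_P d D].

End Precluster.

(* Main.v *)
(* Every X in B' is resolved by triangles V -> Q -> X with Q in P, and splicing d + 1 of
   them gives a complex 0 -> K_{d+1} -> P_d -> ... -> P_0.  By the long exact sequences,
   such a complex is exact on I iff Ext^i(X, I) = 0 for i > 0, and exact on P iff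
   Ext^{-i}(P, X) = 0 for i > 0.

   If B' is abelian with the triangles as short exact sequences, then P consists of
   projectives and covers the kernels, which gives weak kernels; the cone of a
   monomorphism lies in B', so the complexes that are exact on P are resolutions; and the
   cokernels in B' of the morphisms of P give the density of F.  Conversely, (a), (b) and
   (c) make P a class of enough projectives of B' with weak kernels and with cokernels
   that are computed on P.  Exactness can then be tested on P, whence B' is abelian.  The
   pushout of a triangle V -> Q -> Z over P along V -> X is an extension of Z by X in B',
   so by the five lemma every short exact sequence X -> Y -> Z is a triangle.

   Schanuel's lemma enters the last equivalence only, to find the term K_{d+1} of a
   complex whose terms P_1 and P_0 are prescribed. *)
From mathcomp Require Import all_boot all_order all_algebra.
From mathcomp Require Import zify boolp.
(* Imported after boolp, whose cid would otherwise hide the identity morphisms. *)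
Require Import Defs.
Set Implicit Arguments.
Unset Strict Implicit.
Unset Printing Implicit Defensive.
Import GRing.Theory.
Local Open Scope ring_scope.

(** Triangles are represented by sequences that split as graded ones and are governed by a
    connecting cocycle. Octahedra, rotations and pushouts then become explicit matrices, and only
    the middle term is taken up to isomorphism. Of twisted complexes nothing but strict shifts and
    cones enters.

    Condition (b) turns the vanishing of Ext^i(Z, I) into that of Ext^{-i}(P, Z). Dimension shifting
    along covers extends the latter to Ext^{-i}(Y, Z) for all Y in B', since towers are bounded, and
    this puts B' in degree zero.

    Condition (c) is used as density of F, in the form that every morphism of P has an object of B'
    as its cokernel on P. The obstacle in passing from there to complexes is that the kernels of
    prescribed covers are known to lie in a tower only up to a complement in P. From a tower K * ...
    * K[n] with n >= 1 such a complement can be removed by enlarging the kernel of a cover; for K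
    itself closure under summands is assumed. Two kernels are taken, starting at level d + 1, so the
    critical level is d - 1: this explains the case distinction between d >= 2 and d = 1. *)

Ltac move_to_end t := try rewrite [t + _]addrC; repeat rewrite [_ + t + _]addrAC.
Ltac cancel_opposites := match goal with |- context [- ?t] =>
  move_to_end (- t); move_to_end t; first [rewrite subrK | rewrite addNr ?add0r] end.
(** For identities in abelian groups whose sides differ by the order of the terms and by pairs of
    opposite terms. *)
Ltac abel := apply/eqP; rewrite -subr_eq0; try rewrite !(opprD, opprK, oppr0);
  rewrite ?addrA; repeat cancel_opposites; exact: eqxx.

(** * Split sequences in dg categories *)

Section DegreeZero.
Variables (k : comPzRingType) (A : dgcat k).
Implicit Types X Y Z T : A.

Lemma dcomp_irr X Y Z i j n (e e' : i + j = n) (f : dhom Y Z i) (g : dhom X Y j) :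
  dcomp e f g = dcomp e' f g.
Proof. by rewrite (Prop_irrelevance e e'). Qed.

Lemma diff_irr X Y i j (e e' : i + 1 = j) (f : dhom X Y i) : diff e f = diff e' f.
Proof. by rewrite (Prop_irrelevance e e'). Qed.

(* Composition with morphisms of degree 0, stated so that the degree of the other
   factor does not change its index. *)
Definition lcomp X Y Z n (f : dhom Y Z 0) (z : dhom X Y n) : dhom X Z n :=
  dcomp (add0r n) f z.
Definition rcomp X Y Z n (z : dhom Y Z n) (f : dhom X Y 0) : dhom X Z n :=
  dcomp (addr0 n) z f.
Definition one X : dhom X X 0 := dunit X erefl.
Definition D0 X Y (f : dhom X Y 0) : dhom X Y 1 := diff (add0r 1) f.

End DegreeZero.

Notation "f <* z" := (lcomp f z) (at level 40, left associativity).
Notation "z *> f" := (rcomp z f) (at level 40, left associativity).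
Arguments one {k A} X.

Section DegreeZeroTheory.
Variables (k : comPzRingType) (A : dgcat k).
Implicit Types X Y Z T : A.

Lemma lcompA X Y Z T n (f : dhom Z T 0) (g : dhom Y Z 0) (z : dhom X Y n) :
  f <* (g <* z) = f <* g <* z.
Proof. by rewrite /lcomp (dcompA (add0r 0) (add0r n) (add0r n) (add0r n)). Qed.

Lemma rcompA X Y Z T n (z : dhom Z T n) (f : dhom Y Z 0) (g : dhom X Y 0) :
  z *> f *> g = z *> (f <* g).
Proof. by rewrite /rcomp /lcomp (dcompA (addr0 n) (addr0 n) (add0r 0) (addr0 n)). Qed.

Lemma lrcompA X Y Z T n (f : dhom Z T 0) (z : dhom Y Z n) (g : dhom X Y 0) :
  f <* z *> g = f <* (z *> g).
Proof. by rewrite /rcomp /lcomp (dcompA (add0r n) (addr0 n) (addr0 n) (add0r n)). Qed.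

Lemma rlcomp X Y Z (f : dhom Y Z 0) (g : dhom X Y 0) : f *> g = f <* g.
Proof. exact: dcomp_irr. Qed.

Lemma lcomp1 X Y n (z : dhom X Y n) : one Y <* z = z.
Proof. exact: dcomp1l. Qed.
Lemma rcomp1 X Y n (z : dhom X Y n) : z *> one X = z.
Proof. exact: dcomp1r. Qed.
Lemma comp01 X Y (z : dhom X Y 0) : z <* one X = z.
Proof. by rewrite -rlcomp rcomp1. Qed.

Lemma lcomp0 X Y Z n (f : dhom Y Z 0) : f <* (0 : dhom X Y n) = 0.
Proof. exact: dcomp0r. Qed.
Lemma comp0l X Y Z n (z : dhom X Y n) : (0 : dhom Y Z 0) <* z = 0.
Proof. exact: dcomp0l. Qed.
Lemma rcomp0 X Y Z n (f : dhom X Y 0) : (0 : dhom Y Z n) *> f = 0.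
Proof. exact: dcomp0l. Qed.
Lemma comp0r X Y Z n (z : dhom Y Z n) : z *> (0 : dhom X Y 0) = 0.
Proof. exact: dcomp0r. Qed.
Lemma lcompDr X Y Z n (f : dhom Y Z 0) (z t : dhom X Y n) : f <* (z + t) = f <* z + f <* t.
Proof. exact: dcompDr. Qed.
Lemma lcompNr X Y Z n (f : dhom Y Z 0) (z : dhom X Y n) : f <* (- z) = - (f <* z).
Proof. exact: dcompNr. Qed.
Lemma lcompBr X Y Z n (f : dhom Y Z 0) (z t : dhom X Y n) : f <* (z - t) = f <* z - f <* t.
Proof. by rewrite lcompDr lcompNr. Qed.
Lemma lcompDl X Y Z n (f g : dhom Y Z 0) (z : dhom X Y n) : (f + g) <* z = f <* z + g <* z.
Proof. exact: dcompDl. Qed.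
Lemma lcompNl X Y Z n (f : dhom Y Z 0) (z : dhom X Y n) : (- f) <* z = - (f <* z).
Proof. exact: dcompNl. Qed.
Lemma lcompBl X Y Z n (f g : dhom Y Z 0) (z : dhom X Y n) : (f - g) <* z = f <* z - g <* z.
Proof. by rewrite lcompDl lcompNl. Qed.
Lemma rcompDl X Y Z n (f : dhom X Y 0) (z t : dhom Y Z n) : (z + t) *> f = z *> f + t *> f.
Proof. exact: dcompDl. Qed.
Lemma rcompNl X Y Z n (f : dhom X Y 0) (z : dhom Y Z n) : (- z) *> f = - (z *> f).
Proof. exact: dcompNl. Qed.
Lemma rcompBl X Y Z n (f : dhom X Y 0) (z t : dhom Y Z n) : (z - t) *> f = z *> f - t *> f.
Proof. by rewrite rcompDl rcompNl. Qed.
Lemma rcompDr X Y Z n (f g : dhom X Y 0) (z : dhom Y Z n) : z *> (f + g) = z *> f + z *> g.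
Proof. exact: dcompDr. Qed.
Lemma rcompNr X Y Z n (f : dhom X Y 0) (z : dhom Y Z n) : z *> (- f) = - (z *> f).
Proof. exact: dcompNr. Qed.
Lemma rcompBr X Y Z n (f g : dhom X Y 0) (z : dhom Y Z n) : z *> (f - g) = z *> f - z *> g.
Proof. by rewrite rcompDr rcompNr. Qed.

Lemma dcomp_lc X Y Z T i j n (e : i + j = n) (f : dhom Z T 0) (g : dhom Y Z i) (h : dhom X Y j) :
  f <* dcomp e g h = dcomp e (f <* g) h.
Proof. by rewrite /lcomp (dcompA (add0r i) e e (add0r n)). Qed.
Lemma dcomp_rc X Y Z T i j n (e : i + j = n) (f : dhom Z T i) (g : dhom Y Z j) (h : dhom X Y 0) :
  dcomp e f g *> h = dcomp e f (g *> h).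
Proof. by rewrite /rcomp (dcompA e (addr0 n) (addr0 j) e). Qed.
Lemma dcomp_mid X Y Z T i j n (e : i + j = n) (f : dhom Z T i) (g : dhom Y Z 0) (h : dhom X Y j) :
  dcomp e (f *> g) h = dcomp e f (g <* h).
Proof. by rewrite /rcomp /lcomp (dcompA (addr0 i) e (add0r j) e). Qed.

Lemma diff_lc X Y Z n m (e : n + 1 = m) (e' : 1 + n = m) (f : dhom Y Z 0) (z : dhom X Y n) :
  diff e (f <* z) = dcomp e' (D0 f) z + f <* diff e z.
Proof.
by rewrite /lcomp (leibniz (add0r n) e (add0r 1) e e' (add0r m)) sg0 scale1r.
Qed.
Lemma diff_rc X Y Z n m (e : n + 1 = m) (f : dhom X Y 0) (z : dhom Y Z n) :
  diff e (z *> f) = diff e z *> f + sg k n *: dcomp e z (D0 f).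
Proof.
by rewrite /rcomp (leibniz (addr0 n) e e (add0r 1) (addr0 m) e).
Qed.
Lemma diff_lcc X Y Z n m (e : n + 1 = m) (f : dhom Y Z 0) (z : dhom X Y n) :
  D0 f = 0 -> diff e (f <* z) = f <* diff e z.
Proof. by move=> f0; rewrite (diff_lc e (degl e)) f0 dcomp0l add0r. Qed.
Lemma diff_rcc X Y Z n m (e : n + 1 = m) (f : dhom X Y 0) (z : dhom Y Z n) :
  D0 f = 0 -> diff e (z *> f) = diff e z *> f.
Proof. by move=> f0; rewrite diff_rc f0 dcomp0r scaler0 addr0. Qed.

Lemma D0_comp X Y Z (f : dhom Y Z 0) (g : dhom X Y 0) :
  D0 (f <* g) = D0 f *> g + f <* D0 g.
Proof. by rewrite /D0 (diff_lc _ (addr0 1)). Qed.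
Lemma D0D X Y (f g : dhom X Y 0) : D0 (f + g) = D0 f + D0 g.
Proof. exact: diffD. Qed.
Lemma D0N X Y (f : dhom X Y 0) : D0 (- f) = - D0 f.
Proof. exact: diffN. Qed.
Lemma D0B X Y (f g : dhom X Y 0) : D0 (f - g) = D0 f - D0 g.
Proof. by rewrite D0D D0N. Qed.
Lemma D0_0 X Y : D0 (0 : dhom X Y 0) = 0.
Proof. exact: diff0. Qed.
Lemma D0_one X : D0 (one X) = 0.
Proof. exact: diff1. Qed.

(** Classes are unfolded to cochains here, with the neighbouring degrees as free indices, so that
    later proofs need no transport between degrees. *)
Lemma vanishingP X Y i n m (e : i + 1 = n) (e' : n + 1 = m) :
  vanishing X Y n <->
  forall z : dhom X Y n, diff e' z = 0 -> exists w, z = diff e w.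
Proof.
split=> [v z z0 | v x].
  have zc : z \in @cocycle k A X Y n by rewrite (cocycleP e') z0.
  have : cls (Cocycle zc) = cls 0 by rewrite (v (cls (Cocycle zc))) (v (cls 0)).
  case/cls_eq => i' [e1 [w /= zE]].
  have ei : i' = i by lia.
  by subst i'; exists w; rewrite (diff_irr e e1) -zE subr0.
have [z ->] := clsP x; have [w zE] := v _ (cval_closed e' z).
rewrite -(linf0 (@cls_linear k A X Y n)); apply/cls_eq.
by exists i, e, w; rewrite /= subr0.
Qed.

Lemma cocycle_D0 X Y (f : dhom X Y 0) : D0 f = 0 -> f \in @cocycle k A X Y 0.
Proof. by move=> f0; rewrite (cocycleP (add0r 1)) -/(D0 f) f0. Qed.

(** Closedness is a separate argument, so that the representative can be rewritten and any proof of
    closedness supplied ([hcl_irr]). *)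
Definition hcl X Y (f : dhom X Y 0) (f0 : D0 f = 0) : @chom k (H0 A) X Y :=
  cls (Cocycle (cocycle_D0 f0)).

Lemma hclP X Y (x : @chom k (H0 A) X Y) : exists f (f0 : D0 f = 0), x = hcl f0.
Proof.
have [z ->] := clsP x; exists (cval z), (cval_closed _ z).
by rewrite /hcl; congr cls; apply: cval_inj.
Qed.

Lemma cls_hcl X Y (z : cocycles X Y 0) (z0 : D0 (cval z) = 0) : cls z = hcl z0.
Proof. by rewrite /hcl; congr cls; apply: cval_inj. Qed.

Lemma hcl_eq X Y (f g : dhom X Y 0) (f0 : D0 f = 0) (g0 : D0 g = 0) :
  hcl f0 = hcl g0 <-> exists h : dhom X Y (- 1), f - g = diff (addNr 1) h.
Proof.
rewrite /hcl; split.
  case/cls_eq => m [e [h /= E]]; have em : m = -1 by lia.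
  by subst m; exists h; rewrite E; apply: diff_irr.
by case=> h E; apply/cls_eq; exists (-1), (addNr 1), h.
Qed.

Lemma hcl_irr X Y (f g : dhom X Y 0) (f0 : D0 f = 0) (g0 : D0 g = 0) :
  f = g -> hcl f0 = hcl g0.
Proof. by move=> E; subst g; rewrite (Prop_irrelevance f0 g0). Qed.

Lemma hcl_eq0 X Y (f : dhom X Y 0) (f0 : D0 f = 0) :
  hcl f0 = 0 <-> exists h : dhom X Y (- 1), f = diff (addNr 1) h.
Proof.
have z0 : hcl (D0_0 X Y) = 0.
  rewrite -[RHS](linf0 (@cls_linear k A X Y 0)) /hcl; congr cls.
  exact: cval_inj.
by rewrite -z0 hcl_eq; split=> -[h]; rewrite ?subr0 => E; exists h; rewrite ?subr0.
Qed.

Lemma D0_comp0 X Y Z (f : dhom Y Z 0) (g : dhom X Y 0) :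
  D0 f = 0 -> D0 g = 0 -> D0 (f <* g) = 0.
Proof. by move=> f0 g0; rewrite D0_comp f0 g0 rcomp0 lcomp0 addr0. Qed.

Lemma hcl_comp X Y Z (f : dhom Y Z 0) (g : dhom X Y 0)
    (f0 : D0 f = 0) (g0 : D0 g = 0) (fg0 : D0 (f <* g) = 0) :
  hcl f0 \oc hcl g0 = hcl fg0.
Proof.
apply: etrans (cls_comp _ _) _; rewrite /hcl; congr cls; apply: cval_inj.
exact: rlcomp.
Qed.

Lemma hcl_id X (h : D0 (one X) = 0) : hcl h = cid (X : H0 A).
Proof. by rewrite /= /hcl; congr cls; apply: cval_inj. Qed.

Lemma hclD X Y (f g : dhom X Y 0) (f0 : D0 f = 0) (g0 : D0 g = 0)
  (h : D0 (f + g) = 0) : hcl h = hcl f0 + hcl g0.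
Proof. by rewrite /hcl -clsD; congr cls; apply: cval_inj. Qed.

Lemma hclN X Y (f : dhom X Y 0) (f0 : D0 f = 0) (h : D0 (- f) = 0) :
  hcl h = - hcl f0.
Proof.
rewrite /hcl -[RHS](linfN (@cls_linear k A X Y 0)); congr cls.
exact: cval_inj.
Qed.

End DegreeZeroTheory.

Section SplitSequences.
Variables (k : comPzRingType) (A : dgcat k).
Implicit Types X Y Z T : A.

(* Sequences X -> Z -> Y that split as graded sequences, with a retraction [sr] and a
   section [ss] that need not be closed; [sdelta] is the connecting cocycle. *)
Record ses X Z Y := Ses {
  si : dhom X Z 0; sp : dhom Z Y 0; sr : dhom Z X 0; ss : dhom Y Z 0;
  si_closed : D0 si = 0; sp_closed : D0 sp = 0;
  sri : sr <* si = one X; sps : sp <* ss = one Y;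
  spi : sp <* si = 0; srs : sr <* ss = 0;
  sirsp : si <* sr + ss <* sp = one Z }.

Definition sdelta X Z Y (S : ses X Z Y) : dhom Y X 1 := sr S <* D0 (ss S).

Section OneSequence.
Variables (X Z Y : A) (S : ses X Z Y).
Notation i := (si S).
Notation p := (sp S).
Notation r := (sr S).
Notation s := (ss S).
Notation dl := (sdelta S).

Lemma ses_split_l T n (z : dhom T Z n) : z = i <* (r <* z) + s <* (p <* z).
Proof. by rewrite !lcompA -lcompDl sirsp lcomp1. Qed.
Lemma ses_split_r T n (z : dhom Z T n) : z = z *> i *> r + z *> s *> p.
Proof. by rewrite !rcompA -rcompDr sirsp rcomp1. Qed.

Lemma sril T n (z : dhom T X n) : r <* (i <* z) = z.
Proof. by rewrite lcompA sri lcomp1. Qed.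
Lemma spil T n (z : dhom T X n) : p <* (i <* z) = 0.
Proof. by rewrite lcompA spi comp0l. Qed.
Lemma spsl T n (z : dhom T Y n) : p <* (s <* z) = z.
Proof. by rewrite lcompA sps lcomp1. Qed.
Lemma srsl T n (z : dhom T Y n) : r <* (s <* z) = 0.
Proof. by rewrite lcompA srs comp0l. Qed.
Lemma srir T n (z : dhom X T n) : z *> r *> i = z.
Proof. by rewrite rcompA sri rcomp1. Qed.
Lemma spir T n (z : dhom Y T n) : z *> p *> i = 0.
Proof. by rewrite rcompA spi comp0r. Qed.
Lemma spsr T n (z : dhom Y T n) : z *> p *> s = z.
Proof. by rewrite rcompA sps rcomp1. Qed.

(** Since [p <* s] is the identity, p kills the differential of s, which therefore comes from X; the
    retraction reads it off. *)
Lemma D0_ss : D0 s = i <* dl.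
Proof.
rewrite [LHS](ses_split_l) -/dl.
have : D0 (p <* s) = 0 by rewrite sps D0_one.
by rewrite D0_comp sp_closed rcomp0 add0r => ->; rewrite lcomp0 addr0.
Qed.

(** The sign comes from differentiating [r <* s = 0]. *)
Lemma D0_sr : D0 r = - (dl *> p).
Proof.
rewrite [LHS](ses_split_r).
have : D0 (r <* i) = 0 by rewrite sri D0_one.
rewrite D0_comp si_closed lcomp0 addr0 => ->; rewrite rcomp0 add0r.
have : D0 (r <* s) = 0 by rewrite srs D0_0.
by rewrite D0_comp => /eqP; rewrite addr_eq0 => /eqP ->; rewrite rcompNl.
Qed.

Lemma sdelta_closed m (e : 1 + 1 = m) : diff e dl = 0.
Proof.
rewrite -[LHS]sril -(diff_lcc e _ (si_closed S)) -D0_ss.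
by rewrite /D0 diffK lcomp0.
Qed.

Lemma sr_delta T n m (e : 1 + n = m) (z : dhom T Y n) :
  dcomp e (D0 s) z = i <* dcomp e dl z.
Proof. by rewrite D0_ss dcomp_lc. Qed.

(** Cochain form of exactness at the middle term: subtracting the boundary of [s <* b] makes z
    vanish strictly under p, and then z factors through i. *)
Lemma ses_lift_mid T m n (e : m + 1 = n) n' (e' : n + 1 = n') (z : dhom T Z n) b :
  diff e' z = 0 -> p <* z = diff e b ->
  exists2 a, diff e' a = 0 & exists w, z = i <* a + diff e w.
Proof.
move=> z0 zb; exists (r <* (z - diff e (s <* b))).
  rewrite -[LHS]sril -(diff_lcc e' _ (si_closed S)).
  rewrite (_ : i <* _ = z - diff e (s <* b)); last first.
    rewrite [RHS]ses_split_l [X in _ = _ + s <* X](_ : _ = 0) ?lcomp0 ?addr0 //.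
    by rewrite lcompBr -(diff_lcc e _ (sp_closed S)) spsl zb subrr.
  by rewrite diffD diffN diffK z0 subr0 lcomp0.
exists (s <* b); apply/eqP; rewrite -subr_eq; apply/eqP.
rewrite [LHS]ses_split_l [X in _ + s <* X](_ : _ = 0) ?lcomp0 ?addr0 //.
by rewrite lcompBr -(diff_lcc e _ (sp_closed S)) spsl zb subrr.
Qed.

(** The lift [s <* b] fails to be closed by i applied to the connecting image of b, and a corrects
    this. *)
Lemma ses_lift_r T n m (e : n + 1 = m) (e1 : 1 + n = m) (b : dhom T Y n) a :
  diff e b = 0 -> dcomp e1 dl b = diff e a ->
  exists2 z, diff e z = 0 & p <* z = b.
Proof.
move=> b0 ba; exists (s <* b - i <* a).
  rewrite diffD diffN (diff_lc e e1) b0 lcomp0 addr0 sr_delta ba.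
  by rewrite (diff_lcc e _ (si_closed S)) subrr.
by rewrite lcompBr spsl spil subr0.
Qed.

Lemma ses_lift_l T n m (e : n + 1 = m) (e1 : 1 + n = m) m' (e' : m + 1 = m')
    (a : dhom T X m) z :
  i <* a = diff e z ->
  exists2 b, diff e b = 0 & exists w, a = dcomp e1 dl b + diff e w.
Proof.
move=> az; exists (p <* z).
  by rewrite (diff_lcc e _ (sp_closed S)) -az spil.
exists (r <* z); rewrite -[LHS]sril az [in diff e z](ses_split_l z).
rewrite diffD (diff_lcc e _ (si_closed S)) (diff_lc e e1 s) sr_delta.
by rewrite !lcompDr !sril srsl addr0 addrC.
Qed.

(** Dual correction, for morphisms out of the sequence: after subtracting the boundary of [b *> r],
    z vanishes on X and factors through p. *)
Lemma ses_ext_mid T m n (e : m + 1 = n) n' (e' : n + 1 = n') (z : dhom Z T n) b :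
  diff e' z = 0 -> z *> i = diff e b ->
  exists2 a, diff e' a = 0 & exists w, z = a *> p + diff e w.
Proof.
move=> z0 zb; have E : (z - diff e (b *> r)) *> i = 0.
  by rewrite rcompBl -(diff_rcc e _ (si_closed S)) srir zb subrr.
exists ((z - diff e (b *> r)) *> s).
  rewrite -[LHS]spsr -(diff_rcc e' _ (sp_closed S)).
  rewrite (_ : _ *> p = z - diff e (b *> r)); last first.
    by rewrite [RHS]ses_split_r E rcomp0 add0r.
  by rewrite diffD diffN diffK z0 subr0 rcomp0.
exists (b *> r); apply/eqP; rewrite -subr_eq; apply/eqP.
by rewrite [LHS]ses_split_r E rcomp0 add0r.
Qed.

Lemma ses_ext_l T n m (e : n + 1 = m) (a : dhom X T n) c :
  diff e a = 0 -> dcomp e a dl = diff e c ->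
  exists2 z, diff e z = 0 & z *> i = a.
Proof.
move=> a0 ac; exists (a *> r + sg k n *: (c *> p)).
  rewrite diffD diffZ diff_rc a0 rcomp0 add0r D0_sr dcompNr -dcomp_rc ac.
  by rewrite (diff_rcc e _ (sp_closed S)) scalerN addNr.
by rewrite rcompDl srir /rcomp dcompZl -/(rcomp _ _) -/(rcomp _ _) spir scaler0 addr0.
Qed.

Lemma ses_ext_r T n m (e : n + 1 = m) (a : dhom Y T m) z :
  a *> p = diff e z ->
  exists2 c, diff e c = 0 & exists w, a = dcomp e c dl + diff e w.
Proof.
move=> az; exists (- (sg k n *: (z *> i))).
  by rewrite diffN diffZ (diff_rcc e _ (si_closed S)) -az spir scaler0 oppr0.
exists (z *> s); rewrite -[LHS]spsr az diff_rc D0_ss -dcomp_mid dcompNl dcompZl.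
by rewrite addrC addrK.
Qed.

End OneSequence.

(* The map is [[a, -h], [0, b]] in terms of the splittings. *)
Lemma ses_map X Z Y X' Z' Y' (S : ses X Z Y) (S' : ses X' Z' Y')
    (a : dhom X X' 0) (b : dhom Y Y' 0) (h : dhom Y X' 0) :
  D0 a = 0 -> D0 b = 0 -> sdelta S' *> b - a <* sdelta S = D0 h ->
  exists2 f : dhom Z Z' 0, D0 f = 0 &
    f <* si S = si S' <* a /\ sp S' <* f = b <* sp S.
Proof.
move=> a0 b0 dh.
exists (si S' <* a <* sr S + ss S' <* b <* sp S - si S' <* h <* sp S).
  rewrite D0B D0D !D0_comp !si_closed !sp_closed a0 b0 D0_sr D0_ss -dh.
  rewrite !rcomp0 !lcomp0 !add0r !addr0 !rcomp0 add0r.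
  rewrite lcompNr !lcompBr !rcompBl !lrcompA -!lcompA.
  by rewrite opprB addrACA addNr add0r subrr.
rewrite lcompBl lcompDl lcompBr lcompDr -!lcompA.
rewrite sri spi !lcomp0 subr0 addr0 !spil spsl subr0 add0r.
by rewrite comp01.
Qed.

End SplitSequences.

(** * Isomorphisms and biproducts in linear categories *)

Section LinearCategories.
Variables (k : comPzRingType) (C : lincat k).
Implicit Types X Y Z T : C.

Lemma ccompDl X Y Z (f g : chom Y Z) (h : chom X Y) : (f + g) \oc h = f \oc h + g \oc h.
Proof. exact: (linfD (ccomp_linl h)). Qed.
Lemma ccompDr X Y Z (f : chom Y Z) (g h : chom X Y) : f \oc (g + h) = f \oc g + f \oc h.
Proof. exact: (linfD (ccomp_linr f)). Qed.
Lemma ccompNl X Y Z (f : chom Y Z) (h : chom X Y) : (- f) \oc h = - (f \oc h).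
Proof. exact: (linfN (ccomp_linl h)). Qed.
Lemma ccompNr X Y Z (f : chom Y Z) (h : chom X Y) : f \oc (- h) = - (f \oc h).
Proof. exact: (linfN (ccomp_linr f)). Qed.
Lemma ccompBl X Y Z (f g : chom Y Z) (h : chom X Y) : (f - g) \oc h = f \oc h - g \oc h.
Proof. exact: (linfB (ccomp_linl h)). Qed.
Lemma ccompBr X Y Z (f : chom Y Z) (g h : chom X Y) : f \oc (g - h) = f \oc g - f \oc h.
Proof. exact: (linfB (ccomp_linr f)). Qed.
Lemma ccomp0l X Y Z (h : chom X Y) : (0 : chom Y Z) \oc h = 0.
Proof. exact: (linf0 (ccomp_linl h)). Qed.
Lemma ccomp0r X Y Z (f : chom Y Z) : f \oc (0 : chom X Y) = 0.
Proof. exact: (linf0 (ccomp_linr f)). Qed.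

Lemma is_inverse_sym X Y (f : chom X Y) g : is_inverse f g -> is_inverse g f.
Proof. by case. Qed.

Lemma is_iso_id X : is_iso (cid X).
Proof. by exists (cid X); split; rewrite ccomp1l. Qed.

Lemma is_iso_comp X Y Z (f : chom Y Z) (g : chom X Y) :
  is_iso f -> is_iso g -> is_iso (f \oc g).
Proof.
move=> [f' [ff' f'f]] [g' [gg' g'g]]; exists (g' \oc f'); split.
  by rewrite -!ccompA (ccompA g') ff' ccomp1r gg'.
by rewrite -!ccompA (ccompA f) g'g ccomp1r f'f.
Qed.

Lemma is_iso_inverse X Y (f : chom X Y) g : is_inverse f g -> is_iso g.
Proof. by move=> /is_inverse_sym ?; exists f. Qed.

Lemma isomorphic_refl X : isomorphic X X.
Proof. by exists (cid X); apply: is_iso_id. Qed.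
Lemma isomorphic_sym X Y : isomorphic X Y -> isomorphic Y X.
Proof. by move=> [f [g fg]]; exists g; apply: is_iso_inverse fg. Qed.
Lemma isomorphic_trans X Y Z : isomorphic X Y -> isomorphic Y Z -> isomorphic X Z.
Proof. by move=> [f ?] [g ?]; exists (g \oc f); apply: is_iso_comp. Qed.

Lemma is_iso_two_sided X Y (f : chom X Y) (g h : chom Y X) :
  is_iso (g \oc f) -> is_iso (f \oc h) -> is_iso f.
Proof.
move=> [u [u1 u2]] [v [v1 v2]]; exists (u \oc g); split; first by rewrite ccompA.
have E : u \oc g = h \oc v.
  rewrite -[LHS]ccomp1r -v2 -!ccompA [u \oc g \oc f]ccompA u1.
  by rewrite ccomp1l.
by rewrite E -ccompA.
Qed.

Lemma is_iso_unipotent X (f : chom X X) :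
  (f - cid X) \oc (f - cid X) = 0 -> is_iso f.
Proof.
set n := f - cid X => n2; have -> : f = cid X + n by rewrite addrC subrK.
exists (cid X - n); split.
  by rewrite ccompBl ccomp1l ccompDr ccomp1r n2 addr0 addrK.
by rewrite ccompDl ccomp1l ccompBr ccomp1r n2 subr0 subrK.
Qed.

Lemma biproduct_unique X Y Z Z' :
  is_biproduct X Y Z -> is_biproduct X Y Z' -> isomorphic Z Z'.
Proof.
move=> [i [j [p [q [b1 b2 b3 b4 b5]]]]] [i' [j' [p' [q' [c1 c2 c3 c4 c5]]]]].
exists (i' \oc p + j' \oc q), (i \oc p' + j \oc q'); split.
  rewrite ccompDl !ccompDr !ccompA -(ccompA p') -(ccompA p' j') -(ccompA q') -(ccompA q' j').
  by rewrite c1 c2 c3 c4 !ccomp0l !ccomp0r !ccomp1l addr0 add0r.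
rewrite ccompDl !ccompDr !ccompA -(ccompA p) -(ccompA p j) -(ccompA q) -(ccompA q j).
by rewrite b1 b2 b3 b4 !ccomp0l !ccomp0r !ccomp1l addr0 add0r.
Qed.

Lemma biproduct_iso X Y Z X' Y' :
  is_biproduct X Y Z -> isomorphic X X' -> isomorphic Y Y' -> is_biproduct X' Y' Z.
Proof.
move=> [i [j [p [q [b1 b2 b3 b4 b5]]]]] [x [x' [x1 x2]]] [y [y' [y1 y2]]].
exists (i \oc x'), (j \oc y'), (x \oc p), (y \oc q); split.
- by rewrite ccompA -(ccompA p) b1 ccomp1l.
- by rewrite ccompA -(ccompA q) b2 ccomp1l.
- by rewrite ccompA -(ccompA p) b3 ccomp0l ccomp0r.
- by rewrite ccompA -(ccompA q) b4 ccomp0l ccomp0r.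
- by rewrite !ccompA -(ccompA x') x1 -(ccompA y') y1 !ccomp1l.
Qed.

End LinearCategories.

(** * Long exact cohomology sequences *)

Section CohomologyOfSequences.
Variables (k : comPzRingType) (A : dgcat k).
Implicit Types X Y Z T : A.
Notation H := (H0 A).

Lemma diff_closed_r X Y Z i j n i' j' n' (e : i + j = n) (en : n + 1 = n')
    (ei : i + 1 = i') (ej : j + 1 = j') (e1 : i' + j = n')
    (f : dhom Y Z i) (g : dhom X Y j) :
  diff ej g = 0 -> diff en (dcomp e f g) = dcomp e1 (diff ei f) g.
Proof.
move=> g0; have e2 : i + j' = n' by lia.
by rewrite (leibniz e en ei ej e1 e2) g0 dcomp0r scaler0 addr0.
Qed.

Lemma diff_closed_l X Y Z i j n i' j' n' (e : i + j = n) (en : n + 1 = n')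
    (ei : i + 1 = i') (ej : j + 1 = j') (e2 : i + j' = n')
    (f : dhom Y Z i) (g : dhom X Y j) :
  diff ei f = 0 -> diff en (dcomp e f g) = sg k i *: dcomp e2 f (diff ej g).
Proof.
move=> f0; have e1 : i' + j = n' by lia.
by rewrite (leibniz e en ei ej e1 e2) f0 dcomp0l add0r.
Qed.

Arguments diff_closed_r {X Y Z i j n i' j' n'} e en ei ej e1 {f g} _.
Arguments diff_closed_l {X Y Z i j n i' j' n'} e en ei ej e2 {f g} _.

(** If f g - 1 = D h, then a cocycle z equals f (g z) up to the boundary of h z. *)
Lemma vanishing_iso_r T X Y n :
  @isomorphic k H X Y -> vanishing T X n -> vanishing T Y n.
Proof.
move=> [x [y [_ xy]]]; have [f [f0 xE]] := hclP x; have [g [g0 yE]] := hclP y.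
subst x y; move: xy; rewrite (hcl_comp _ _ (D0_comp0 f0 g0)).
rewrite -(hcl_id (D0_one Y)) => /hcl_eq[h hE].
have e : n - 1 + 1 = n by rewrite subrK.
have e1 : -1 + n = n - 1 by rewrite addrC.
move=> /(vanishingP _ _ e erefl) v; apply/(vanishingP _ _ e erefl) => z z0.
have [w wE] : exists w, g <* z = diff e w.
  by apply: v; rewrite diff_lcc // z0 lcomp0.
exists (f <* w - dcomp e1 h z).
rewrite diffD diffN diff_lcc // -wE.
rewrite (diff_closed_r e1 e (addNr 1) erefl (add0r n)) // -hE lcompA.
by rewrite -/(lcomp _ _) lcompBl lcomp1 subKr.
Qed.

Lemma vanishing_iso_l T X Y n :
  @isomorphic k H X Y -> vanishing X T n -> vanishing Y T n.
Proof.
move=> [x [y [_ xy]]]; have [f [f0 xE]] := hclP x; have [g [g0 yE]] := hclP y.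
subst x y; move: xy; rewrite (hcl_comp _ _ (D0_comp0 f0 g0)).
rewrite -(hcl_id (D0_one Y)) => /hcl_eq[h hE].
have e : n - 1 + 1 = n by rewrite subrK.
move=> /(vanishingP _ _ e erefl) v; apply/(vanishingP _ _ e erefl) => z z0.
have [w wE] : exists w, z *> f = diff e w.
  by apply: v; rewrite diff_rcc // z0 rcomp0.
have e1 : n + -1 = n - 1 by [].
exists (w *> g - sg k n *: dcomp e1 z h).
rewrite diffD diffN diffZ diff_rcc // -wE.
rewrite (diff_closed_l e1 e erefl (addNr 1) (addr0 n)) // -hE scalerA sgK scale1r.
by rewrite rcompA -/(rcomp _ _) rcompBr rcomp1 subKr.
Qed.

Variables (X Z Y : A) (S : ses X Z Y).
Notation i := (si S).
Notation p := (sp S).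
Notation r := (sr S).
Notation s := (ss S).
Notation dl := (sdelta S).

Definition ci : @chom k H X Z := hcl (si_closed S).
Definition cp : @chom k H Z Y := hcl (sp_closed S).

Lemma cp_ci : cp \oc ci = 0.
Proof.
rewrite (hcl_comp _ _ (D0_comp0 (sp_closed S) (si_closed S))).
by apply/hcl_eq0; exists 0; rewrite diff0 spi.
Qed.

(** In the names [van_a_b], a is the term at which the cohomology vanishes, and b is the side on
    which the test object T stands. *)
Lemma van_mid_l T n : vanishing T X n -> vanishing T Y n -> vanishing T Z n.
Proof.
have e : n - 1 + 1 = n by rewrite subrK.
move=> /(vanishingP _ _ e erefl) vX /(vanishingP _ _ e erefl) vY.
apply/(vanishingP _ _ e erefl) => z z0.
have [|b bE] := vY (p <* z); first by rewrite (diff_lcc _ _ (sp_closed S)) z0 lcomp0.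
have [a /vX[w wE] [t ->]] := ses_lift_mid z0 bE.
by exists (i <* w + t); rewrite diffD (diff_lcc _ _ (si_closed S)) -wE.
Qed.

Lemma van_l_l T n m : m + 1 = n -> vanishing T Z n -> vanishing T Y m -> vanishing T X n.
Proof.
move=> e /(vanishingP _ _ e erefl) vZ.
have e' : m - 1 + 1 = m by rewrite subrK.
move=> /(vanishingP _ _ e' e) vY; apply/(vanishingP _ _ e erefl) => a a0.
have [|z zE] := vZ (i <* a); first by rewrite (diff_lcc _ _ (si_closed S)) a0 lcomp0.
have e1 : 1 + m = n by rewrite addrC.
have [b /vY[w ->] [t ->]] := ses_lift_l e1 erefl zE.
have e2 : 1 + (m - 1) = m by rewrite addrC.
exists (- dcomp e2 dl w + t); rewrite diffD diffN.
rewrite (diff_closed_l e2 e (erefl (1 + 1)) e' e1) ?sdelta_closed //.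
by rewrite (sgS k (add0r 1)) sg0 scaleN1r opprK.
Qed.

Lemma van_r_l T n m : n + 1 = m -> vanishing T Z n -> vanishing T X m -> vanishing T Y n.
Proof.
move=> e; have e' : n - 1 + 1 = n by rewrite subrK.
move=> /(vanishingP _ _ e' e) vZ /(vanishingP _ _ e erefl) vX.
apply/(vanishingP _ _ e' e) => b b0.
have e1 : 1 + n = m by rewrite addrC.
have [|a aE] := vX (dcomp e1 dl b).
  have e2 : 1 + m = m + 1 by rewrite addrC.
  rewrite (diff_closed_l e1 erefl (erefl (1 + 1)) e e2) ?sdelta_closed //.
  by rewrite b0 dcomp0r scaler0.
have [z z0 <-] := ses_lift_r b0 aE.
by have [w ->] := vZ _ z0; exists (p <* w); rewrite (diff_lcc _ _ (sp_closed S)).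
Qed.

Lemma van_mid_r T n : vanishing X T n -> vanishing Y T n -> vanishing Z T n.
Proof.
have e : n - 1 + 1 = n by rewrite subrK.
move=> /(vanishingP _ _ e erefl) vX /(vanishingP _ _ e erefl) vY.
apply/(vanishingP _ _ e erefl) => z z0.
have [|b bE] := vX (z *> i); first by rewrite (diff_rcc _ _ (si_closed S)) z0 rcomp0.
have [a /vY[w wE] [t ->]] := ses_ext_mid z0 bE.
by exists (w *> p + t); rewrite diffD (diff_rcc _ _ (sp_closed S)) -wE.
Qed.

Lemma van_r_r T n m : m + 1 = n -> vanishing Z T n -> vanishing X T m -> vanishing Y T n.
Proof.
move=> e /(vanishingP _ _ e erefl) vZ.
have e' : m - 1 + 1 = m by rewrite subrK.
move=> /(vanishingP _ _ e' e) vX; apply/(vanishingP _ _ e erefl) => a a0.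
have [|z zE] := vZ (a *> p); first by rewrite (diff_rcc _ _ (sp_closed S)) a0 rcomp0.
have [c /vX[w ->] [t ->]] := ses_ext_r zE.
exists (dcomp e' w dl + t); rewrite diffD.
by rewrite (diff_closed_r e' e e' (erefl (1 + 1)) e) // sdelta_closed.
Qed.

Lemma van_l_r T n m : n + 1 = m -> vanishing Z T n -> vanishing Y T m -> vanishing X T n.
Proof.
move=> e; have e' : n - 1 + 1 = n by rewrite subrK.
move=> /(vanishingP _ _ e' e) vZ /(vanishingP _ _ e erefl) vY.
apply/(vanishingP _ _ e' e) => a a0.
have [|c cE] := vY (dcomp e a dl).
  by rewrite (diff_closed_r e erefl e (erefl (1 + 1)) erefl) ?sdelta_closed // a0 dcomp0l.
have [z z0 <-] := ses_ext_l a0 cE.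
by have [w ->] := vZ _ z0; exists (w *> i); rewrite (diff_rcc _ _ (si_closed S)).
Qed.

Lemma cp_surj T : vanishing T X 1 -> forall b : @chom k H T Y, exists z, b = cp \oc z.
Proof.
move=> /(vanishingP _ _ (add0r 1) erefl) v x; have [b [b0 ->]] := hclP x.
have [|a aE] := v (dcomp (addr0 1) dl b).
  rewrite (diff_closed_l _ _ (erefl (1 + 1)) (add0r 1) erefl) ?sdelta_closed //.
  by rewrite -/(D0 b) b0 dcomp0r scaler0.
have [z z0 zb] := ses_lift_r b0 aE.
exists (hcl z0); rewrite (hcl_comp _ _ (D0_comp0 (sp_closed S) z0)).
exact: hcl_irr.
Qed.

Lemma ci_cosurj T : vanishing Y T 1 -> forall b : @chom k H X T, exists z, b = z \oc ci.
Proof.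
move=> /(vanishingP _ _ (add0r 1) erefl) v x; have [b [b0 ->]] := hclP x.
have [|a aE] := v (dcomp (add0r 1) b dl).
  by rewrite (diff_closed_r _ _ (add0r 1) (erefl (1 + 1)) erefl)
    ?sdelta_closed // -/(D0 b) b0 dcomp0l.
have [z z0 zb] := ses_ext_l b0 aE.
exists (hcl z0); rewrite (hcl_comp _ _ (D0_comp0 z0 (si_closed S))).
by apply: hcl_irr; rewrite -rlcomp.
Qed.

Lemma cp_exact T (z : @chom k H T Z) : cp \oc z = 0 -> exists a, z = ci \oc a.
Proof.
have [f [f0 ->]] := hclP z.
rewrite (hcl_comp _ _ (D0_comp0 (sp_closed S) f0)) => /hcl_eq0[h hE].
have [a a0 [w wE]] := ses_lift_mid f0 hE.
exists (hcl a0); rewrite (hcl_comp _ _ (D0_comp0 (si_closed S) a0)).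
by apply/hcl_eq; exists w; rewrite wE addrC addKr.
Qed.

Lemma ci_coexact T (z : @chom k H Z T) : z \oc ci = 0 -> exists b, z = b \oc cp.
Proof.
have [f [f0 ->]] := hclP z.
rewrite (hcl_comp _ _ (D0_comp0 f0 (si_closed S))) => /hcl_eq0[h]; rewrite -rlcomp => hE.
have [a a0 [w wE]] := ses_ext_mid f0 hE.
exists (hcl a0); rewrite (hcl_comp _ _ (D0_comp0 a0 (sp_closed S))).
by apply/hcl_eq; exists w; rewrite wE rlcomp addrC addKr.
Qed.

Lemma ci_inj T : vanishing T Y (- 1) -> forall a : @chom k H T X, ci \oc a = 0 -> a = 0.
Proof.
have e : -2 + 1 = -1 :> int by [].
move=> /(vanishingP _ _ e (addNr 1)) v x; have [a [a0 ->]] := hclP x.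
rewrite (hcl_comp _ _ (D0_comp0 (si_closed S) a0)) => /hcl_eq0[z zE].
have [b /v[w wE] [t tE]] := ses_lift_l (subrr 1) (add0r 1) zE.
have e2 : 1 + -2 = -1 :> int by [].
apply/hcl_eq0; exists (- dcomp e2 dl w + t); rewrite tE wE diffD diffN.
rewrite (diff_closed_l e2 (addNr 1) (erefl (1 + 1)) e (subrr 1)) ?sdelta_closed //.
by rewrite (sgS k (add0r 1)) sg0 scaleN1r opprK.
Qed.

Lemma cp_coinj T : vanishing X T (- 1) -> forall c : @chom k H Y T, c \oc cp = 0 -> c = 0.
Proof.
have e : -2 + 1 = -1 :> int by [].
move=> /(vanishingP _ _ e (addNr 1)) v x; have [a [a0 ->]] := hclP x.
rewrite (hcl_comp _ _ (D0_comp0 a0 (sp_closed S))) => /hcl_eq0[z]; rewrite -rlcomp => zE.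
have [c /v[w wE] [t tE]] := ses_ext_r zE.
apply/hcl_eq0; exists (dcomp e w dl + t); rewrite tE wE diffD.
by rewrite (diff_closed_r e (addNr 1) e (erefl (1 + 1)) (addNr 1)) // sdelta_closed.
Qed.

(** The connecting map sends H^{-1}(T, Y) into the kernel of composition with [ci]. If that kernel
    is zero, every class comes from H^{-1}(T, Z). *)
Lemma van_of_ci_inj T : (forall a : @chom k H T X, ci \oc a = 0 -> a = 0) ->
  vanishing T Z (- 1) -> vanishing T Y (- 1).
Proof.
have e : -2 + 1 = -1 :> int by [].
move=> inj /(vanishingP _ _ e (addNr 1)) v; apply/(vanishingP _ _ e (addNr 1)) => b b0.
have f0 : D0 (dcomp (subrr 1) dl b) = 0.
  rewrite /D0 (diff_closed_l (subrr 1) (add0r 1) (erefl (1 + 1)) (addNr 1) (addr0 1)).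
    by rewrite b0 dcomp0r scaler0.
  exact: sdelta_closed.
have /hcl_eq0[a aE] : hcl f0 = 0.
  apply: inj; rewrite (hcl_comp _ _ (D0_comp0 (si_closed S) f0)).
  apply/hcl_eq0; exists (s <* b).
  by rewrite (diff_lc _ (subrr 1)) b0 lcomp0 addr0 sr_delta.
have [z /v[w ->] <-] := ses_lift_r b0 aE.
by exists (p <* w); rewrite (diff_lcc _ _ (sp_closed S)).
Qed.

Lemma van_of_ci_cosurj T : (forall a : @chom k H X T, exists z, a = z \oc ci) ->
  vanishing Z T 1 -> vanishing Y T 1.
Proof.
move=> sur /(vanishingP _ _ (add0r 1) erefl) v.
apply/(vanishingP _ _ (add0r 1) erefl) => a a0.
have [|z zE] := v (a *> p); first by rewrite (diff_rcc _ _ (sp_closed S)) a0 rcomp0.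
have [c c0 [w ->]] := ses_ext_r zE.
have [y] := sur (hcl c0); have [f [f0 ->]] := hclP y.
rewrite (hcl_comp _ _ (D0_comp0 f0 (si_closed S))) => /hcl_eq[h hE].
(* As D s = i dl, the morphism [f <* s] is a primitive of f i dl. The morphism f extends c up to the
   homotopy h, and the term with h repairs the difference. *)
exists (f <* s + dcomp (addNr 1) h dl + w); rewrite !diffD; congr (_ + _).
rewrite (diff_lcc _ _ f0) -/(D0 s) D0_ss lcompA.
rewrite (diff_closed_r (addNr 1) (add0r 1) (addNr 1) (erefl (1 + 1)) (add0r 1)) ?sdelta_closed //.
by rewrite -hE -[dcomp _ (c - _) dl]/(lcomp (c - _) dl) lcompBl addrC subrK.
Qed.

Lemma van_of_cp_surj T : (forall b : @chom k H T Y, exists z, b = cp \oc z) ->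
  vanishing T Z 1 -> vanishing T X 1.
Proof.
move=> sur /(vanishingP _ _ (add0r 1) erefl) v.
apply/(vanishingP _ _ (add0r 1) erefl) => a a0.
have [|z zE] := v (i <* a); first by rewrite (diff_lcc _ _ (si_closed S)) a0 lcomp0.
have [b b0 [w ->]] := ses_lift_l (addr0 1) erefl zE.
have [y] := sur (hcl b0); have [f [f0 ->]] := hclP y.
rewrite (hcl_comp _ _ (D0_comp0 (sp_closed S) f0)) => /hcl_eq[h hE].
exists (- (r <* f) - dcomp (subrr 1) dl h + w); rewrite !diffD; congr (_ + _).
rewrite !diffN -[diff _ (r <* f)]/(D0 (r <* f)) D0_comp f0 lcomp0 addr0 D0_sr.
rewrite rcompNl opprK rcompA.
rewrite (diff_closed_l (subrr 1) (add0r 1) (erefl (1 + 1)) (addNr 1) (addr0 1)) ?sdelta_closed //.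
rewrite (sgS k (add0r 1)) sg0 scaleN1r opprK -hE -[dcomp _ dl (b - _)]/(rcomp dl (b - _)) rcompBr.
by rewrite addrC subrK.
Qed.

End CohomologyOfSequences.

Arguments diff_closed_r {k A X Y Z i j n i' j' n'} e en ei ej e1 {f g} _.
Arguments diff_closed_l {k A X Y Z i j n i' j' n'} e en ei ej e2 {f g} _.

(** * Closed isomorphisms of arbitrary degree *)

Section HomogeneousIsomorphisms.
Variables (k : comPzRingType) (A : dgcat k).
Implicit Types X Y Z T : A.

Lemma closed_dcomp X Y Z i j n (e : i + j = n) (f : dhom Y Z i) (g : dhom X Y j) :
  (forall m (e : i + 1 = m), diff e f = 0) -> (forall m (e : j + 1 = m), diff e g = 0) ->
  forall m (e' : n + 1 = m), diff e' (dcomp e f g) = 0.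
Proof.
move=> f0 g0 m e'; have e1 : i + 1 + j = m by lia.
by rewrite (diff_closed_r e e' erefl erefl e1) // f0 dcomp0l.
Qed.

Lemma D0_closed X Y (f : dhom X Y 0) m (e : 0 + 1 = m) : D0 f = 0 -> diff e f = 0.
Proof. by move=> f0; case: m / e; rewrite (diff_irr _ (add0r 1)). Qed.

(** The inverse is strict and not only an inverse up to homotopy. The case in mind is the canonical
    X -> X[n], of degree -n. *)
Record hiso (a b : int) X Y := Hiso {
  hdeg : b + a = 0;
  hu : dhom X Y a; hv : dhom Y X b;
  hu_closed : forall m (e : a + 1 = m), diff e hu = 0;
  hv_closed : forall m (e : b + 1 = m), diff e hv = 0;
  hvu : forall n (e : b + a = n) (e0 : n = 0), dcomp e hv hu = dunit X e0;
  huv : forall n (e : a + b = n) (e0 : n = 0), dcomp e hu hv = dunit Y e0 }.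

Definition hiso_sym a b X Y (u : hiso a b X Y) : hiso b a Y X :=
  Hiso (etrans (addrC a b) (hdeg u)) (hv_closed u) (hu_closed u) (huv u) (hvu u).

Section OneHiso.
Variables (a b : int) (X Y : A) (u : hiso a b X Y).

Lemma hvuK T n m (e : a + n = m) (e' : b + m = n) (z : dhom T X n) :
  dcomp e' (hv u) (dcomp e (hu u) z) = z.
Proof.
have e1 : b + a = 0 by lia.
by rewrite -(dcompA e1 (add0r n)) (hvu u e1 erefl) dcomp1l.
Qed.

Lemma hvuKr T n m (e : n + b = m) (e' : m + a = n) (z : dhom X T n) :
  dcomp e' (dcomp e z (hv u)) (hu u) = z.
Proof.
have e1 : b + a = 0 by lia.
by rewrite (dcompA e e' e1 (addr0 n)) (hvu u e1 erefl) dcomp1r.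
Qed.

End OneHiso.

Lemma hiso_comp a b a' b' a'' b'' X Y Z :
  a' + a = a'' -> b + b' = b'' -> hiso a b X Y -> hiso a' b' Y Z -> hiso a'' b'' X Z.
Proof.
move=> ea eb u v; have du := hdeg u; have dv := hdeg v.
apply: (@Hiso a'' b'' X Z _ (dcomp ea (hu v) (hu u)) (dcomp eb (hv u) (hv v))).
- lia.
- by apply: closed_dcomp; apply: hu_closed.
- by apply: closed_dcomp; apply: hv_closed.
- move=> n e e0; have e1 : b' + a'' = a by lia.
  have e3 : b + a = n by lia.
  by rewrite (dcompA eb e e1 e3) hvuK (hvu u _ e0).
- move=> n e e0; have e1 : a + b'' = b' by lia.
  have e3 : a' + b' = n by lia.
  rewrite (dcompA ea e e1 e3) (hvuK (hiso_sym u)).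
  by rewrite (huv v _ e0).
Qed.

Lemma hiso_isomorphic a b X Y : a = 0 -> b = 0 -> hiso a b X Y -> @isomorphic k (H0 A) X Y.
Proof.
move=> -> -> u; have u0 : D0 (hu u) = 0 by apply: hu_closed.
have v0 : D0 (hv u) = 0 by apply: hv_closed.
exists (hcl u0), (hcl v0); split.
  rewrite (hcl_comp _ _ (D0_comp0 v0 u0)) -(hcl_id (D0_one X)).
  by apply: hcl_irr; apply: hvu.
rewrite (hcl_comp _ _ (D0_comp0 u0 v0)) -(hcl_id (D0_one Y)).
by apply: hcl_irr; apply: huv.
Qed.

Lemma vanishing_hiso_r a b X Y T m n :
  hiso a b X Y -> a + m = n -> vanishing T X m -> vanishing T Y n.
Proof.
move=> u e; have eab := hdeg u; have em : m - 1 + 1 = m by rewrite subrK.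
have en : n - 1 + 1 = n by rewrite subrK.
move=> /(vanishingP _ _ em erefl) v; apply/(vanishingP _ _ en erefl) => z z0.
have e' : b + n = m by lia.
have [|w wE] := v (dcomp e' (hv u) z).
  by apply: closed_dcomp => [|q eq]; [exact: hv_closed | subst q].
have e1 : a + (m - 1) = n - 1 by lia.
exists (sg k a *: dcomp e1 (hu u) w).
rewrite diffZ (diff_closed_l e1 en erefl em e); last exact: hu_closed.
by rewrite scalerA sgK scale1r -wE (hvuK (hiso_sym u)).
Qed.

Lemma vanishing_hiso_l a b X Y T m n :
  hiso a b X Y -> m + b = n -> vanishing X T m -> vanishing Y T n.
Proof.
move=> u e; have eab := hdeg u; have em : m - 1 + 1 = m by rewrite subrK.
have en : n - 1 + 1 = n by rewrite subrK.
move=> /(vanishingP _ _ em erefl) v; apply/(vanishingP _ _ en erefl) => z z0.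
have e' : n + a = m by lia.
have [|w wE] := v (dcomp e' z (hu u)).
  by apply: closed_dcomp => [q eq|]; [subst q | exact: hu_closed].
have e1 : (m - 1) + b = n - 1 by lia.
exists (dcomp e1 w (hv u)).
rewrite (diff_closed_r e1 en em erefl e); last exact: hv_closed.
by rewrite -wE (hvuKr (hiso_sym u)).
Qed.

Lemma hcomp_id a b X Y (u : hiso a b X Y) (e : a + 0 = a) (eab : a + b = 0) :
  dcomp eab (dcomp e (hu u) (one X)) (hv u) = one Y.
Proof. by rewrite dcomp1r (huv u _ erefl). Qed.

Definition hconj a b X Y X' Y' (u : hiso a b X X') (v : hiso a b Y Y') (e : a + b = 0)
  (f : dhom X Y 0) : dhom X' Y' 0 := dcomp e (dcomp (addr0 a) (hu v) f) (hv u).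

Lemma hconj_closed a b X Y X' Y' (u : hiso a b X X') (v : hiso a b Y Y') e (f : dhom X Y 0) :
  D0 f = 0 -> D0 (hconj u v e f) = 0.
Proof.
move=> f0; apply: closed_dcomp; last exact: hv_closed.
apply: closed_dcomp; first exact: hu_closed.
by move=> m e'; apply: D0_closed.
Qed.

Lemma hconj_comp a b X Y Z X' Y' Z' (u : hiso a b X X') (v : hiso a b Y Y')
    (w : hiso a b Z Z') e (f : dhom Y Z 0) (g : dhom X Y 0) :
  hconj v w e f <* hconj u v e g = hconj u w e (f <* g).
Proof.
rewrite /hconj /lcomp (dcompA e (add0r 0) (addr0 b) e).
rewrite [X in dcomp _ _ (dcomp _ _ X)](dcompA (addr0 a) e (add0r b) e) hvuK.
by rewrite -(dcompA (addr0 a) e) (dcompA (addr0 a) (addr0 a) (add0r 0) (addr0 a)).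
Qed.

Lemma hconjD a b X Y X' Y' (u : hiso a b X X') (v : hiso a b Y Y') e (f g : dhom X Y 0) :
  hconj u v e (f + g) = hconj u v e f + hconj u v e g.
Proof. by rewrite /hconj dcompDr dcompDl. Qed.

Lemma hconj1 a b X X' (u : hiso a b X X') e : hconj u u e (one X) = one X'.
Proof. exact: hcomp_id. Qed.

Lemma hconj0 a b X Y X' Y' (u : hiso a b X X') (v : hiso a b Y Y') e :
  hconj u v e 0 = 0.
Proof. by rewrite /hconj dcomp0r dcomp0l. Qed.

(** Conjugation preserves the splitting identities. It may change the sign of the connecting
    cocycle, which [tri] does not record. *)
Definition ses_hiso a b X Z Y X' Z' Y' (e : a + b = 0) (u : hiso a b X X')
  (v : hiso a b Z Z') (w : hiso a b Y Y') (S : ses X Z Y) : ses X' Z' Y'.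
Proof.
refine (@Ses k A X' Z' Y' (hconj u v e (si S)) (hconj v w e (sp S))
  (hconj v u e (sr S)) (hconj w v e (ss S)) _ _ _ _ _ _ _).
- exact: hconj_closed (si_closed S).
- exact: hconj_closed (sp_closed S).
- by rewrite hconj_comp sri hconj1.
- by rewrite hconj_comp sps hconj1.
- by rewrite hconj_comp spi hconj0.
- by rewrite hconj_comp srs hconj0.
- by rewrite !hconj_comp -hconjD sirsp hconj1.
Defined.

Definition ses_strict_iso X Z Y Y' (t : dhom Y Y' 0) (t' : dhom Y' Y 0) (S : ses X Z Y) :
  D0 t = 0 -> t <* t' = one Y' -> t' <* t = one Y -> ses X Z Y'.
Proof.
move=> t0 tt' t't.
refine (@Ses k A X Z Y' (si S) (t <* sp S) (sr S) (ss S <* t') _ _ _ _ _ _ _).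
- exact: si_closed.
- exact: D0_comp0 t0 (sp_closed S).
- exact: sri.
- by rewrite -lcompA spsl.
- by rewrite -lcompA spi lcomp0.
- by rewrite lcompA srs comp0l.
- by rewrite -!lcompA (lcompA t') t't lcomp1 sirsp.
Defined.

End HomogeneousIsomorphisms.

(* The shifts and cones of a pretriangulated dg category; the triangle theory below uses
   nothing else about twisted complexes. *)
Record pretriangulation (k : comPzRingType) (A : dgcat k) := Pretriangulation {
  shf : int -> A -> A;
  shfP : forall n X, hiso (- n) n X (shf n X);
  mcone : forall X Y, cocycles X Y 0 -> A;
  mconeP : forall X Y (f : cocycles X Y 0), ses Y (mcone f) (shf 1 X);
  mcone_delta : forall X Y (f : cocycles X Y 0),
    sdelta (mconeP f) = lcomp (cval f) (hv (shfP 1 X)) }.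

(** * Extensions from connecting cocycles *)

Section SequenceConstructions.
Variables (k : comPzRingType) (A : dgcat k) (R : pretriangulation A).
Implicit Types X Y Z T U W : A.
Notation H := (H0 A).
Notation hom := (@chom k H).

(** Such a cocycle is a closed morphism of degree 0 from Y[-1] to X, and Z is its cone. The last
    term Y[-1][1] is strictly isomorphic to Y, so the connecting cocycle is dl on the nose. *)
Lemma extension_exists X Y (dl : dhom Y X 1) :
  (forall m (e : 1 + 1 = m), diff e dl = 0) ->
  exists Z (S : ses X Z Y), sdelta S = dl.
Proof.
move=> dl0.
pose u := shfP R (-1) Y; pose v := shfP R 1 (shf R (-1) Y).
have f0 : D0 (dcomp (addrN 1) dl (hv u)) = 0.
  by apply: closed_dcomp => //; apply: hv_closed.
pose z := Cocycle (cocycle_D0 f0).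
have [eu ev] : (- 1 + 1 = 0 :> int) /\ (- 1 + - - 1 = 0 :> int) by [].
pose t := dcomp eu (hv u) (hv v).
pose t' := dcomp eu (hu v) (hu u).
have t0 : D0 t = 0 by apply: closed_dcomp => m e; apply: hv_closed.
have e1 : 1 + 0 = 1 :> int by [].
have tt' : t <* t' = one Y.
  rewrite /t /t' /lcomp (dcompA eu (add0r 0) e1 ev) hvuK.
  exact: (huv (hiso_sym u)).
have t't : t' <* t = one _.
  rewrite /t /t' /lcomp (dcompA eu (add0r 0) e1 eu) (hvuK (hiso_sym u)).
  exact: huv.
exists (mcone R z), (ses_strict_iso (mconeP R z) t0 tt' t't).
rewrite /sdelta /= -/(sdelta (mconeP R z)).
rewrite D0_comp [X in _ <* (_ + X)](_ : _ = 0) ?addr0; last first.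
  rewrite [D0 t'](_ : _ = 0) ?lcomp0 //.
  by apply: closed_dcomp => m e; apply: hu_closed.
rewrite -lrcompA -/(sdelta (mconeP R z)) mcone_delta -/u.
rewrite -[cval z]/(dcomp (addrN 1) dl (hv u)) /lcomp /rcomp -/v.
rewrite (dcompA (addrN 1) (add0r 1) eu (addr0 1)).
rewrite (dcompA (addr0 1) (addr0 1) (add0r 0) (addr0 1)).
by rewrite -/t -/(lcomp t t') tt'; apply: rcomp1.
Qed.

(** The difference f - 1 vanishes on X and dies in Y, so it is both of the form b p and of the form
    i a; its square contains p i = 0. *)
Lemma ses_endo_iso X Z Y (S : ses X Z Y) (f : hom Z Z) :
  f \oc ci S = ci S -> cp S \oc f = cp S -> is_iso f.
Proof.
move=> fi pf; apply: is_iso_unipotent.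
have [|b bE] := @ci_coexact k A X Z Y S _ (f - cid (Z : H)).
  by rewrite ccompBl fi ccomp1l subrr.
have [|a aE] := @cp_exact k A X Z Y S _ (f - cid (Z : H)).
  by rewrite ccompBr pf ccomp1r subrr.
rewrite {1}bE aE (ccompA b) -(ccompA (cp S)) cp_ci ccomp0l.
exact: ccomp0r.
Qed.

Definition homotopic1 X Y (x y : dhom X Y 1) := exists h : dhom X Y 0, x - y = D0 h.
Notation "x ~~ y" := (homotopic1 x y) (at level 70).

Lemma homotopic1_sym X Y (x y : dhom X Y 1) : x ~~ y -> y ~~ x.
Proof. by case=> h E; exists (- h); rewrite D0N -E opprB. Qed.

Lemma homotopic1_trans X Y (x y z : dhom X Y 1) : x ~~ y -> y ~~ z -> x ~~ z.
Proof. by case=> h E [h' E']; exists (h + h'); rewrite D0D -E -E' addrA subrK. Qed.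

Lemma homotopic1_lcomp X Y Z (f : dhom Y Z 0) (x y : dhom X Y 1) :
  D0 f = 0 -> x ~~ y -> f <* x ~~ f <* y.
Proof.
move=> f0 [h E]; exists (f <* h); rewrite -lcompBr E D0_comp f0 rcomp0.
by rewrite add0r.
Qed.

Lemma homotopic1_rcomp X Y Z (f : dhom X Y 0) (x y : dhom Y Z 1) :
  D0 f = 0 -> x ~~ y -> x *> f ~~ y *> f.
Proof.
move=> f0 [h E]; exists (h <* f); rewrite -rcompBl E D0_comp f0 lcomp0.
by rewrite addr0.
Qed.

Lemma homotopic1_hcl_l X Y Z (f g : dhom Y Z 0) (f0 : D0 f = 0) (g0 : D0 g = 0)
    (x : dhom X Y 1) :
  (forall m (e : 1 + 1 = m), diff e x = 0) -> hcl f0 = hcl g0 -> f <* x ~~ g <* x.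
Proof.
move=> x0 /hcl_eq[h E]; exists (dcomp (addNr 1) h x).
rewrite -lcompBl E /D0.
by rewrite (diff_closed_r (addNr 1) (add0r 1) (addNr 1) (erefl (1 + 1)) (add0r 1)).
Qed.

Lemma homotopic1_hcl_r X Y Z (f g : dhom X Y 0) (f0 : D0 f = 0) (g0 : D0 g = 0)
    (x : dhom Y Z 1) :
  (forall m (e : 1 + 1 = m), diff e x = 0) -> hcl f0 = hcl g0 -> x *> f ~~ x *> g.
Proof.
move=> x0 /hcl_eq[h E]; exists (- dcomp (addrN 1) x h).
rewrite -rcompBr E D0N /D0.
rewrite (diff_closed_l (addrN 1) (add0r 1) (erefl (1 + 1)) (addNr 1) (addr0 1)) //.
by rewrite (sgS k (add0r 1)) sg0 scaleN1r opprK.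
Qed.

(** The homotopy inverses of a and b are again compatible with the connecting cocycles and induce a
    map backwards. Both composites restrict to the identity at the ends, so [ses_endo_iso] applies
    to them. *)
Lemma ses_map_iso X Z Y X' Z' Y' (S : ses X Z Y) (S' : ses X' Z' Y')
    (a : dhom X X' 0) (b : dhom Y Y' 0) (a0 : D0 a = 0) (b0 : D0 b = 0) :
  sdelta S' *> b ~~ a <* sdelta S -> is_iso (hcl a0) -> is_iso (hcl b0) ->
  exists f : hom Z Z', is_iso f /\
    (f \oc ci S = ci S' \oc hcl a0 /\ cp S' \oc f = hcl b0 \oc cp S).
Proof.
move=> dh [x [xa ax]] [y [yb by_]]; have [h hE] := dh.
have [a' [a'0 xE]] := hclP x; have [b' [b'0 yE]] := hclP y; subst x y.
have [f f0 [fi pf]] := ses_map a0 b0 hE.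
have [h' h'E] : sdelta S *> b' ~~ a' <* sdelta S'.
  have cS m (e : 1 + 1 = m) := sdelta_closed S e.
  have cS' m (e : 1 + 1 = m) := sdelta_closed S' e.
  have E1 : sdelta S *> b' ~~ a' <* (a <* sdelta S) *> b'.
    apply: homotopic1_rcomp => //; rewrite lcompA -{1}[sdelta S]lcomp1.
    apply: (homotopic1_hcl_l (f0 := D0_one X) (g0 := D0_comp0 a'0 a0)) => //.
    by rewrite hcl_id -xa; apply: hcl_comp.
  apply: (homotopic1_trans E1).
  have E2 : a' <* (a <* sdelta S) *> b' ~~ a' <* (sdelta S' *> b) *> b'.
    apply: homotopic1_rcomp => //; apply: homotopic1_lcomp => //.
    exact: homotopic1_sym.
  apply: (homotopic1_trans E2); rewrite lrcompA rcompA.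
  apply: homotopic1_lcomp => //; rewrite -[X in _ ~~ X]rcomp1.
  apply: (homotopic1_hcl_r (f0 := D0_comp0 b0 b'0) (g0 := D0_one Y')) => //.
  by rewrite hcl_id -by_; apply: esym; apply: hcl_comp.
have [g g0 [gi pg]] := ses_map a'0 b'0 h'E.
have Efi : hcl f0 \oc ci S = ci S' \oc hcl a0.
  rewrite (hcl_comp _ _ (D0_comp0 f0 (si_closed S))).
  by rewrite (hcl_comp _ _ (D0_comp0 (si_closed S') a0)); apply: hcl_irr.
have Epf : cp S' \oc hcl f0 = hcl b0 \oc cp S.
  rewrite (hcl_comp _ _ (D0_comp0 (sp_closed S') f0)).
  by rewrite (hcl_comp _ _ (D0_comp0 b0 (sp_closed S))); apply: hcl_irr.
have Egi : hcl g0 \oc ci S' = ci S \oc hcl a'0.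
  rewrite (hcl_comp _ _ (D0_comp0 g0 (si_closed S'))).
  by rewrite (hcl_comp _ _ (D0_comp0 (si_closed S) a'0)); apply: hcl_irr.
have Epg : cp S \oc hcl g0 = hcl b'0 \oc cp S'.
  rewrite (hcl_comp _ _ (D0_comp0 (sp_closed S) g0)).
  by rewrite (hcl_comp _ _ (D0_comp0 b'0 (sp_closed S'))); apply: hcl_irr.
exists (hcl f0); split=> //.
apply: (@is_iso_two_sided k H Z Z' (hcl f0) (hcl g0) (hcl g0)).
  apply: (@ses_endo_iso _ _ _ S).
    by rewrite ccompA Efi -ccompA Egi ccompA xa ccomp1r.
  by rewrite -ccompA Epg ccompA Epf -ccompA yb ccomp1l.
apply: (@ses_endo_iso _ _ _ S').
  by rewrite ccompA Egi -ccompA Efi ccompA ax ccomp1r.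
by rewrite -ccompA Epf ccompA Epg -ccompA by_ ccomp1l.
Qed.

End SequenceConstructions.

(** * Octahedra and rotations *)

Section Octahedra.
Variables (k : comPzRingType) (A : dgcat k) (R : pretriangulation A).
Implicit Types X Y Z T U W C : A.
Notation H := (H0 A).
Notation hom := (@chom k H).

(** W is the extension of C by Y with connecting cocycle [sp S1 <* sdelta S2]. With this choice the
    composite inclusion is strictly part of a graded split sequence. *)
Lemma ses_octahedron X U Y Z C (S1 : ses X U Y) (S2 : ses U Z C) :
  exists W (S3 : ses Y W C) (S : ses X Z W), ci S = ci S2 \oc ci S1.
Proof.
have [|W [S3 dE]] := @extension_exists k A R Y C (sp S1 <* sdelta S2).
  by move=> m e; rewrite (diff_lcc _ _ (sp_closed S1)) sdelta_closed lcomp0.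
have i0 : D0 (si S2 <* si S1) = 0 by apply: D0_comp0; apply: si_closed.
have q0 : D0 (si S3 <* (sp S1 <* sr S2) + ss S3 <* sp S2) = 0.
  rewrite D0D !D0_comp si_closed !sp_closed !rcomp0 !lcomp0 !add0r addr0.
  by rewrite D0_sr D0_ss dE !lcompNr !lrcompA addNr.
exists W, S3; unshelve eexists.
  refine (@Ses k A X Z W (si S2 <* si S1) (si S3 <* (sp S1 <* sr S2) + ss S3 <* sp S2)
    (sr S1 <* sr S2) (si S2 <* (ss S1 <* sr S3) + ss S2 <* sp S3) i0 q0 _ _ _ _ _).
  - by rewrite -lcompA sril sri.
  - rewrite lcompDl !lcompDr -!lcompA !sril !srsl !spil spsl !lcomp0 add0r addr0.
    by rewrite spsl -(sirsp S3).
  - by rewrite lcompDl -!lcompA !sril spil !lcomp0 addr0 spi lcomp0.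
  - by rewrite lcompDr -!lcompA sril srsl srsl lcomp0 addr0.
  - rewrite lcompDl !lcompDr -!lcompA !sril !srsl !spil !spsl !lcomp0 !addr0 add0r.
    rewrite addrA -(sirsp S2) -[in RHS](lcomp1 (sr S2)) -(sirsp S1).
    by rewrite lcompDl lcompDr -!lcompA.
by rewrite (hcl_comp _ _ i0); apply: hcl_irr.
Qed.

(** Dually, U is the restriction of the extension Z of W by X along [si S2]. *)
Lemma ses_octahedron_op X Z W Y C (S1 : ses X Z W) (S2 : ses Y W C) :
  exists U (S3 : ses X U Y) (S : ses U Z C), cp S = cp S2 \oc cp S1.
Proof.
have [|U [S3 dE]] := @extension_exists k A R X Y (sdelta S1 *> si S2).
  by move=> m e; rewrite (diff_rcc _ _ (si_closed S2)) sdelta_closed rcomp0.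
have p0 : D0 (sp S2 <* sp S1) = 0 by apply: D0_comp0; apply: sp_closed.
have i0 : D0 (si S1 <* sr S3 + ss S1 <* (si S2 <* sp S3)) = 0.
  rewrite D0D !D0_comp !si_closed !sp_closed !rcomp0 !lcomp0 !add0r lcomp0 addr0.
  by rewrite D0_sr D0_ss dE !lcompNr !lrcompA rcompA addNr.
exists U, S3; unshelve eexists.
  refine (@Ses k A U Z C (si S1 <* sr S3 + ss S1 <* (si S2 <* sp S3)) (sp S2 <* sp S1)
    (si S3 <* sr S1 + ss S3 <* (sr S2 <* sp S1)) (ss S1 <* ss S2) i0 p0 _ _ _ _ _).
  - rewrite lcompDl !lcompDr -!lcompA !sril !srsl !spil !spsl !lcomp0 add0r addr0.
    by rewrite sril (sirsp S3).
  - by rewrite -lcompA spsl sps.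
  - by rewrite lcompDr -!lcompA spil spsl spil !lcomp0 addr0.
  - by rewrite lcompDl -!lcompA srsl spsl srs !lcomp0 addr0.
  - rewrite lcompDl !lcompDr -!lcompA !sril !srsl !spil !spsl !lcomp0 !addr0 add0r.
    rewrite -addrA -(sirsp S1) -[in RHS](lcomp1 (sp S1)) -(sirsp S2).
    by rewrite lcompDl lcompDr -!lcompA.
by rewrite (hcl_comp _ _ p0); apply: hcl_irr.
Qed.

Lemma su_diff X Y T (u : hiso (- 1) 1 X Y) (z : dhom T X 0) :
  diff (addNr 1) (dcomp (addr0 (- 1)) (hu u) z) = - dcomp (addNr 1) (hu u) (D0 z).
Proof.
rewrite (diff_closed_l (addr0 (- 1)) (addNr 1) erefl (add0r 1) (addNr 1)).
  by rewrite sgN /sg expr1 scaleN1r.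
exact: hu_closed.
Qed.

Lemma hu_rcomp X Y T U (u : hiso (- 1) 1 X Y) (z : dhom T X 1) (f : dhom U T 0) :
  dcomp (addNr 1) (hu u) z <* f = dcomp (addNr 1) (hu u) (z *> f).
Proof. by rewrite -rlcomp dcomp_rc. Qed.

(** E is the mapping cylinder of f, written as an extension of the cone C by X. It replaces f by a
    graded split inclusion and is homotopy equivalent to Y. *)
Lemma cone_ses_rotate X Y C X' (u : hiso (- 1) 1 X X') (f : dhom X Y 0)
    (f0 : D0 f = 0) (S : ses Y C X') :
  sdelta S = f <* hv u ->
  exists E (S' : ses X E C) (phi : hom E Y),
    [/\ is_iso phi, hcl f0 = phi \oc ci S' & cp S' = ci S \oc phi].
Proof.
move=> dS.
have [|E [S' dE]] := @extension_exists k A R X C (- (hv u *> sp S)).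
  by move=> m e; rewrite diffN (diff_rcc _ _ (sp_closed S)) hv_closed rcomp0 oppr0.
have a0 : D0 (f <* sr S' + sr S <* sp S') = 0.
  rewrite D0D !D0_comp f0 sp_closed rcomp0 lcomp0 add0r addr0 !D0_sr dE dS.
  by rewrite rcompNl opprK rcompNl !lrcompA subrr.
have b0 : D0 (ss S' <* si S) = 0.
  rewrite D0_comp si_closed lcomp0 addr0 D0_ss dE lcompNr rcompNl.
  by rewrite -lrcompA rcompA spi comp0r oppr0.
have ab : hcl a0 \oc hcl b0 = cid (Y : H).
  rewrite (hcl_comp _ _ (D0_comp0 a0 b0)) -(hcl_id (D0_one Y)); apply: hcl_irr.
  by rewrite lcompDl -!lcompA srsl spsl lcomp0 add0r sri.
have ba : hcl b0 \oc hcl a0 = cid (E : H).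
  rewrite (hcl_comp _ _ (D0_comp0 b0 a0)) -(hcl_id (D0_one E)); apply/hcl_eq.
  (* The contracting homotopy moves the summand X of the cylinder to its summand X[1]. *)
  set w := dcomp (addr0 (- 1)) (hu u) (sr S').
  exists ((ss S' <* ss S) <* w).
  have E1 : D0 (ss S' <* ss S) = (ss S' <* si S <* f - si S') <* hv u.
    rewrite D0_comp !D0_ss dE dS lcompNr rcompNl lrcompA rcompA sps rcomp1.
    by rewrite lcompBl addrC !lcompA.
  have E2 : diff (addNr 1) w = - (sp S <* sp S').
    rewrite su_diff D0_sr dE rcompNl opprK rcompA -dcomp_rc.
    by rewrite (huv u _ erefl) rlcomp lcomp1.
  rewrite (diff_lc _ (addrN 1)) E1 E2 -dcomp_lc hvuK.
  rewrite -(sirsp S') -[in ss S' <* sp S'](lcomp1 (sp S')) -(sirsp S).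
  rewrite lcompNr lcompBl !lcompDl !lcompDr -!lcompA.
  abel.
exists E, S', (hcl a0); split.
- by exists (hcl b0).
- rewrite (hcl_comp _ _ (D0_comp0 a0 (si_closed S'))); apply: hcl_irr.
  by rewrite lcompDl -!lcompA sri spi lcomp0 addr0 comp01.
- have E' : cp S' \oc hcl b0 = ci S.
    rewrite (hcl_comp _ _ (D0_comp0 (sp_closed S') b0)).
    by apply: hcl_irr; rewrite spsl.
  by rewrite -E' ccompA ba ccomp1r.
Qed.

(** The cone of a split inclusion is homotopy equivalent to the quotient. Under this equivalence the
    projection to X[1] becomes minus the shifted connecting cocycle, which is the sign of a rotated
    triangle. *)
Lemma ses_rotate X Z Y C X' (u : hiso (- 1) 1 X X') (S : ses X Z Y) (S' : ses Z C X') :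
  sdelta S' = si S <* hv u ->
  exists (a : hom C Y) (b : hom Y C) (h0 : D0 (dcomp (addNr 1) (hu u) (sdelta S)) = 0),
    [/\ is_inverse a b, a \oc ci S' = cp S & cp S' \oc b = - hcl h0].
Proof.
move=> dS'.
have h0 : D0 (dcomp (addNr 1) (hu u) (sdelta S)) = 0.
  apply: closed_dcomp; first exact: hu_closed.
  by move=> m e; apply: sdelta_closed.
set h := dcomp _ _ _ in h0.
have a0 : D0 (sp S <* sr S') = 0.
  rewrite D0_comp sp_closed rcomp0 add0r D0_sr dS' lcompNr.
  by rewrite lrcompA lcompA spi comp0l oppr0.
have vh : dcomp (addr0 1) (hv u) h = sdelta S.
  exact: hvuK.
have b0 : D0 (si S' <* ss S - ss S' <* h) = 0.
  rewrite D0B !D0_comp si_closed h0 rcomp0 lcomp0 add0r addr0 !D0_ss dS'.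
  rewrite lrcompA lrcompA -[hv u *> h]/(dcomp (addr0 1) (hv u) h) vh.
  by rewrite subrr.
have ab : hcl a0 \oc hcl b0 = cid (Y : H).
  rewrite (hcl_comp _ _ (D0_comp0 a0 b0)) -(hcl_id (D0_one Y)); apply: hcl_irr.
  by rewrite -lcompA lcompBr sril srsl subr0 sps.
have ba : hcl b0 \oc hcl a0 = cid (C : H).
  rewrite (hcl_comp _ _ (D0_comp0 b0 a0)) -(hcl_id (D0_one C)); apply/hcl_eq.
  set w := dcomp (addr0 (- 1)) (hu u) (sr S <* sr S').
  exists (- (ss S' <* w)).
  have E2 : diff (addNr 1) w = h <* (sp S <* sr S') + sp S'.
    rewrite su_diff D0_comp !D0_sr dS' lcompNr rcompNl -opprD dcompNr opprK.
    rewrite dcompDr lrcompA sril -[X in _ + X]dcomp_rc (huv u _ erefl) rlcomp lcomp1.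
    by rewrite /h hu_rcomp rcompA.
  rewrite diffN (diff_lc _ (addrN 1)) D0_ss dS' E2 -!dcomp_lc hvuK.
  rewrite -(sirsp S') -[in si S' <* sr S'](lcomp1 (sr S')) -(sirsp S).
  rewrite lcompBl !lcompDl !lcompDr -!lcompA.
  abel.
exists (hcl a0), (hcl b0), h0; split=> //.
  rewrite (hcl_comp _ _ (D0_comp0 a0 (si_closed S'))); apply: hcl_irr.
  by rewrite -lcompA sri comp01.
rewrite (hcl_comp _ _ (D0_comp0 (sp_closed S') b0)).
have n0 : D0 (- h) = 0 by rewrite D0N h0 oppr0.
rewrite -(hclN h0 n0); apply: hcl_irr.
by rewrite lcompBr spil spsl sub0r.
Qed.

End Octahedra.

(** * Triangles *)

Section Triangles.
Variables (k : comPzRingType) (A : dgcat k) (R : pretriangulation A).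
Implicit Types X Y Z T U W C : A.
Notation H := (H0 A).
Notation hom := (@chom k H).
Notation iso X Y := (@isomorphic k H X Y).
Notation one_ X := (@Defs.cid k H X).

(* X -> Z -> Y is the beginning of a triangle X -> Z -> Y -> X[1]: up to an
   isomorphism of the middle term it is a graded split sequence *)
Definition tri X Z Y (f : hom X Z) (g : hom Z Y) :=
  exists Z0 (S : ses X Z0 Y) (phi : hom Z0 Z),
    [/\ is_iso phi, f = phi \oc ci S & cp S = g \oc phi].

Lemma tri_ses X Z Y (S : ses X Z Y) : tri (ci S) (cp S).
Proof.
by exists Z, S, (one_ Z); split; rewrite ?ccomp1l ?ccomp1r //; apply: is_iso_id.
Qed.

Section OneTriangle.
Variables (X Z Y : A) (f : hom X Z) (g : hom Z Y).
Hypothesis fg : tri f g.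

Lemma tri_van_mid_l T n : vanishing T X n -> vanishing T Y n -> vanishing T Z n.
Proof.
have [Z0 [S [phi [isoZ _ _]]]] := fg => vX vY.
by apply: (@vanishing_iso_r k A T Z0); [exists phi | apply: (van_mid_l S)].
Qed.
Lemma tri_van_mid_r T n : vanishing X T n -> vanishing Y T n -> vanishing Z T n.
Proof.
have [Z0 [S [phi [isoZ _ _]]]] := fg => vX vY.
by apply: (@vanishing_iso_l k A T Z0); [exists phi | apply: (van_mid_r S)].
Qed.
Lemma tri_van_l_l T n m : m + 1 = n -> vanishing T Z n -> vanishing T Y m -> vanishing T X n.
Proof.
have [Z0 [S [phi [isoZ _ _]]]] := fg => e vZ; apply: (van_l_l S e).
by apply: (@vanishing_iso_r k A T Z) vZ; apply: isomorphic_sym; exists phi.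
Qed.
Lemma tri_van_r_l T n m : n + 1 = m -> vanishing T Z n -> vanishing T X m -> vanishing T Y n.
Proof.
have [Z0 [S [phi [isoZ _ _]]]] := fg => e vZ; apply: (van_r_l S e).
by apply: (@vanishing_iso_r k A T Z) vZ; apply: isomorphic_sym; exists phi.
Qed.
Lemma tri_van_r_r T n m : m + 1 = n -> vanishing Z T n -> vanishing X T m -> vanishing Y T n.
Proof.
have [Z0 [S [phi [isoZ _ _]]]] := fg => e vZ; apply: (van_r_r S e).
by apply: (@vanishing_iso_l k A T Z) vZ; apply: isomorphic_sym; exists phi.
Qed.
Lemma tri_van_l_r T n m : n + 1 = m -> vanishing Z T n -> vanishing Y T m -> vanishing X T n.
Proof.
have [Z0 [S [phi [isoZ _ _]]]] := fg => e vZ; apply: (van_l_r S e).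
by apply: (@vanishing_iso_l k A T Z) vZ; apply: isomorphic_sym; exists phi.
Qed.

Lemma tri_comp : g \oc f = 0.
Proof.
have [Z0 [S [phi [_ -> E]]]] := fg.
by rewrite -ccompA -E cp_ci.
Qed.

Lemma tri_lift T (z : hom T Z) : g \oc z = 0 -> exists a, z = f \oc a.
Proof.
have [Z0 [S [phi [[psi [p1 p2]] -> E]]]] := fg => gz.
have [|a aE] := @cp_exact k A X Z0 Y S T (psi \oc z).
  by rewrite E -ccompA (ccompA g) p2 ccomp1r.
by exists a; rewrite ccompA -aE -ccompA p2 ccomp1l.
Qed.
Lemma tri_colift T (z : hom Z T) : z \oc f = 0 -> exists b, z = b \oc g.
Proof.
have [Z0 [S [phi [[psi [p1 p2]] -> E]]]] := fg => zf.
have [|a aE] := @ci_coexact k A X Z0 Y S T (z \oc phi).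
  by rewrite ccompA.
by exists a; rewrite -[LHS]ccomp1r -p2 -ccompA aE E !ccompA p2 ccomp1r.
Qed.

Lemma tri_surj T : vanishing T X 1 -> forall b : hom T Y, exists z, b = g \oc z.
Proof.
have [Z0 [S [phi [_ _ E]]]] := fg => vX b.
have [z ->] := cp_surj S vX b.
by exists (phi \oc z); rewrite E ccompA.
Qed.
Lemma tri_cosurj T : vanishing Y T 1 -> forall a : hom X T, exists z, a = z \oc f.
Proof.
have [Z0 [S [phi [[psi [p1 _]] -> _]]]] := fg => vY a.
have [z ->] := ci_cosurj S vY a.
by exists (z \oc psi); rewrite -ccompA (ccompA z) p1 ccomp1r.
Qed.
Lemma tri_inj T : vanishing T Y (- 1) -> forall a : hom T X, f \oc a = 0 -> a = 0.
Proof.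
have [Z0 [S [phi [[psi [p1 _]] -> _]]]] := fg => vY a fa.
apply: (ci_inj (S := S)) => //.
by rewrite -[LHS]ccomp1l -p1 ccompA -(ccompA phi) fa ccomp0r.
Qed.
Lemma tri_coinj T : vanishing X T (- 1) -> forall c : hom Y T, c \oc g = 0 -> c = 0.
Proof.
have [Z0 [S [phi [_ _ E]]]] := fg => vX c cg.
by apply: (cp_coinj (S := S)) => //; rewrite E -ccompA cg ccomp0l.
Qed.

Lemma van_of_tri_inj T : (forall a : hom T X, f \oc a = 0 -> a = 0) ->
  vanishing T Z (- 1) -> vanishing T Y (- 1).
Proof.
have [Z0 [S [phi [isoZ fE _]]]] := fg => inj vZ.
apply: (van_of_ci_inj (S := S)).
  by move=> a a0; apply: inj; rewrite fE ccompA a0 ccomp0r.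
by apply: (@vanishing_iso_r k A T Z) vZ; apply: isomorphic_sym; exists phi.
Qed.
Lemma van_of_tri_cosurj T : (forall a : hom X T, exists z, a = z \oc f) ->
  vanishing Z T 1 -> vanishing Y T 1.
Proof.
have [Z0 [S [phi [isoZ fE _]]]] := fg => sur vZ.
apply: (van_of_ci_cosurj (S := S)).
  by move=> a; have [z ->] := sur a; exists (z \oc phi); rewrite fE ccompA.
by apply: (@vanishing_iso_l k A T Z) vZ; apply: isomorphic_sym; exists phi.
Qed.
Lemma van_of_tri_surj T : (forall b : hom T Y, exists z, b = g \oc z) ->
  vanishing T Z 1 -> vanishing T X 1.
Proof.
have [Z0 [S [phi [isoZ _ E]]]] := fg => sur vZ; have [psi [p1 p2]] := isoZ.
apply: (van_of_cp_surj (S := S)).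
  move=> b; have [z ->] := sur b; exists (psi \oc z).
  by rewrite E ccompA -(ccompA phi) p2 ccomp1l.
by apply: (@vanishing_iso_r k A T Z) vZ; apply: isomorphic_sym; exists phi.
Qed.

Lemma tri_isoM Z' (y : hom Z Z') y' : is_inverse y y' -> tri (y \oc f) (g \oc y').
Proof.
have [Z0 [S [phi [isoZ -> E]]]] := fg => -[y1 y2].
exists Z0, S, (y \oc phi); split.
- by apply: is_iso_comp => //; exists y'.
- by rewrite ccompA.
- by rewrite E ccompA -(ccompA y') y1 ccomp1l.
Qed.

(** A split sequence ending in Y' itself is required, while y is invertible only up to homotopy. The
    extension pulled back along the inverse of y provides one. *)
Lemma tri_isoR Y' (y : hom Y Y') : is_iso y -> tri f (y \oc g).
Proof.
have [Z0 [S [phi [isoZ fE E]]]] := fg => isoy.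
have [y' [y1 y2]] := isoy; have [b [b0 yE]] := hclP y; have [b' [b'0 y'E]] := hclP y'.
subst y y'.
have [|Z1 [S1 dE]] := @extension_exists k A R X Y' (sdelta S *> b').
  by move=> m e; rewrite (diff_rcc _ _ b'0) sdelta_closed rcomp0.
have [||psi [isopsi [ip pp]]] := ses_map_iso (S := S) (S' := S1) (a0 := D0_one X) (b0 := b0) _ _ isoy.
- rewrite dE lcomp1 rcompA -[X in homotopic1 _ X]rcomp1.
  apply: (homotopic1_hcl_r (f0 := D0_comp0 b'0 b0) (g0 := D0_one Y)).
    by move=> m e; apply: sdelta_closed.
  by rewrite hcl_id -y1; apply: esym; apply: hcl_comp.
- by rewrite hcl_id; apply: is_iso_id.
have [chi chiP] := isopsi; have [c1 c2] := chiP.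
exists Z1, S1, (phi \oc chi); split.
- by apply: is_iso_comp => //; apply: is_iso_inverse chiP.
- move: ip; rewrite hcl_id ccomp1r => <-.
  by rewrite ccompA -(ccompA chi) c1 ccomp1l.
- by rewrite -[LHS]ccomp1r -c2 -ccompA pp ccompA E !ccompA.
Qed.

Lemma tri_isoL X' (x : hom X' X) : is_iso x -> tri (f \oc x) g.
Proof.
have [Z0 [S [phi [isoZ fE E]]]] := fg => isox.
have [x' [x1 x2]] := isox; have [a [a0 xE]] := hclP x; have [a' [a'0 x'E]] := hclP x'.
subst x x'.
have [|Z1 [S1 dE]] := @extension_exists k A R X' Y (a' <* sdelta S).
  by move=> m e; rewrite (diff_lcc _ _ a'0) sdelta_closed lcomp0.
have [|| psi [isopsi [ip pp]]] := ses_map_iso (S := S1) (S' := S) (a0 := a0) (b0 := D0_one Y) _ isox.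
- rewrite dE rcomp1 lcompA -[X in homotopic1 X _]lcomp1.
  apply: (homotopic1_hcl_l (f0 := D0_one X) (g0 := D0_comp0 a0 a'0)).
    by move=> m e; apply: sdelta_closed.
  by rewrite hcl_id -x2; apply: hcl_comp.
- by rewrite hcl_id; apply: is_iso_id.
exists Z1, S1, (phi \oc psi); split; first exact: is_iso_comp.
- by rewrite ccompA ip fE ccompA.
- by move: pp; rewrite hcl_id ccomp1l => <-; rewrite E ccompA.
Qed.

End OneTriangle.

Lemma tri_octahedron X U Y Z C (f1 : hom X U) (g1 : hom U Y) (f2 : hom U Z) (g2 : hom Z C) :
  tri f1 g1 -> tri f2 g2 ->
  exists W (w : hom Z W) (v : hom Y W) (t : hom W C), tri (f2 \oc f1) w /\ tri v t.
Proof.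
move=> [U0 [S1 [phi [isophi -> _]]]] t2.
have [Z0 [S2 [psi [isopsi E _]]]] := tri_isoL t2 isophi.
have [W [S3 [S SE]]] := ses_octahedron R S1 S2.
have [chi chiP] := isopsi.
exists W, (cp S \oc chi), (ci S3), (cp S3); split; last exact: tri_ses.
rewrite -ccompA E ccompA -SE.
exact: (tri_isoM (tri_ses S) chiP).
Qed.

Lemma tri_octahedron_op X Z W Y C (f1 : hom X Z) (g1 : hom Z W) (f2 : hom Y W) (g2 : hom W C) :
  tri f1 g1 -> tri f2 g2 ->
  exists U (a : hom X U) (b : hom U Y) (u : hom U Z), tri a b /\ tri u (g2 \oc g1).
Proof.
move=> t1 [W0 [S2 [psi [[chi chiP] fE E2]]]]; have [c1 c2] := chiP.
have [Z0 [S1 [phi [isophi _ E1]]]] := tri_isoR t1 (is_iso_inverse chiP).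
have [U [S3 [S SE]]] := ses_octahedron_op R S1 S2.
exists U, (ci S3), (cp S3), (phi \oc ci S); split; first exact: tri_ses.
exists Z0, S, phi; split=> //.
by rewrite SE E2 E1 !ccompA -(ccompA psi) c2 ccomp1l.
Qed.

(** Each last term is isomorphic to the strict cone of its split inclusion by [ses_rotate]. The
    isomorphism between the two middle terms induces one between these cones. *)
Lemma tri_cone_unique X Z Y Y' (f : hom X Z) (g : hom Z Y) (g' : hom Z Y') :
  tri f g -> tri f g' -> exists2 e : hom Y Y', is_iso e & e \oc g = g'.
Proof.
move=> [Z1 [S1 [p1 [iso1 E1 F1]]]] [Z2 [S2 [p2 [iso2 E2 F2]]]].
pose v := shfP R 1 X.
pose T1 := mconeP R (Cocycle (cocycle_D0 (si_closed S1))).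
pose T2 := mconeP R (Cocycle (cocycle_D0 (si_closed S2))).
have d1 : sdelta T1 = si S1 <* hv v by apply: mcone_delta.
have d2 : sdelta T2 = si S2 <* hv v by apply: mcone_delta.
have [a1 [b1 [h1 [ab1 A1 _]]]] := ses_rotate d1.
have [a2 [b2 [h2 [ab2 A2 _]]]] := ses_rotate d2.
have [q2 qP2] := iso2; have [q21 q22] := qP2.
have isot : is_iso (q2 \oc p1).
  by apply: is_iso_comp => //; apply: is_iso_inverse qP2.
have [t [t0 tE]] := hclP (q2 \oc p1).
rewrite tE in isot.
have [|| e [isoe [ei _]]] := ses_map_iso (S := T1) (S' := T2) (a0 := t0) (b0 := D0_one (shf R 1 X)) _ isot.
- rewrite rcomp1 d1 d2 lcompA.
  apply: (homotopic1_hcl_l (f0 := si_closed S2) (g0 := D0_comp0 t0 (si_closed S1))).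
    by move=> m e; apply: hv_closed.
  rewrite -(hcl_comp t0 (si_closed S1)) -tE -/(ci S1) -/(ci S2).
  by rewrite ccompA -E1 E2 -ccompA q21 ccomp1l.
- by rewrite hcl_id; apply: is_iso_id.
exists (a2 \oc (e \oc b1)).
  apply: is_iso_comp; first by exists b2.
  apply: is_iso_comp => //; exact: is_iso_inverse ab1.
have [q1 [q11 q12]] := iso1; have [ab11 ab12] := ab1.
rewrite -[g]ccomp1r -q12 -(ccompA g) -F1 -A1.
rewrite !ccompA -(ccompA b1) ab11 ccomp1l -(ccompA e) ei.
rewrite -tE -!ccompA A2 F2 !ccompA.
by rewrite q12 ccomp1r q22 ccomp1r.
Qed.

Lemma tri_cone X Z (f : hom X Z) : exists Y (g : hom Z Y), tri f g.
Proof.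
have [f0 fE] := clsP f.
have f00 : D0 (cval f0) = 0 by apply: cval_closed.
have [E [S [phi [isophi Ef Es]]]] := cone_ses_rotate R f00 (mcone_delta R f0).
exists (mcone R f0), (ci (mconeP R f0)), E, S, phi; split=> //.
by rewrite -Ef fE (cls_hcl f00).
Qed.

Lemma tri_mcone X Z (f : cocycles X Z 0) : tri (cls f : hom X Z) (ci (mconeP R f)).
Proof.
have f00 : D0 (cval f) = 0 by apply: cval_closed.
have [E [S [phi [isophi Ef Es]]]] := cone_ses_rotate R f00 (mcone_delta R f).
exists E, S, phi; split=> //.
by rewrite -Ef (cls_hcl f00).
Qed.

Lemma tri_rotate X Z Y (f : hom X Z) (g : hom Z Y) :
  tri f g -> exists h : hom Y (shf R 1 X), tri g h.
Proof.
move=> [Z1 [S1 [p1 [iso1 E1 F1]]]].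
pose v := shfP R 1 X.
pose T1 := mconeP R (Cocycle (cocycle_D0 (si_closed S1))).
have d1 : sdelta T1 = si S1 <* hv v by apply: mcone_delta.
have [a1 [b1 [h1 [ab1 A1 _]]]] := ses_rotate d1.
exists (cp T1 \oc b1).
have t1 : tri (cp S1) (cp T1 \oc b1) by rewrite -A1; apply: (tri_isoM (tri_ses T1) ab1).
have [q1 qP1] := iso1; have [_ q12] := qP1.
have := tri_isoL t1 (is_iso_inverse qP1).
by rewrite F1 ccompA q12 ccomp1r.
Qed.

(** Read as a cocycle of degree 1 from Z to Y[-1], g classifies an extension of Z by Y[-1]. Rotating
    that extension returns g, up to sign and the identification of Y[-1][1] with Y. *)
Lemma tri_cocone Z Y (g : hom Z Y) : exists X (f : hom X Z), tri f g.
Proof.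
have [g0 [g00 ->]] := hclP g.
pose u1 := shfP R (- 1) Y; pose Y' := shf R (- 1) Y.
have e1 : - - 1 = 1 :> int by [].
pose dl : dhom Z Y' 1 := dcomp (addr0 1) (hu u1) g0.
have [|E [S dE]] := @extension_exists k A R Y' Z dl.
  apply: closed_dcomp; first exact: hu_closed.
  by move=> m e; apply: D0_closed.
pose u2 := shfP R 1 Y'.
pose T1 := mconeP R (Cocycle (cocycle_D0 (si_closed S))).
have d1 : sdelta T1 = si S <* hv u2 by apply: mcone_delta.
have [a1 [b1 [h1 [ab1 A1 B1]]]] := ses_rotate d1.
exists E, (cp S).
have t1 : tri (cp S) (cp T1 \oc b1) by rewrite -A1; apply: (tri_isoM (tri_ses T1) ab1).
have eu : - 1 + - - 1 = 0 :> int by [].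
pose x : dhom Y (shf R 1 Y') 0 := dcomp eu (hu u2) (hu u1).
pose x' : dhom (shf R 1 Y') Y 0 := dcomp (addNr 1) (hv u1) (hv u2).
have x0 : D0 x = 0 by apply: closed_dcomp; apply: hu_closed.
have x'0 : D0 x' = 0 by apply: closed_dcomp; apply: hv_closed.
have e0 : 1 + 0 = 1 :> int by [].
have x'x : x' <* x = one Y.
  rewrite /x /x' /lcomp (dcompA (addNr 1) (add0r 0) e0 (addNr 1)) hvuK.
  exact: hvu.
have hE : dcomp (addNr 1) (hu u2) (sdelta S) = x <* g0.
  rewrite dE /dl /x /lcomp.
  by rewrite (dcompA eu (add0r 0) (addr0 1) (addNr 1)).
have -> : hcl g00 = (- hcl x'0) \oc (cp T1 \oc b1).
  rewrite B1 ccompNr ccompNl opprK.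
  have xg0 := D0_comp0 x0 g00.
  rewrite (hcl_comp _ _ (D0_comp0 x'0 h1)); apply: hcl_irr.
  by rewrite hE lcompA x'x lcomp1.
apply: (tri_isoR t1); exists (- hcl x0).
have xx' : x <* x' = one (shf R 1 Y').
  have e3 : - - 1 + 0 = 1 :> int by [].
  rewrite /x /x' /lcomp (dcompA eu (add0r 0) e3 (addNr 1)) (hvuK (hiso_sym u1)).
  exact: huv.
split; rewrite ccompNl ccompNr opprK.
  rewrite (hcl_comp _ _ (D0_comp0 x0 x'0)) -(hcl_id (D0_one _)).
  exact: hcl_irr.
rewrite (hcl_comp _ _ (D0_comp0 x'0 x0)) -(hcl_id (D0_one _)).
exact: hcl_irr.
Qed.

End Triangles.

(** * Pushouts, shifts and splittings of triangles *)

Section TriangleConstructions.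
Variables (k : comPzRingType) (A : dgcat k) (R : pretriangulation A).
Implicit Types X Y Z T U W C : A.
Notation H := (H0 A).
Notation hom := (@chom k H).
Notation iso X Y := (@isomorphic k H X Y).
Notation one_ X := (@Defs.cid k H X).
Notation shf := (shf R).

(** W is the extension of Y by X' obtained by pushing the connecting cocycle along a. The mapping
    property is that of a homotopy pushout: it gives existence of phi and no uniqueness. *)
Lemma tri_pushout X Z Y X' (f : hom X Z) (g : hom Z Y) (a : hom X X') :
  tri f g -> exists W (f' : hom X' W) (g' : hom W Y) (w : hom Z W),
    [/\ tri f' g', w \oc f = f' \oc a, g' \oc w = g
      & forall T (u : hom X' T) (v : hom Z T), u \oc a = v \oc f ->
          exists2 phi : hom W T, phi \oc f' = u & phi \oc w = v].
Proof.
move=> [Z0 [S [phi [isoZ fE E]]]]; have [psi [p1 p2]] := isoZ.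
have [a0 [a00 aE]] := hclP a; subst a.
have [|W [S1 dE]] := @extension_exists k A R X' Y (a0 <* sdelta S).
  by move=> m e; rewrite (diff_lcc _ _ a00) sdelta_closed lcomp0.
have w0 : D0 (si S1 <* (a0 <* sr S) + ss S1 <* sp S) = 0.
  rewrite D0D !D0_comp si_closed sp_closed a00 !rcomp0 !lcomp0 !add0r addr0.
  by rewrite D0_sr D0_ss dE !lcompNr !lrcompA addNr.
exists W, (ci S1), (cp S1), (hcl w0 \oc psi); split; first exact: tri_ses.
- rewrite fE ccompA -(ccompA psi) p1 ccomp1l.
  rewrite (hcl_comp _ _ (D0_comp0 w0 (si_closed S))).
  rewrite (hcl_comp _ _ (D0_comp0 (si_closed S1) a00)); apply: hcl_irr.
  by rewrite lcompDl -!lcompA sri spi lcomp0 addr0 comp01.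
- rewrite -ccompA (hcl_comp _ _ (D0_comp0 (sp_closed S1) w0)).
  rewrite (_ : hcl _ = cp S); first by rewrite E ccompA p2 ccomp1r.
  by apply: hcl_irr; rewrite lcompDr spil spsl add0r.
move=> T u v uv; have [u0 [u00 uE]] := hclP u; subst u.
have [v0 [v00 vE]] := hclP (v \oc phi).
have [h hE] : exists h : dhom X T (- 1), u0 <* a0 - v0 <* si S = diff (addNr 1) h.
  apply/(hcl_eq (D0_comp0 u00 a00) (D0_comp0 v00 (si_closed S))).
  by rewrite -(hcl_comp u00 a00) -(hcl_comp v00 (si_closed S)) -vE uv fE ccompA.
(* The homotopy h, by which u and v agree on X, is composed with the connecting cocycle to make the
   second component of q compatible with the differential. *)
pose q := u0 <* sr S1 + (v0 <* ss S + dcomp (addNr 1) h (sdelta S)) <* sp S1.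
have q0 : D0 q = 0.
  rewrite D0D !D0_comp D0D D0_comp u00 v00 sp_closed !rcomp0 !lcomp0 !add0r addr0.
  rewrite D0_sr dE D0_ss /D0.
  rewrite (diff_closed_r (addNr 1) (add0r 1) (addNr 1) (erefl (1 + 1)) (add0r 1));
    last exact: sdelta_closed.
  rewrite -hE -[dcomp _ (_ - _) _]/(lcomp (_ - _) _).
  rewrite lcompBl lcompNr rcompDl rcompBl !lrcompA -!lcompA.
  abel.
exists (hcl q0).
  rewrite (hcl_comp _ _ (D0_comp0 q0 (si_closed S1))); apply: hcl_irr.
  by rewrite /q lcompDl -!lcompA sri spi lcomp0 addr0 comp01.
rewrite -[RHS]ccomp1r -p2 -!ccompA vE; congr (_ \oc _).
rewrite (hcl_comp _ _ (D0_comp0 q0 w0)); apply/hcl_eq.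
exists (h *> sr S).
rewrite diff_rc -hE D0_sr dcompNr sgN /sg expr1 scaleN1r opprK.
rewrite /q lcompDl !lcompDr -!lcompA !sril !srsl !spil !spsl !lcomp0 !addr0 add0r.
rewrite lcompDl -!lcompA rlcomp lcompBl -!lcompA.
rewrite -[in RHS]dcomp_rc rlcomp -[X in _ - X = _]comp01 -(sirsp S) lcompDr.
abel.
Qed.

Definition extends X Z Y := exists (f : hom X Z) (g : hom Z Y), tri f g.

Lemma extends_iso X Z Y X' Z' Y' :
  iso X X' -> iso Z Z' -> iso Y Y' -> extends X Z Y -> extends X' Z' Y'.
Proof.
move=> [x [x' xx']] [z [z' zz']] [y isoy] [f [g t]].
have t1 := tri_isoR R (tri_isoM (tri_isoL R t (is_iso_inverse xx')) zz') isoy.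
by do 2 eexists; exact: t1.
Qed.

Lemma shf_hiso n X : hiso (- n) n X (shf n X).
Proof. exact: shfP. Qed.

Lemma shf_shf n m l X : n + m = l -> iso (shf n (shf m X)) (shf l X).
Proof.
move=> e.
have u : hiso (- l) l X (shf n (shf m X)).
  by apply: (hiso_comp _ _ (shf_hiso m X) (shf_hiso n (shf m X))); lia.
apply: isomorphic_sym; apply: (hiso_isomorphic _ _ (hiso_comp _ _ (hiso_sym (shf_hiso l X)) u));
  [exact: addNr | exact: addNr | |]; by [].
Qed.

Lemma shf0 X : iso (shf 0 X) X.
Proof. by apply: (hiso_isomorphic _ _ (hiso_sym (shf_hiso 0 X))). Qed.

Lemma shf_iso n X Y : iso X Y -> iso (shf n X) (shf n Y).
Proof.
move=> [x [y [xy yx]]]; have [f [f0 fE]] := hclP x; have [g [g0 gE]] := hclP y; subst x y.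
pose u := shf_hiso n X; pose v := shf_hiso n Y.
have e : - n + n = 0 by apply: addNr.
have F0 := hconj_closed u v e f0; have G0 := hconj_closed v u e g0.
move: xy yx; rewrite (hcl_comp _ _ (D0_comp0 g0 f0)) (hcl_comp _ _ (D0_comp0 f0 g0)).
rewrite -!(hcl_id (D0_one _)) => /hcl_eq[h hE] /hcl_eq[h' h'E].
have key Z (w : hiso (- n) n Z (shf n Z)) (s : dhom Z Z 0) (t : dhom Z Z (- 1)) :
    s = diff (addNr 1) t -> exists t', hconj w w e s = diff (addNr 1) t'.
  move=> ->; have e1 : - n + - 1 = - n - 1 by [].
  have e2 : - n - 1 + n = - 1 by lia.
  have e3 : - n - 1 + 1 = - n by lia.
  exists (sg k n *: dcomp e2 (dcomp e1 (hu w) t) (hv w)).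
  rewrite diffZ (diff_closed_r e2 (addNr 1) e3 erefl e); last exact: hv_closed.
  rewrite (diff_closed_l e1 e3 erefl (addNr 1) (addr0 _)); last exact: hu_closed.
  by rewrite dcompZl scalerA sgN sgK scale1r.
have hconjB Z Z' W W' (w : hiso (- n) n Z Z') (w' : hiso (- n) n W W') s t :
    hconj w w' e (s - t) = hconj w w' e s - hconj w w' e t.
  by rewrite hconjD /hconj dcompNr dcompNl.
exists (hcl F0), (hcl G0); split.
  rewrite (hcl_comp _ _ (D0_comp0 G0 F0)) -(hcl_id (D0_one _)); apply/hcl_eq.
  by rewrite hconj_comp -(hconj1 u e) -hconjB; apply: key hE.
rewrite (hcl_comp _ _ (D0_comp0 F0 G0)) -(hcl_id (D0_one _)); apply/hcl_eq.
by rewrite hconj_comp -(hconj1 v e) -hconjB; apply: key h'E.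
Qed.

Lemma vanishing_shf_r n X T m l : m + n = l -> vanishing T (shf n X) m <-> vanishing T X l.
Proof.
by move=> e; split; apply: vanishing_hiso_r;
  [exact: hiso_sym (shf_hiso n X) | lia | exact: shf_hiso | lia].
Qed.

Lemma vanishing_shf_l n X T m l : m + n = l -> vanishing (shf n X) T l <-> vanishing X T m.
Proof.
by move=> e; split; apply: vanishing_hiso_l;
  [exact: hiso_sym (shf_hiso n X) | lia | exact: shf_hiso | lia].
Qed.

Lemma extends_shf n X Z Y : extends X Z Y -> extends (shf n X) (shf n Z) (shf n Y).
Proof.
move=> [f [g [Z0 [S [phi [isoZ _ _]]]]]].
have e : - n + n = 0 by apply: addNr.
pose S' := ses_hiso e (shf_hiso n X) (shf_hiso n Z0) (shf_hiso n Y) S.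
apply: (@extends_iso (shf n X) (shf n Z0) (shf n Y)); try exact: isomorphic_refl.
  by apply: shf_iso; exists phi.
by exists (ci S'), (cp S'); apply: tri_ses.
Qed.

Lemma extends_rotate X Z Y : extends X Z Y -> extends Z Y (shf 1 X).
Proof. by move=> [f [g t]]; have [h t'] := tri_rotate R t; exists g, h. Qed.

(** If X' is the cocone of f, then X'[1] is a cone of f, hence isomorphic to Y. *)
Lemma tri_unrotate X Z Y (f : hom X Z) (g : hom Z Y) :
  tri f g -> exists h : hom (shf (- 1) Y) X, tri h f.
Proof.
move=> t; have [X' [h t']] := tri_cocone R f.
have [h' t''] := tri_rotate R t'.
have [e isoe _] := tri_cone_unique R t t''.
have [x isox] : iso (shf (- 1) Y) X'.
  apply: isomorphic_trans (isomorphic_trans (shf_shf X' (addNr 1)) (shf0 X')).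
  by apply: shf_iso; exists e.
by exists (h \oc x); apply: tri_isoL.
Qed.

Lemma extends_unrotate X Z Y : extends X Z Y -> extends (shf (- 1) Y) X Z.
Proof. by move=> [f [g t]]; have [h t'] := tri_unrotate t; exists h, f. Qed.

Lemma extends_cone_iso X Z Y Y' (f : hom X Z) (g : hom Z Y) (g' : hom Z Y') :
  tri f g -> tri f g' -> iso Y Y'.
Proof. by move=> t t'; have [e isoe _] := tri_cone_unique R t t'; exists e. Qed.

Lemma extends_octahedron X U Y Z C :
  extends X U Y -> extends U Z C -> exists2 W, extends X Z W & extends Y W C.
Proof.
move=> [f1 [g1 t1]] [f2 [g2 t2]].
have [W [w [v [t [ta tb]]]]] := tri_octahedron R t1 t2.
by exists W; [exists (f2 \oc f1), w | exists v, t].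
Qed.

Lemma extends_octahedron_op X Z W Y C :
  extends X Z W -> extends Y W C -> exists2 U, extends X U Y & extends U Z C.
Proof.
move=> [f1 [g1 t1]] [f2 [g2 t2]].
have [U [a [b [u [ta tb]]]]] := tri_octahedron_op R t1 t2.
by exists U; [exists a, b | exists u, (g2 \oc g1)].
Qed.

Lemma ses_biproduct X Z Y (S : ses X Z Y) : D0 (sr S) = 0 -> D0 (ss S) = 0 ->
  exists (rX : hom Z X) (sY : hom Y Z),
    [/\ rX \oc ci S = one_ X, cp S \oc sY = one_ Y, rX \oc sY = 0
      & ci S \oc rX + sY \oc cp S = one_ Z].
Proof.
move=> r0 s0; exists (hcl r0), (hcl s0); split.
- rewrite (hcl_comp _ _ (D0_comp0 r0 (si_closed S))) -(hcl_id (D0_one _)).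
  by apply: hcl_irr; apply: sri.
- rewrite (hcl_comp _ _ (D0_comp0 (sp_closed S) s0)) -(hcl_id (D0_one _)).
  by apply: hcl_irr; apply: sps.
- rewrite (hcl_comp _ _ (D0_comp0 r0 s0)); apply/hcl_eq0; exists 0.
  by rewrite diff0 srs.
- have a0 := D0_comp0 (si_closed S) r0; have b0 := D0_comp0 s0 (sp_closed S).
  have ab0 : D0 (si S <* sr S + ss S <* sp S) = 0 by rewrite D0D a0 b0 addr0.
  rewrite (hcl_comp _ _ a0) (hcl_comp _ _ b0) -(hclD a0 b0 ab0) -(hcl_id (D0_one _)).
  by apply: hcl_irr; apply: sirsp.
Qed.

Lemma split_ses X Y : exists Z (S : ses X Z Y), D0 (sr S) = 0 /\ D0 (ss S) = 0.
Proof.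
have [|Z [S dE]] := @extension_exists k A R X Y 0; first by move=> m e; rewrite diff0.
by exists Z, S; rewrite D0_sr D0_ss dE rcomp0 lcomp0 oppr0.
Qed.

Lemma biproduct_exists X Y : exists Z : H, @is_biproduct k H X Y Z.
Proof.
have [Z [S [r0 s0]]] := split_ses X Y.
have [r [s [E1 E2 E3 E4]]] := ses_biproduct r0 s0.
by exists Z, (ci S), s, r, (cp S); split=> //; apply: cp_ci.
Qed.

Lemma biproduct_tri X Y Z (iX : hom X Z) (iY : hom Y Z) (pX : hom Z X) (pY : hom Z Y) :
  [/\ pX \oc iX = one_ X, pY \oc iY = one_ Y, pX \oc iY = 0, pY \oc iX = 0
    & iX \oc pX + iY \oc pY = one_ Z] -> tri iX pY.
Proof.
move=> [pi1 pi2 pi3 pi4 pi5]; have [Z0 [S [r0 s0]]] := split_ses X Y.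
have [r [s [E1 E2 E3 E4]]] := ses_biproduct r0 s0; have E5 := cp_ci S.
exists Z0, S, (iX \oc r + iY \oc cp S); split.
- exists (ci S \oc pX + s \oc pY); split.
    rewrite ccompDl !ccompDr !ccompA -(ccompA pX) -(ccompA pX iY) -(ccompA pY) -(ccompA pY iY).
    by rewrite pi1 pi2 pi3 pi4 !ccomp0l !ccomp0r !ccomp1l addr0 add0r E4.
  rewrite ccompDl !ccompDr !ccompA -(ccompA r) -(ccompA r s) -(ccompA (cp S)) -(ccompA (cp S) s).
  by rewrite E1 E2 E3 E5 !ccomp0l !ccomp0r !ccomp1l addr0 add0r pi5.
- by rewrite ccompDl !ccompA E1 E5 ccomp1r ccomp0r addr0.
- by rewrite ccompDr -!ccompA pi4 pi2 ccomp0l ccomp1l add0r.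
Qed.

Lemma biproduct_extends X Y Z : @is_biproduct k H X Y Z -> extends X Z Y.
Proof. by move=> [i [j [p [q h]]]]; exists i, q; apply: biproduct_tri h. Qed.

Lemma is_biproduct_sym X Y Z : @is_biproduct k H X Y Z -> @is_biproduct k H Y X Z.
Proof.
move=> [i [j [p [q [h1 h2 h3 h4 h5]]]]]; exists j, i, q, p; split=> //.
by rewrite addrC.
Qed.

Lemma tri_split X Y Z (f : hom X Z) (g : hom Z Y) :
  tri f g -> vanishing Y X 1 -> @is_biproduct k H X Y Z.
Proof.
move=> t v; have [s sE] := tri_surj t v (one_ Y).
have [r rE] := tri_cosurj t v (one_ X).
have [|r' r'E] := tri_lift t (z := one_ Z - s \oc g).
  by rewrite ccompBr -ccompA -sE ccomp1r ccomp1l subrr.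
have gf := tri_comp t.
have injf T (a b : hom T X) : f \oc a = f \oc b -> a = b.
  by move=> /(congr1 (fun x => r \oc x)); rewrite -!ccompA -rE !ccomp1l.
exists f, s, r', g; split=> //.
- apply: injf; rewrite -ccompA -r'E ccompBl ccompA gf ccomp0r subr0 ccomp1l.
  by rewrite ccomp1r.
- apply: injf; rewrite -ccompA -r'E ccompBl ccompA -sE ccomp1l ccomp1r subrr.
  by rewrite ccomp0r.
- by rewrite -r'E subrK.
Qed.

Lemma extends_split X Y Z : extends X Z Y -> vanishing Y X 1 -> @is_biproduct k H X Y Z.
Proof. by move=> [f [g t]]; apply: tri_split t. Qed.

Lemma biproduct_zero X O : @is_zero_object k H O -> @is_biproduct k H X O X.
Proof.
move=> O0; exists (one_ X), 0, (one_ X), 0; split; rewrite ?ccomp1l ?ccomp0l ?ccomp0r //.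
by rewrite addr0.
Qed.

Lemma zero_hom_l O T (f : hom O T) : @is_zero_object k H O -> f = 0.
Proof. by move=> O0; rewrite -[f]ccomp1r O0 ccomp0r. Qed.

Lemma shf_zero n O : @is_zero_object k H O -> @is_zero_object k H (shf n O).
Proof.
move=> O0; rewrite /is_zero_object.
have : vanishing (shf n O) (shf n O) 0.
  apply/(vanishing_shf_r _ _ (add0r n)); apply/(vanishing_shf_l _ _ (add0r n)).
  by move=> x; apply: zero_hom_l.
exact.
Qed.

End TriangleConstructions.

(** * Towers of extensions *)

Section Towers.
Variables (k : comPzRingType) (A : dgcat k) (R : pretriangulation A).
Implicit Types X Y Z T U V W C Q : A.
Notation H := (H0 A).
Notation hom := (@chom k H).
Notation iso X Y := (@isomorphic k H X Y).
Notation shf := (shf R).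
Variables kk pp : A -> Prop.

(** The properties of K and P on which the towers rest, stated for classes of objects closed under
    isomorphism in an abstract pretriangulated category. *)
Record orthogonal_pair : Prop := OrthogonalPair {
  kk_iso : forall X Y, iso X Y -> kk X -> kk Y;
  pp_iso : forall X Y, iso X Y -> pp X -> pp Y;
  pp_kk : forall X, pp X -> kk X;
  pp_zero : exists2 O, pp O & @is_zero_object k H O;
  pp_biproduct : forall X Y Z, pp X -> pp Y -> @is_biproduct k H X Y Z -> pp Z;
  kk_extends : forall X Z Y, kk X -> kk Y -> extends X Z Y -> kk Z;
  orth_pk : forall Q X (n : int), (0 < n)%R -> pp Q -> kk X -> vanishing Q X n;
  orth_kp : forall Q X (n : int), (0 < n)%R -> pp Q -> kk X -> vanishing X Q n;
  kk_cover : forall X, kk X -> exists X' Q, [/\ kk X', pp Q & extends X' Q X] }.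

(* [st n] is kk * kk[1] * ... * kk[n]. *)
Fixpoint st (n : nat) : A -> Prop :=
  if n is m.+1 then fun Z => exists X Y,
    [/\ st m X, exists2 K, kk K & iso Y (shf m.+1%:Z K) & extends X Z Y]
  else kk.

Hypothesis OP : orthogonal_pair.

Lemma st_iso n X Y : iso X Y -> st n X -> st n Y.
Proof.
case: n => [|n] i; first exact: kk_iso OP _ _ i.
move=> [U [V [sU sV e]]]; exists U, V; split=> //.
by apply: extends_iso e => //; exact: isomorphic_refl.
Qed.

Lemma st_van n Q Z (i : int) : (0 < i)%R -> pp Q -> st n Z -> vanishing Q Z i.
Proof.
elim: n Z i => [|n IH] Z i i0 pQ; first by move=> kZ; apply: (orth_pk OP).
move=> [X [Y [sX [K kK iY] [f [g t]]]]].
apply: (tri_van_mid_l t); first exact: IH.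
apply: (@vanishing_iso_r k A Q (shf n.+1%:Z K)); first exact: isomorphic_sym.
apply/(vanishing_shf_r _ _ _ (erefl (i + n.+1%:Z))); apply: (orth_pk OP) => //.
lia.
Qed.

Lemma st_mono n Z : st n Z -> st n.+1 Z.
Proof.
move=> sZ; have [O pO O0] := pp_zero OP.
exists Z, (shf n.+1%:Z O); split=> //.
  by exists O; [apply: pp_kk OP _ pO | apply: isomorphic_refl].
exact/biproduct_extends/biproduct_zero/shf_zero.
Qed.

Lemma st_mono_le n m Z : (n <= m)%N -> st n Z -> st m Z.
Proof.
move=> nm sZ; rewrite -(subnK nm); elim: (m - n)%N => [//|l IH].
by rewrite addSn; apply: st_mono.
Qed.

Lemma extends_unshift V W V' : extends (shf 1 V) W (shf 1 V') ->
  exists2 T, iso W (shf 1 T) & extends V T V'.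
Proof.
move=> e; exists (shf (- 1) W).
  apply: isomorphic_sym; apply: isomorphic_trans (shf0 R W).
  exact: (shf_shf R W (addrN 1)).
have back X : iso (shf (- 1) (shf 1 X)) X.
  exact: isomorphic_trans (shf_shf R X (addNr 1)) (shf0 R X).
by apply: extends_iso (extends_shf R (- 1) e); rewrite //; apply: isomorphic_refl.
Qed.

Definition st_pred n := if n is m.+1 then st m else kk.

(** A cover Q -> U of the lower part of the tower also serves for Z: by the octahedron its cone is
    T[1], where T extends the top factor, shifted down once, by the kernel V of Q -> U. *)
Lemma st_resolve n Z : st n Z -> exists V Q, [/\ pp Q, extends V Q Z & st_pred n V].
Proof.
elim: n Z => [|n IH] Z.
  by move=> kZ; have [V [Q [kV pQ e]]] := kk_cover OP kZ; exists V, Q.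
move=> [U [Y [sU [K kK iY] eUZ]]].
have [V [Q [pQ eV sV]]] := IH U sU.
have [W eQ eW] := extends_octahedron R (extends_rotate R eV) eUZ.
have iK : iso Y (shf 1 (shf n%:Z K)).
  apply: (isomorphic_trans iY); apply: isomorphic_sym; apply: shf_shf; lia.
have {}eW : extends (shf 1 V) W (shf 1 (shf n%:Z K)).
  by apply: extends_iso eW => //; apply: isomorphic_refl.
have [T iT eT] := extends_unshift eW.
exists T, Q; split=> //.
  have e1 := extends_unrotate R eQ.
  apply: extends_iso e1; rewrite //; try exact: isomorphic_refl.
  apply: isomorphic_trans (shf_iso R (- 1) iT) _.
  exact: isomorphic_trans (shf_shf R T (addNr 1)) (shf0 R T).
case: n sV {IH sU eUZ iY eW iK} eT => [|n] /= sV eT.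
  by apply: (kk_extends OP) eT => //; apply: (kk_iso OP) kK; apply: isomorphic_sym; apply: shf0.
by exists V, (shf n.+1%:Z K); split=> //; exists K => //; apply: isomorphic_refl.
Qed.

(** Rebracketing: [st] splits off the last factor of a tower, whereas here the first one is split
    off. *)
Lemma st_extend_kk n X Y Z : kk X -> st n Y -> extends X Z (shf 1 Y) -> st n.+1 Z.
Proof.
elim: n X Y Z => [|n IH] X Y Z kX sY e.
  by exists X, (shf 1 Y); split=> //; exists Y => //; apply: isomorphic_refl.
have [U [C [sU [K kK iC] eC]]] := sY.
have [W eW1 eW2] := extends_octahedron_op R e (extends_shf R 1 eC).
exists W, (shf 1 C); split=> //; first exact: IH eW1.
exists K => //; apply: isomorphic_trans (shf_iso R 1 iC) _.
by apply: shf_shf; lia.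
Qed.

Lemma st_cone n V Q Z : pp Q -> st n V -> extends V Q Z -> st n.+1 Z.
Proof.
move=> pQ sV e; apply: (st_extend_kk (pp_kk OP pQ) sV).
exact: extends_rotate.
Qed.

(** A horseshoe argument: Z is covered by U2, a sum of Q and Q', and the kernel T is an extension of
    V' by V, to which the induction applies. *)
Lemma st_extends n X Z Y : st n X -> st n Y -> extends X Z Y -> st n Z.
Proof.
elim: n X Y Z => [|n IH] X Y Z sX sY e; first exact: (kk_extends OP) e.
have [V [Q [pQ eX sV]]] := st_resolve sX.
have [V' [Q' [pQ' eY sV']]] := st_resolve sY.
have [W eQ eW] := extends_octahedron R (extends_rotate R eX) e.
have [U eU eUW] := extends_octahedron_op R eW (extends_rotate R eY).
(* The obstruction to splitting U lies in Ext^2(Q', V), which vanishes because V is in a tower. *)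
have bU : @is_biproduct k H Q' (shf 1 V) U.
  apply: is_biproduct_sym; apply: extends_split eU _.
  by apply/(vanishing_shf_r _ _ _ (erefl (1 + 1))); apply: st_van sV.
have [W2 eW2 eV] := extends_octahedron R (biproduct_extends R bU) eUW.
have [T iT eT] := extends_unshift eV.
have [U2 eU2 eUZ] := extends_octahedron_op R eQ eW2.
apply: (@st_extend_kk n U2 T).
- apply: (pp_kk OP); apply: (pp_biproduct OP pQ pQ').
  by apply: extends_split eU2 _; apply: (orth_pk OP) => //; apply: (pp_kk OP).
- exact: IH sV sV' eT.
- by apply: extends_iso eUZ => //; apply: isomorphic_refl.
Qed.

Lemma st_biproduct_pp n Z Q W : st n Z -> pp Q -> @is_biproduct k H Z Q W -> st n W.
Proof.
move=> sZ pQ b; apply: (st_extends sZ _ (biproduct_extends R b)).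
exact: (st_mono_le (n := 0%N)) (leq0n n) (pp_kk OP pQ).
Qed.

(* Schanuel's lemma: the homotopy pullback of the two covers of W *)
Lemma schanuel n V Q V' Q' W : pp Q -> pp Q' -> extends V Q W -> extends V' Q' W ->
  vanishing Q' V 1 -> st n V' -> exists2 E, st n E & @is_biproduct k H V Q' E.
Proof.
move=> pQ pQ' [j [q t]] [j' [q' t']] v sV'.
have [B [iQ [iQ' [prQ [prQ' bB]]]]] := biproduct_exists R Q Q'.
have [b1 b2 b3 b4 b5] := bB.
have [E [m tE]] := tri_cocone R (q \oc prQ + q' \oc prQ').
have tQ := biproduct_tri R bB.
have tQ' : tri iQ' prQ by apply: (biproduct_tri R (iY := iQ) (pX := prQ')); split; rewrite // addrC.
have [h tW] := tri_rotate R tE.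
have back X : iso (shf (- 1) (shf 1 X)) X.
  exact: isomorphic_trans (shf_shf R X (addNr 1)) (shf0 R X).
(* The octahedron for X -> B -> W: E is an extension of the complement Y of X in B by the kernel U
   of the restricted morphism X -> W. It is used for both summands of B. *)
have key X (i : hom X B) Y (p : hom B Y) U (jj : hom U X) (qq : hom X W) :
    tri i p -> (q \oc prQ + q' \oc prQ') \oc i = qq -> tri jj qq -> extends U E Y.
  move=> ti iq tq; have [h2 tq2] := tri_rotate R tq.
  have [T [w [s [r [tw tr]]]]] := tri_octahedron R ti tW.
  rewrite iq in tw; have iT := extends_cone_iso R tw tq2.
  have e1 : extends Y (shf 1 U) (shf 1 E).
    by apply: (@extends_iso _ _ R Y T (shf 1 E)) => //; try exact: isomorphic_refl; exists s, r.
  have e2 : extends E Y (shf 1 U).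
    by apply: extends_iso (extends_unrotate R e1); rewrite //; apply: isomorphic_refl.
  by apply: extends_iso (extends_unrotate R e2); rewrite //; apply: isomorphic_refl.
have eV : extends V E Q'.
  apply: key tQ _ t.
  by rewrite ccompDl !ccompA b1 b4 ccomp0r addr0 ccomp1r.
have eV' : extends V' E Q.
  apply: key tQ' _ t'.
  by rewrite ccompDl !ccompA b2 b3 ccomp0r add0r ccomp1r.
exists E; last exact: extends_split eV v.
apply: (st_biproduct_pp sV' pQ); apply: (extends_split eV').
exact: (st_van _ pQ sV').
Qed.

Lemma biproduct_van_l X Y Z T n : @is_biproduct k H X Y Z -> vanishing T Z n -> vanishing T X n.
Proof.
move=> [i [j [p [q [b1 b2 b3 b4 b5]]]]].
have [i0 [i00 iE]] := hclP i; have [p0 [p00 pE]] := hclP p; subst i p.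
move: b1; rewrite (hcl_comp _ _ (D0_comp0 p00 i00)) -(hcl_id (D0_one X)) => /hcl_eq[h hE].
have e : n - 1 + 1 = n by rewrite subrK.
have e1 : -1 + n = n - 1 by rewrite addrC.
move=> /(vanishingP _ _ e erefl) v; apply/(vanishingP _ _ e erefl) => z z0.
have [|w wE] := v (i0 <* z); first by rewrite diff_lcc // z0 lcomp0.
exists (p0 <* w - dcomp e1 h z).
rewrite diffD diffN diff_lcc // -wE.
rewrite (diff_closed_r e1 e (addNr 1) erefl (add0r n)) // -hE lcompA.
by rewrite -/(lcomp _ _) lcompBl lcomp1 subKr.
Qed.

(** Membership in [st n] up to a complement in P, which is all that Schanuel's lemma yields about
    the kernel of a given cover. *)
Definition st_summand n Z := exists Q W, [/\ pp Q, @is_biproduct k H Z Q W & st n W].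

Lemma st_st_summand n Z : st n Z -> st_summand n Z.
Proof.
have [O pO O0] := pp_zero OP => sZ; exists O, Z; split=> //.
exact: biproduct_zero.
Qed.

(* E^1(P, V) = 0 means that Q -> Z is surjective on morphisms from objects of P *)
Lemma st_summand_kernel n V Q Z : pp Q -> extends V Q Z ->
  (forall Q', pp Q' -> vanishing Q' V 1) -> st_summand n.+1 Z -> st_summand n V.
Proof.
move=> pQ e vV [P0 [W [pP bW sW]]].
have [B bB] := biproduct_exists R Q P0.
have [Y eY1 eY2] := extends_octahedron R e (biproduct_extends R bB).
have vZ : vanishing P0 Z 1.
  by apply: (biproduct_van_l bW); apply: (st_van _ pP sW).
have bY := extends_split eY2 vZ.
have iYW : iso Y W := biproduct_unique bY bW.
have sY : st n.+1 Y by apply: st_iso sW; apply: isomorphic_sym.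
have [V' [Q' [pQ' eV' sV']]] := st_resolve sY.
have pB := pp_biproduct OP pQ pP bB.
have [E sE bE] := schanuel pB pQ' eY1 eV' (vV _ pQ') sV'.
by exists Q', E.
Qed.

(** Composing a cover of W with the projection to Z enlarges its kernel by the complement P0 only,
    and [st n] absorbs this. The cone lies one level above the kernel, so the argument starts at
    level 1. *)
Lemma st_summand_st n Z : st_summand n.+1 Z -> st n.+1 Z.
Proof.
move=> [P0 [W [pP bW sW]]].
have [V [Q [pQ e sV]]] := st_resolve sW.
have [U eU1 eU2] := extends_octahedron_op R e (biproduct_extends R (is_biproduct_sym bW)).
apply: (st_cone pQ _ eU2); apply: (st_extends sV _ eU1).
exact: (st_mono_le (n := 0%N)) (leq0n n) (pp_kk OP pP).
Qed.

Lemma st_unresolve n Z : st n Z -> exists V Q, [/\ pp Q, extends V Q Z & st n V].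
Proof.
move=> sZ; have [V [Q [pQ e sV]]] := st_resolve sZ; exists V, Q; split=> //.
by case: n sZ sV => [//|n] sZ sV; apply: st_mono.
Qed.

End Towers.

(** * Twisted complexes *)

Section TwistedComplexes.
Variables (k : comPzRingType) (K : dgcat k).
Notation Sh := (shifts K).
Notation pre := (pretr K).

(** The diagonal matrix with entries t i; composing with [tw_kron] hides the transport along i =
    j. *)
Definition diagm (X : pre) (Y : tix X -> Sh) n (t : forall i, dhom (X i) (Y i) n)
  (i j : tix X) : dhom (X j) (Y i) n := dcomp (addr0 n) (t i) (tw_kron erefl i j).

Lemma diagm_suml (X : pre) (Y : tix X -> Sh) n (t : forall i, dhom (X i) (Y i) n)
    (Z : Sh) m l (e : n + m = l) (f : forall i, dhom Z (X i) m) i :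
  \sum_j dcomp e (diagm t i j) (f j) = dcomp e (t i) (f i).
Proof.
under eq_bigr => j _ do rewrite (dcompA (addr0 n) e (add0r m) e).
by rewrite -dcomp_sumr tw_kron_suml dcomp1l.
Qed.

Lemma diagm_sumr (X : pre) (Y : tix X -> Sh) n (t : forall i, dhom (X i) (Y i) n)
    (Z : Sh) m l (e : m + n = l) (f : forall i, dhom (Y i) Z m) i :
  \sum_j dcomp e (f j) (diagm t j i) = dcomp e (f i) (t i).
Proof.
under eq_bigr => j _ do rewrite -(dcompA e (addr0 l) (addr0 n) e).
by rewrite tw_kron_sumr dcomp1r.
Qed.

Lemma unit_kron (X : pre) (i j : tix X) m (e0 : m = 0) (e : 0 + 0 = m) :
  dcomp e (dunit (X i) erefl) (tw_kron erefl i j) = tw_kron e0 i j.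
Proof.
by subst m; rewrite (Prop_irrelevance e (add0r 0)) dcomp1l.
Qed.

Variable n : int.

Lemma conj_shift_to (X Y : Sh) (f : dhom X Y 1) m (e : 1 - n = m) (e' : - n + 1 = m) :
  dcomp e (conj_shift n f) (to_shift n X) = dcomp e' (to_shift n Y) f.
Proof.
rewrite /conj_shift.
have e1 : 1 + n - n = 1 by lia.
have e2 : n - n = 0 by rewrite subrr.
rewrite (dcompA (degs n 1) e e1 e') (dcompA erefl e1 e2 (addr0 1)).
by rewrite (of_to_shift X e2 erefl) dcomp1r.
Qed.

Definition to_Sigma (X : pre) : @dhom k pre X (Sigma n X) (- n) :=
  diagm (fun i => to_shift n (X i)).
Definition of_Sigma (X : pre) : @dhom k pre (Sigma n X) X n :=
  @diagm (Sigma n X) X n (fun i => of_shift n (X i)).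

Arguments to_Sigma : clear implicits.
Arguments of_Sigma : clear implicits.

(** The sign (-1)^n in the twisting element of [Sigma] makes the two sums in the differential of a
    morphism of degree -n cancel. *)
Lemma to_Sigma_closed X m (e : - n + 1 = m) : diff e (to_Sigma X) = 0.
Proof.
apply: famP => i j.
rewrite -[LHS]/(@diff k Sh (X j) (Sigma n X i) _ _ e (to_Sigma X i j) +
  \sum_l @dcomp k Sh (X j) (Sigma n X l) (Sigma n X i) _ _ _ (degl e)
    (@tw k Sh (Sigma n X) i l) (diagm (fun i => to_shift n (X i)) l j) -
  sg k (- n) *: \sum_l @dcomp k Sh (X j) (X l) (Sigma n X i) _ _ _ e
    (diagm (fun i => to_shift n (X i)) i l) (@tw k Sh X l j)) -[RHS]/(0 : dhom (X j) _ m).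
have -> : \sum_l @dcomp k Sh (X j) (X l) (Sigma n X i) _ _ _ e
    (diagm (fun i => to_shift n (X i)) i l) (@tw k Sh X l j) =
    dcomp e (to_shift n (X i)) (@tw k Sh X i j).
  exact: (@diagm_suml X (fun i => Sigma n X i) _ (fun i => to_shift n (X i))).
have -> : \sum_l @dcomp k Sh (X j) (Sigma n X l) (Sigma n X i) _ _ _ (degl e)
    (@tw k Sh (Sigma n X) i l) (diagm (fun i => to_shift n (X i)) l j) =
    dcomp (degl e) (@tw k Sh (Sigma n X) i j) (to_shift n (X j)).
  exact: (@diagm_sumr X (fun i => Sigma n X i) _ (fun i => to_shift n (X i))).
rewrite [@tw k Sh (Sigma n X) i j](_ : _ = sg k n *: conj_shift n (@tw k Sh X i j)) //.
rewrite dcompZl (conj_shift_to _ (degl e) e) sgN addrK.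
rewrite [to_Sigma X i j]/(dcomp _ _ _).
rewrite (diff_closed_l (addr0 (- n)) e e (erefl (0 + 1)) e) ?diff_to_shift //.
by rewrite tw_kron_diff dcomp0r scaler0.
Qed.

Lemma of_Sigma_closed X m (e : n + 1 = m) : diff e (of_Sigma X) = 0.
Proof.
apply: famP => i j.
rewrite -[LHS]/(@diff k Sh (Sigma n X j) (X i) _ _ e (of_Sigma X i j) +
  \sum_l @dcomp k Sh (Sigma n X j) (X l) (X i) _ _ _ (degl e)
    (@tw k Sh X i l) (@diagm (Sigma n X) X n (fun i => of_shift n (X i)) l j) -
  sg k n *: \sum_l @dcomp k Sh (Sigma n X j) (Sigma n X l) (X i) _ _ _ e
    (@diagm (Sigma n X) X n (fun i => of_shift n (X i)) i l)
    (@tw k Sh (Sigma n X) l j)) -[RHS]/(0 : dhom (Sigma n X j) _ m).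
have -> : \sum_l @dcomp k Sh (Sigma n X j) (X l) (X i) _ _ _ (degl e)
    (@tw k Sh X i l) (@diagm (Sigma n X) X n (fun i => of_shift n (X i)) l j) =
    dcomp (degl e) (@tw k Sh X i j) (of_shift n (X j)).
  exact: (@diagm_sumr (Sigma n X) X n (fun i => of_shift n (X i))).
have -> : \sum_l @dcomp k Sh (Sigma n X j) (Sigma n X l) (X i) _ _ _ e
    (@diagm (Sigma n X) X n (fun i => of_shift n (X i)) i l)
    (@tw k Sh (Sigma n X) l j) =
    dcomp e (of_shift n (X i)) (@tw k Sh (Sigma n X) i j).
  exact: (@diagm_suml (Sigma n X) X n (fun i => of_shift n (X i))).
rewrite -[@tw k Sh (Sigma n X) i j]/(sg k n *: conj_shift n (@tw k Sh X i j)).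
rewrite dcompZr scalerA sgK scale1r.
have -> : dcomp e (of_shift n (X i)) (conj_shift n (@tw k Sh X i j)) =
    dcomp (degl e) (@tw k Sh X i j) (of_shift n (X j)).
  rewrite /conj_shift.
  have e1 : n - n = 0 by rewrite subrr.
  have e2 : 0 + (1 + n) = m by lia.
  rewrite -(dcompA e1 e2 (degs n 1) e) (of_to_shift (X i) e1 erefl).
  have e3 : 0 + 1 = 1 :> int by [].
  by rewrite -(dcompA e3 (degl e) erefl e2) dcomp1l.
rewrite addrK [of_Sigma X i j]/(dcomp _ _ _).
rewrite (diff_closed_l (addr0 n) e e (erefl (0 + 1)) e) ?diff_of_shift //.
by rewrite tw_kron_diff dcomp0r scaler0.
Qed.

Definition Sigma_hiso (X : pre) : hiso (- n) n X (Sigma n X).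
Proof.
refine (@Hiso k pre (- n) n X (Sigma n X) (addrN n) (to_Sigma X) (of_Sigma X) _ _ _ _).
- exact: to_Sigma_closed.
- exact: of_Sigma_closed.
- move=> m e e0; apply: famP => i j.
  apply: etrans (@diagm_suml (Sigma n X) X n (fun i => of_shift n (X i)) (X j) _ _ e
    (fun l => to_Sigma X l j) i) _.
  rewrite -[RHS]/(tw_kron e0 i j) [to_Sigma X i j]/(dcomp _ _ _).
  have e1 : n - n = 0 by rewrite subrr.
  have e2 : 0 + 0 = m by rewrite e0.
  rewrite -(dcompA e1 e2 (addr0 (- n)) e) (of_to_shift (X i) e1 erefl).
  exact: (@unit_kron X).
- move=> m e e0; apply: famP => i j.
  apply: etrans (@diagm_suml X (Sigma n X) (- n) (fun i => to_shift n (X i)) (Sigma n X j) _ _ e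
    (fun l => of_Sigma X l j) i) _.
  rewrite -[RHS]/(@tw_kron k Sh (Sigma n X) m e0 i j) [of_Sigma X i j]/(dcomp _ _ _).
  have e1 : - n + n = 0 by rewrite addNr.
  have e2 : 0 + 0 = m by rewrite e0.
  rewrite -(dcompA e1 e2 (addr0 n) e) (to_of_shift (X i) e1 erefl).
  exact: (@unit_kron (Sigma n X)).
Defined.

End TwistedComplexes.

Lemma sum_sumType (V : nmodType) (I J : finType) (F : I + J -> V) :
  \sum_i F i = \sum_i F (inl i) + \sum_j F (inr j).
Proof. by rewrite big_sumType. Qed.

(** * Cones of twisted complexes as graded split sequences *)

Section Cones.
Variables (k : comPzRingType) (K : dgcat k).
Notation Sh := (shifts K).
Notation pre := (pretr K).
Variables (X Y : pre) (f : cocycles X Y 0).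
Notation C := (Defs.cone f).
Notation SX := (Sigma 1 X).

Definition cone_retr : @dhom k pre C Y 0 := fun i j =>
  match j return dhom (cone_ob j) (Y i) 0 with
  | inl j => tw_kron erefl i j
  | inr j => 0
  end.

Definition cone_sect : @dhom k pre SX C 0 := fun i j =>
  match i return dhom (SX j) (cone_ob i) 0 with
  | inl i => 0
  | inr i => @tw_kron k Sh SX 0 erefl i j
  end.

Lemma unit_comp_kron (Z : pre) (i j : tix Z) (e : 0 + 0 = 0 :> int) :
  dcomp e (dunit (Z i) erefl) (tw_kron erefl i j) = tw_kron erefl i j.
Proof. exact: unit_kron. Qed.

Lemma cone_retr_incl : cone_retr <* (cval (cone_incl f) : @dhom k pre Y C 0) = one (Y : pre).
Proof.
apply: famP => i j; rewrite -[RHS]/(tw_kron erefl i j : dhom (Y j) (Y i) 0).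
rewrite -[LHS]/(\sum_(l : tix Y + tix X) @dcomp k Sh (Y j) (@cone_ob k K X Y l) (Y i) _ _ _ (add0r 0)
  (cone_retr i l) (@cone_incl_hom k K X Y f l j)).
rewrite sum_sumType [X in _ + X]big1 ?addr0; last by move=> l _; apply: dcomp0l.
rewrite -[LHS]/(\sum_l dcomp (add0r 0) (tw_kron erefl i l) (tw_kron erefl l j)).
by rewrite tw_kron_suml unit_comp_kron.
Qed.

Lemma cone_proj_sect : (cval (cone_proj f) : @dhom k pre C SX 0) <* cone_sect = one (SX : pre).
Proof.
apply: famP => i j; rewrite -[RHS]/(@tw_kron k Sh SX 0 erefl i j : dhom (SX j) (SX i) 0).
rewrite -[LHS]/(\sum_(l : tix Y + tix X) @dcomp k Sh (SX j) (@cone_ob k K X Y l) (SX i) _ _ _ (add0r 0)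
  (@cone_proj_hom k K X Y f i l) (cone_sect l j)).
rewrite sum_sumType [X in X + _]big1 ?add0r; last by move=> l _; apply: dcomp0l.
rewrite -[LHS]/(\sum_l @dcomp k Sh (SX j) (SX l) (SX i) _ _ _ (add0r 0)
  (@tw_kron k Sh SX 0 erefl i l) (@tw_kron k Sh SX 0 erefl l j)).
by rewrite tw_kron_suml unit_comp_kron.
Qed.

Lemma cone_proj_incl : (cval (cone_proj f) : @dhom k pre C SX 0) <*
  (cval (cone_incl f) : @dhom k pre Y C 0) = 0.
Proof.
apply: famP => i j; rewrite -[RHS]/(0 : dhom (Y j) (SX i) 0).
rewrite -[LHS]/(\sum_(l : tix Y + tix X) @dcomp k Sh (Y j) (@cone_ob k K X Y l) (SX i) _ _ _ (add0r 0)
  (@cone_proj_hom k K X Y f i l) (@cone_incl_hom k K X Y f l j)).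
by rewrite sum_sumType !big1 ?addr0 // => l _; [apply: dcomp0r | apply: dcomp0l].
Qed.

Lemma cone_retr_sect : cone_retr <* cone_sect = 0.
Proof.
apply: famP => i j; rewrite -[RHS]/(0 : dhom (SX j) (Y i) 0).
rewrite -[LHS]/(\sum_(l : tix Y + tix X) @dcomp k Sh (SX j) (@cone_ob k K X Y l) (Y i) _ _ _ (add0r 0)
  (cone_retr i l) (cone_sect l j)).
by rewrite sum_sumType !big1 ?addr0 // => l _; [apply: dcomp0l | apply: dcomp0r].
Qed.

Lemma cone_splitting :
  (cval (cone_incl f) : @dhom k pre Y C 0) <* cone_retr +
  cone_sect <* (cval (cone_proj f) : @dhom k pre C SX 0) = one (C : pre).
Proof.
apply: famP => i j; rewrite -[RHS]/(@tw_kron k Sh C 0 erefl i j : dhom (@cone_ob k K X Y j) (@cone_ob k K X Y i) 0).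
rewrite -[LHS]/(\sum_l @dcomp k Sh (@cone_ob k K X Y j) (Y l) (@cone_ob k K X Y i) _ _ _ (add0r 0)
    (@cone_incl_hom k K X Y f i l) (cone_retr l j) +
  \sum_l @dcomp k Sh (@cone_ob k K X Y j) (SX l) (@cone_ob k K X Y i) _ _ _ (add0r 0)
    (cone_sect i l) (@cone_proj_hom k K X Y f l j)).
case: i => i; case: j => j.
- rewrite [X in _ + X]big1 ?addr0; last by move=> l _; apply: dcomp0l.
  rewrite -[LHS]/(\sum_l dcomp (add0r 0) (tw_kron erefl i l) (tw_kron erefl l j)).
  rewrite tw_kron_suml unit_comp_kron.
  case: (eqVneq i j) => [<-|ij]; first by rewrite !tw_kron_eq.
  by rewrite !tw_kron_neq //; apply: contra ij => /eqP[->].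
- rewrite !big1 ?addr0; first by rewrite tw_kron_neq.
    by move=> l _; apply: dcomp0l.
  by move=> l _; apply: dcomp0r.
- rewrite !big1 ?addr0; first by rewrite tw_kron_neq.
    by move=> l _; apply: dcomp0r.
  by move=> l _; apply: dcomp0l.
- rewrite [X in X + _]big1 ?add0r; last by move=> l _; apply: dcomp0l.
  rewrite -[LHS]/(\sum_l @dcomp k Sh (SX j) (SX l) (SX i) _ _ _ (add0r 0)
    (@tw_kron k Sh SX 0 erefl i l) (@tw_kron k Sh SX 0 erefl l j)).
  rewrite tw_kron_suml unit_comp_kron.
  case: (eqVneq i j) => [<-|ij]; first by rewrite !tw_kron_eq.
  by rewrite !tw_kron_neq //; apply: contra ij => /eqP[->].
Qed.

Definition cone_ses : @ses k pre Y C SX.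
Proof.
refine (@Ses k pre Y C SX (cval (cone_incl f)) (cval (cone_proj f)) cone_retr cone_sect
  _ _ cone_retr_incl cone_proj_sect cone_proj_incl cone_retr_sect cone_splitting).
- exact: cval_closed.
- exact: cval_closed.
Defined.

(** The connecting cocycle is the off-diagonal entry of the twisting element of the cone. *)
Lemma cone_ses_delta : sdelta cone_ses = (cval f : @dhom k pre X Y 0) <* hv (Sigma_hiso 1 X).
Proof.
apply: famP => i j.
rewrite -[RHS]/(\sum_l dcomp (add0r 1) (cval f i l)
  (@diagm k K SX X 1 (fun i => of_shift 1 (X i)) l j)).
have -> : \sum_l dcomp (add0r 1) (cval f i l)
  (@diagm k K SX X 1 (fun i => of_shift 1 (X i)) l j) =
  dcomp (add0r 1) (cval f i j) (of_shift 1 (X j)).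
  exact: (@diagm_sumr k K SX X 1 (fun i => of_shift 1 (X i))).
rewrite -[LHS]/(\sum_(l : tix Y + tix X) @dcomp k Sh (SX j) (@cone_ob k K X Y l) (Y i) _ _ _ (add0r 1)
  (cone_retr i l) ((D0 cone_sect) l j)).
rewrite sum_sumType [X in _ + X]big1 ?addr0; last by move=> l _; apply: dcomp0l.
rewrite -[LHS]/(\sum_l dcomp (add0r 1) (tw_kron erefl i l) ((D0 cone_sect) (inl l) j)).
rewrite tw_kron_suml dcomp1l.
rewrite -[LHS]/(@diff k Sh (SX j) (Y i) _ _ (add0r 1) 0 +
  \sum_(l : tix Y + tix X) @dcomp k Sh (SX j) (@cone_ob k K X Y l) (Y i) _ _ _ (degl (add0r 1))
    (@cone_tw k K X Y f (inl i) l) (cone_sect l j) -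
  sg k 0 *: \sum_l @dcomp k Sh (SX j) (SX l) (Y i) _ _ _ (add0r 1) 0 (@tw k Sh SX l j)).
rewrite diff0 add0r [X in _ - _ *: X]big1; last by move=> l _; apply: dcomp0l.
rewrite scaler0 subr0 sum_sumType [X in X + _]big1 ?add0r; last by move=> l _; apply: dcomp0r.
rewrite -[LHS]/(\sum_l @dcomp k Sh (SX j) (SX l) (Y i) _ _ _ (degl (add0r 1))
   (dcomp (add0r 1) (cval f i l) (of_shift 1 (X l))) (@tw_kron k Sh SX 0 erefl l j)).
rewrite (@tw_kron_sumr k Sh SX).
exact: dcomp1r.
Qed.

End Cones.

Definition pretr_pretriangulation (k : comPzRingType) (K : dgcat k) :
  pretriangulation (pretr K).
Proof.
exact: (@Pretriangulation k (pretr K) (fun n X => Sigma n X) (fun n X => Sigma_hiso n X)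
  (fun X Y f => Defs.cone f) (fun X Y f => cone_ses f) (fun X Y f => cone_ses_delta f)).
Defined.

Definition fully_faithful (k : comPzRingType) (C D : lincat k) (F : linfun C D) :=
  forall X Y : C, injective (@lf_hom k C D F X Y) /\
    forall h, exists f : chom X Y, lf_hom F f = h.

(** * Resolutions by objects of P *)

Section Resolutions.
Variables (k : comPzRingType) (A K : dgcat k) (R : pretriangulation A).
Variables (E : linfun (H0 K) (H0 A)) (P I : H0 K -> Prop).
Implicit Types (Q J : H0 K) (Z V : A).
Notation H := (H0 A).
Notation hom := (@chom k H).
Notation iso X Y := (@isomorphic k H X Y).

Definition in_ob (S : H0 K -> Prop) Z := exists2 X : H0 K, S X & iso Z (E X).
Notation kk := (in_ob xpredT).
Notation pp := (in_ob P).

Hypothesis EFF : fully_faithful E.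
Hypothesis OP : orthogonal_pair kk pp.
Hypothesis IP : forall J, I J -> P J.

Definition nonneg := forall (X Y : H0 K) (n : int), (n < 0)%R -> @vanishing k A (E X) (E Y) n.

Definition Bn n Z := st R kk n Z /\
  forall (i : nat) J, (0 < i)%N -> I J -> @vanishing k A Z (E J) i%:Z.

Definition vanP Z := forall Q (i : nat), (0 < i)%N -> P Q -> @vanishing k A (E Q) Z (- i%:Z).

Lemma in_obE S X : S X -> in_ob S (E X).
Proof. by exists X => //; apply: isomorphic_refl. Qed.

Lemma E_inj X Y : injective (@lf_hom k _ _ E X Y).
Proof. by have [] := EFF X Y. Qed.

Lemma E_surj X Y h : exists f : chom X Y, lf_hom E f = h.
Proof. by have [_] := EFF X Y. Qed.

Lemma E_eq0 X Y (f : chom X Y) : lf_hom E f = 0 <-> f = 0.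
Proof.
by split=> [|->]; [rewrite -(linf0 (@lf_linear _ _ _ E X Y)) => /E_inj
  | exact: linf0 (@lf_linear _ _ _ E X Y)].
Qed.

(** Shifting the first argument up lowers the degree further, so towers inherit the vanishing. A
    shift of the second argument raises the degree, whence [vanP] is a genuine condition. *)
Lemma st_nonneg n Z (Y : H0 K) (i : int) : nonneg -> st R kk n Z -> (i < 0)%R ->
  @vanishing k A Z (E Y) i.
Proof.
move=> NN; elim: n Z i => [|n IH] Z i.
  move=> [X _ iX] i0; apply: (@vanishing_iso_l k A (E Y) (E X)); last exact: NN.
  exact: isomorphic_sym.
move=> [U [V [sU [C [X _ iX] iC] [f [g t]]]]] i0.
apply: (tri_van_mid_r t); first exact: IH.
apply: (@vanishing_iso_l k A _ (shf R n.+1%:Z C)); first exact: isomorphic_sym.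
apply/(vanishing_shf_l R (m := i - n.+1%:Z) _ _ _); first by rewrite subrK.
apply: (@vanishing_iso_l k A (E Y) (E X)); first exact: isomorphic_sym.
apply: NN; lia.
Qed.

(* The complex X n -> ... -> X 0 is obtained from Z by splicing n triangles. *)
Fixpoint resolves n (X : nat -> H0 K) (D : forall i, chom (X i.+1) (X i))
    Z (p : hom (E (X 0%N)) Z) : Prop :=
  if n is m.+1 then
    exists (V : A) (j : hom V (E (X 0%N))) (q : hom (E (X 1%N)) V),
      [/\ tri j p, lf_hom E (D 0%N) = j \oc q
        & @resolves m (fun i => X i.+1) (fun i => D i.+1) V q]
  else is_iso p.

Lemma resolves_st n X D Z p : (forall i, (i < n)%N -> P (X i)) ->
  @resolves n X D Z p -> st R kk n Z.
Proof.
elim: n X D Z p => [|n IH] X D Z p PX.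
  by move=> isop; exists (X 0%N) => //; apply: isomorphic_sym; exists p.
move=> [V [j [q [t _ r]]]].
apply: (st_cone OP (V := V) (Q := E (X 0%N))); last by exists j, p.
  by apply: in_obE; apply: PX.
by apply: IH r => i i_n; apply: PX.
Qed.

Lemma resolves_epi n X D Z p (T : H0 K) (c : hom Z (E T)) : nonneg ->
  (forall i, (i < n)%N -> P (X i)) -> @resolves n X D Z p -> c \oc p = 0 -> c = 0.
Proof.
move=> NN; case: n => [|n] PX.
  by move=> [p' [_ pp']] cp0; rewrite -[c]ccomp1r -pp' -ccompA cp0 ccomp0l.
move=> [V [j [q [t _ r]]]]; apply: (tri_coinj t).
by apply: (@st_nonneg n) => //; apply: resolves_st r => i i_n; apply: PX.
Qed.

Lemma resolves_surj n X D Z p Q (b : hom (E Q) Z) : P Q ->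
  (forall i, (i < n)%N -> P (X i)) -> @resolves n X D Z p -> exists z, b = p \oc z.
Proof.
move=> PQ; case: n => [|n] PX.
  by move=> [p' [_ pp']]; exists (p' \oc b); rewrite -ccompA pp' ccomp1l.
move=> [V [j [q [t _ r]]]]; apply: (tri_surj t).
by apply: (st_van OP (n := n)) => //; [exact: in_obE | apply: resolves_st r => i i_n; apply: PX].
Qed.

Lemma resolution_exists n Z : st R kk n Z -> exists X D p,
  (forall i, (i < n)%N -> P (X i)) /\ @resolves n X D Z p.
Proof.
elim: n Z => [|n IH] Z.
  move=> [X _ [f [g [gf fg]]]]; exists (fun=> X), (fun=> 0), g; split=> //.
  by exists f.
move=> sZ; have [V [Q [[Q0 PQ0 [y yiso]] [j [p t]] sV]]] := st_resolve OP sZ.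
have [X [D [q [PX r]]]] := IH V sV.
have [y' yy'] := yiso; have t' := tri_isoM t yy'.
have [d0 d0E] := E_surj ((y \oc j) \oc q).
pose X' i := if i is i'.+1 then X i' else Q0.
pose D' i : chom (X' i.+1) (X' i) := if i is i'.+1 then D i' else d0.
exists X', D', (p \oc y'); split; first by case.
by exists V, (y \oc j), q.
Qed.

Lemma resolves_complex d X D Z p : nonneg -> (forall i, (i <= d)%N -> P (X i)) ->
  @resolves d.+1 X D Z p -> @P_complex k K P d X D.
Proof.
move=> NN; elim: d X D Z p => [|d IH] X D Z p PX r; split=> //.
have [V [j [q [t DE r']]]] := r.
have [_ IHc] := IH (fun i => X i.+1) (fun i => D i.+1) V q (fun i => PX i.+1) r'.
case=> [_|i i_d]; last exact: IHc.
have [V' [j' [q' [t' D'E _]]]] := r'.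
apply/E_eq0; rewrite lf_comp DE D'E ccompA -(ccompA q) (tri_comp t') ccomp0l.
exact: ccomp0r.
Qed.

Lemma Bn_kernel n V Z (X0 : H0 K) (j : hom V (E X0)) (p : hom (E X0) Z) : P X0 -> st R kk n V -> @tri k A V (E X0) Z j p ->
  Bn n.+1 Z -> Bn n V.
Proof.
move=> PX0 sV t [sZ vZ]; split=> // i J i0 IJ.
apply: (tri_van_l_r t (m := i.+1%:Z)); first lia.
- by apply: (orth_kp OP); [lia | exact/in_obE/IP | exact: in_obE].
- exact: vZ.
Qed.

(** Extending morphisms along j amounts to Ext^1(Z, J) = 0; the higher degrees shift to V. *)
Lemma Bn_cone n V Z (X0 : H0 K) (j : hom V (E X0)) (p : hom (E X0) Z) : P X0 -> st R kk n V -> @tri k A V (E X0) Z j p ->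
  (forall (i : nat) J, (0 < i)%N -> I J -> @vanishing k A V (E J) i%:Z) ->
  (forall J (v : hom V (E J)), I J -> exists w, v = w \oc j) -> Bn n.+1 Z.
Proof.
move=> PX0 sV t vV cosur; split.
  by apply: (st_cone OP (V := V) (Q := E X0)) => //; [exact: in_obE | exists j, p].
have v0 (i : int) J : (0 < i)%R -> I J -> @vanishing k A (E X0) (E J) i.
  by move=> i0 IJ; apply: (orth_kp OP) => //; [exact/in_obE/IP | exact: in_obE].
case=> [//|[|i]] J _ IJ.
  by apply: (van_of_tri_cosurj t); [move=> v; exact: cosur | exact: v0].
by apply: (tri_van_r_r t (m := i.+1%:Z)); [lia | apply: v0 => //; lia | apply: vV].
Qed.

(** By induction the complex without X 0 resolves some V, and Z is the cone of the morphism V -> X 0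
    induced by the last differential. Exactness at X 1 extends morphisms along it, and [Bn_cone]
    applies. *)
Lemma resolve_exact_on_I d X D : nonneg -> @P_complex k K P d X D ->
  @exact_on_I k K I d X D -> exists Z p, Bn d.+1 Z /\ @resolves d.+1 X D Z p.
Proof.
move=> NN; elim: d X D => [|d IH] X D [PX DD] exI.
  have [Z [p t]] := tri_cone R (lf_hom E (D 0%N)).
  exists Z, p; split; last first.
    exists (E (X 1%N)), (lf_hom E (D 0%N)), (Defs.cid _); split=> //; first by rewrite ccomp1r.
    exact: is_iso_id.
  apply: (Bn_cone (n := 0%N) (PX 0%N isT) _ t).
  - exact: in_obE.
  - by move=> i J i0 IJ; apply: (orth_kp OP) => //; [exact/in_obE/IP | exact: in_obE].
  - move=> J v IJ; have [v0 v0E] := E_surj v.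
    have [_ /(_ v0)[u uE]] := exI J IJ.
    by exists (lf_hom E u); rewrite -lf_comp -uE.
have [||V [q [BV r]]] := IH (fun i => X i.+1) (fun i => D i.+1).
- by split=> i i_d; [apply: (PX i.+1) | apply: (DD i.+1)].
- by move=> J IJ; have [ex sur] := exI J IJ; split=> // i i_d; apply: (ex i.+1).
have [V' [j' [q' [t' DE r']]]] := r.
have PX' i : (i < d)%N -> P (X i.+2) by move=> i_d; apply: PX; lia.
have epi' (T : H0 K) (c : hom V' (E T)) : c \oc q' = 0 -> c = 0.
  by apply: resolves_epi r'.
(* The last differential kills j' q', hence kills j', because q' is epimorphic for morphisms into
   objects of K. *)
have [|j jE] := tri_colift t' (z := lf_hom E (D 0%N)).
  by apply: epi'; rewrite ccompA -DE -lf_comp DD // E_eq0.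
have [Z [p t]] := tri_cone R j.
exists Z, p; split; last by exists V, j, q.
apply: (Bn_cone (n := d.+1) (PX 0%N isT) BV.1 t); first exact: BV.2.
move=> J v IJ; have [y yE] := E_surj (v \oc q).
have [ex _] := exI J IJ.
have [|w wE] := (ex 0%N isT y).1.
  apply/E_eq0; rewrite lf_comp yE DE -ccompA (ccompA v) (tri_comp t') ccomp0r.
  exact: ccomp0l.
exists (lf_hom E w); apply/eqP; rewrite -subr_eq0; apply/eqP.
have PX1 i : (i < d.+1)%N -> P (X i.+1) by move=> i_d; apply: PX.
apply: (@resolves_epi d.+1 _ _ V q J _ NN PX1 r).
by rewrite ccompBl ccompA -jE -yE -lf_comp -wE subrr.
Qed.

Lemma resolves_exact_on_I d X D Z p : nonneg -> (forall i, (i <= d)%N -> P (X i)) ->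
  @resolves d.+1 X D Z p -> Bn d.+1 Z -> @exact_on_I k K I d X D.
Proof.
move=> NN; elim: d X D Z p => [|d IH] X D Z p PX r BZ J IJ.
  have [V [j [q [t DE [q' [q1 q2]]]]]] := r.
  split=> // v; have [w wE] := tri_cosurj t (BZ.2 1%N J isT IJ) (lf_hom E v \oc q').
  have [u uE] := E_surj w; exists u; apply: E_inj.
  by rewrite lf_comp uE DE -ccompA -wE ccompA q1 ccomp1r.
have [_ DD] := resolves_complex NN PX r.
have [V [j [q [t DE r']]]] := r.
have PX' i : (i < d.+1)%N -> P (X i.+1) by move=> i_d; apply: PX.
have sV := @resolves_st d.+1 (fun i => X i.+1) (fun i => D i.+1) V q PX' r'.
have BV := Bn_kernel (PX 0%N isT) sV t BZ.
have [ex sur] := IH (fun i => X i.+1) (fun i => D i.+1) V q PX' r' BV J IJ.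
split=> //; case=> [_|i i_d]; last exact: ex.
move=> y; split=> [yD|[x ->]]; last first.
  by apply: etrans (@ccompA k (H0 K) _ _ _ _ x (D 0%N) (D 1%N)) _; rewrite DD // ccomp0r.
have [V' [j' [q' [t' D'E r'']]]] := r'.
have [|c cE] := tri_colift t' (z := lf_hom E y).
  apply: (@resolves_epi d _ _ V' q' J _ NN _ r''); first by move=> i i_d; apply: PX; lia.
  by rewrite ccompA -D'E -lf_comp yD E_eq0.
have [w wE] := tri_cosurj t (BZ.2 1%N J isT IJ) c.
have [u uE] := E_surj w; exists u; apply: E_inj.
by rewrite lf_comp uE DE -ccompA -wE.
Qed.

(** Injectivity of j on morphisms from P accounts for Ext^{-1}(P, Z), and the lower degrees shift to
    V. *)
Lemma vanP_cone V Z (X0 : H0 K) (j : hom V (E X0)) (p : hom (E X0) Z) : nonneg -> P X0 -> @tri k A V (E X0) Z j p ->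
  (vanP V /\ forall Q (a : hom (E Q) V), P Q -> j \oc a = 0 -> a = 0) <-> vanP Z.
Proof.
move=> NN PX0 t; split.
  move=> [vV inj] Q [//|[|i]] _ PQ.
    by apply: (van_of_tri_inj t); [move=> a; apply: inj | apply: NN].
  apply: (tri_van_r_l t (m := - i.+1%:Z)); first lia.
    by apply: NN; lia.
  exact: vV.
move=> vZ; split=> [Q i i0 PQ|Q a PQ].
  apply: (tri_van_l_l t (m := - i.+1%:Z)); first lia.
    by apply: NN; lia.
  exact: vZ.
by apply: (tri_inj t); apply: (vZ Q 1%N).
Qed.

(** Removing X 0 trades exactness at X 1 for the injectivity of j in [vanP_cone]. *)
Lemma exact_on_P_vanP d X D Z p : nonneg -> (forall i, (i <= d)%N -> P (X i)) ->
  @resolves d.+1 X D Z p -> @exact_on_P k K P d X D <-> vanP Z.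
Proof.
move=> NN; elim: d X D Z p => [|d IH] X D Z p PX r.
  have [V [j [q [t DE [q' [q1 q2]]]]]] := r.
  rewrite -(vanP_cone NN (PX 0%N isT) t); split.
    move=> ex; split.
      move=> Q i i0 PQ; apply: (@vanishing_iso_r k A (E Q) (E (X 1%N))).
        by exists q, q'.
      by apply: NN; lia.
    move=> Q a PQ ja; have [v vE] := E_surj (q' \oc a).
    have v0 : v = 0.
      by apply: (ex Q PQ).1; apply/E_eq0; rewrite lf_comp vE DE ccompA -(ccompA q) q2 ccomp1l.
    by rewrite -[a]ccomp1l -q2 ccompA -vE v0 (E_eq0 _).2 // ccomp0r.
  move=> [_ inj] Q PQ; split=> // v Dv; apply/E_eq0.
  rewrite -[LHS]ccomp1l -q1 ccompA (inj _ (q \oc lf_hom E v) PQ) ?ccomp0r //.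
  by rewrite -ccompA -DE -lf_comp Dv E_eq0.
have [_ DD] := resolves_complex NN PX r.
have [V [j [q [t DE r']]]] := r.
have PX' i : (i <= d)%N -> P (X i.+1) by move=> i_d; apply: PX.
have [V' [j' [q' [t' D'E r'']]]] := r'.
rewrite -(vanP_cone NN (PX 0%N isT) t) -(IH (fun i => X i.+1) (fun i => D i.+1) V q PX' r'); split.
  move=> ex; split.
    move=> Q PQ; have [inj exi] := ex Q PQ; split=> // i i_d; exact: (exi i.+1).
  move=> Q a PQ ja; have [_ exi] := ex Q PQ.
  have [a' aE] := @resolves_surj d.+1 (fun i => X i.+1) (fun i => D i.+1) V q Q a PQ PX' r'.
  have [v vE] := E_surj a'.
  have [|u uE] := (exi 0%N isT v).1.
    by apply/E_eq0; rewrite lf_comp vE DE ccompA -aE.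
  rewrite aE -vE uE lf_comp D'E -ccompA -(ccompA q) (tri_comp t') ccomp0l.
  exact: ccomp0l.
move=> [ex inj] Q PQ; have [ex1 ex2] := ex Q PQ; split=> //.
case=> [_|i i_d]; last exact: ex2.
move=> v; split=> [Dv|[u ->]]; last first.
  by apply: etrans (esym (@ccompA k (H0 K) _ _ _ _ (D 0%N) (D 1%N) u)) _; rewrite DD // ccomp0l.
have qv : q \oc lf_hom E v = 0.
  by apply: (inj Q) => //; rewrite -ccompA -DE -lf_comp Dv E_eq0.
have [b bE] := tri_lift t' qv.
have PX'' i : (i < d)%N -> P (X i.+2) by move=> i_d; apply: PX; lia.
have [b' b'E] := @resolves_surj d (fun i => X i.+2) (fun i => D i.+2) V' q' Q b PQ PX'' r''.
have [u uE] := E_surj b'; exists u; apply: E_inj.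
by rewrite lf_comp uE D'E bE b'E ccompA.
Qed.

Lemma vanishing_st_st n m (i : int) Y Z : nonneg -> st R kk n Y -> st R kk m Z ->
  (i + m%:Z < 0)%R -> vanishing Y Z i.
Proof.
move=> NN sY; elim: m Z i => [|m IH] Z i.
  move=> [X _ iX] i0; apply: (@vanishing_iso_r k A Y (E X)); first exact: isomorphic_sym.
  by apply: (st_nonneg NN sY); lia.
move=> [U [V [sU [C [X _ iX] iC] [f [g t]]]]] i0.
apply: (tri_van_mid_l t); first by apply: IH => //; lia.
apply: (@vanishing_iso_r k A _ (shf R m.+1%:Z C)); first exact: isomorphic_sym.
apply/(vanishing_shf_r R _ _ (erefl (i + m.+1%:Z))).
apply: (@vanishing_iso_r k A Y (E X)); first exact: isomorphic_sym.
by apply: (st_nonneg NN sY); lia.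
Qed.

(** Shifting along covers of Y lowers the degree, with the terms in P handled by [vanP Z], until
    [vanishing_st_st] applies. *)
Lemma vanishing_st_vanP n m (i : nat) Y Z : nonneg -> st R kk n Y -> st R kk m Z ->
  vanP Z -> (0 < i)%N -> vanishing Y Z (- i%:Z).
Proof.
move=> NN sY sZ vZ; have [l le_l] : exists l, (m < i + l)%N by exists m.+1; lia.
elim: l i n Y sY le_l => [|l IH] i n Y sY le_l i0.
  by apply: (vanishing_st_st NN sY sZ); lia.
have [V [Q [[Q0 PQ0 iQ] [f [g t]] sV]]] := st_unresolve OP sY.
apply: (tri_van_r_r t (m := - i.+1%:Z)); first lia.
  by apply: (@vanishing_iso_l k A Z (E Q0)); [apply: isomorphic_sym | apply: vZ].
by apply: (IH i.+1 _ _ sV) => //; lia.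
Qed.

End Resolutions.

(** * Abelian categories *)

Section EnoughProjectives.
Variables (k : comPzRingType) (D : lincat k) (pr : D -> Prop).
Implicit Types X Y Z T Q : D.

Definition presentation Q1 Q0 X (d : chom Q1 Q0) (p : chom Q0 X) :=
  [/\ p \oc d = 0,
      forall T (h : chom Q0 T), h \oc d = 0 -> exists u, h = u \oc p,
      forall T (u : chom X T), u \oc p = 0 -> u = 0,
      forall Q (b : chom Q X), pr Q -> exists z, b = p \oc z
    & forall Q (z : chom Q Q0), pr Q -> p \oc z = 0 -> exists w, z = d \oc w].

(* Cokernels and weak kernels are only required for morphisms between the projectives
   [pr], and are tested on these. *)
Record enough_projectives : Prop := EnoughProjectives {
  ep_additive : additive_cat D;
  ep_biproduct : forall Q Q', pr Q -> pr Q' -> exists2 Z, pr Z & is_biproduct Q Q' Z;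
  ep_present : forall X, exists Q1 Q0 (d : chom Q1 Q0) (p : chom Q0 X),
    [/\ pr Q1, pr Q0 & presentation d p];
  ep_coker : forall Q1 Q0 (d : chom Q1 Q0), pr Q1 -> pr Q0 ->
    exists X (p : chom Q0 X), [/\ p \oc d = 0,
      forall Q (b : chom Q X), pr Q -> exists z, b = p \oc z
      & forall Q (z : chom Q Q0), pr Q -> p \oc z = 0 -> exists w, z = d \oc w];
  ep_weak_kernel : forall Q Q' (g : chom Q Q'), pr Q -> pr Q' ->
    exists W (f : chom W Q), [/\ pr W, g \oc f = 0
      & forall T (h : chom T Q), pr T -> g \oc h = 0 -> exists u, h = f \oc u] }.

Definition pr_inj X Y (f : chom X Y) := forall Q (a : chom Q X), pr Q -> f \oc a = 0 -> a = 0.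
Definition pr_surj X Y (f : chom X Y) := forall Q (b : chom Q Y), pr Q -> exists z, b = f \oc z.
Definition pr_exact X Y Z (f : chom X Y) (g : chom Y Z) :=
  g \oc f = 0 /\ forall Q (z : chom Q Y), pr Q -> g \oc z = 0 -> exists a, z = f \oc a.

Hypothesis EP : enough_projectives.

Lemma pr_eq0 X Y (f : chom X Y) :
  (forall Q (a : chom Q X), pr Q -> f \oc a = 0) -> f = 0.
Proof.
have [Q1 [Q0 [d [p [_ pQ0 [_ _ epi _ _]]]]]] := ep_present EP X.
by move=> f0; apply: epi; apply: f0.
Qed.

(** On a projective cover of T, h lifts along f. The lift respects the relations d because f is
    injective on projectives, so it descends to T. *)
Lemma pr_kernel X Y Z (f : chom X Y) (g : chom Y Z) :
  pr_inj f -> pr_exact f g -> is_kernel f g.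
Proof.
move=> inj [gf ex]; split=> // T h gh.
have [Q1 [Q0 [d [p [pQ1 pQ0 [pd fac epi _ _]]]]]] := ep_present EP T.
have [|a aE] := ex _ (h \oc p) pQ0; first by rewrite -ccompA gh ccomp0l.
have [|u uE] := fac _ a.
  by apply: (inj _ _ pQ1); rewrite -ccompA -aE ccompA pd ccomp0r.
have hu : h = f \oc u.
  apply/eqP; rewrite -subr_eq0; apply/eqP; apply: epi.
  by rewrite ccompBl ccompA -uE aE subrr.
exists u; split=> // v hv.
apply/eqP; rewrite -subr_eq0; apply/eqP; apply: pr_eq0 => Q q pQ.
apply: (inj _ _ pQ).
by rewrite -ccompA ccompBr -hu -hv subrr ccomp0l.
Qed.

(** A morphism out of Z is defined on a presentation: the cover p of Z lifts along g to z, and h z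
    kills the relations. *)
Lemma pr_cokernel X Y Z (f : chom X Y) (g : chom Y Z) :
  pr_exact f g -> pr_surj g -> is_cokernel f g.
Proof.
move=> [gf ex] sur; split=> // T h hf.
have [Q1 [Q0 [d [p [pQ1 pQ0 [pd fac epi psur _]]]]]] := ep_present EP Z.
have [z zE] := sur _ p pQ0.
have [|a aE] := ex _ (z \oc d) pQ1; first by rewrite -ccompA -zE.
have [|u uE] := fac _ (h \oc z); first by rewrite ccompA aE -ccompA hf ccomp0l.
exists u; split=> [|v hv].
  apply/eqP; rewrite -subr_eq0; apply/eqP; apply: pr_eq0 => Q q pQ.
  have [b bE] := psur _ (g \oc q) pQ.
  have [|c cE] := ex _ (q - z \oc b) pQ; first by rewrite ccompBr -ccompA -zE bE subrr.
  rewrite ccompBl ccompA bE -ccompA -uE ccompA -ccompBr cE -ccompA hf.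
  exact: ccomp0l.
apply/eqP; rewrite -subr_eq0; apply/eqP; apply: epi.
by rewrite ccompBl -uE zE -ccompA -hv subrr.
Qed.

Lemma presentation_exists Q1 Q0 (d : chom Q1 Q0) : pr Q1 -> pr Q0 ->
  exists X (p : chom Q0 X), presentation d p.
Proof.
move=> pQ1 pQ0; have [X [p [pd sur ex]]] := ep_coker EP d pQ1 pQ0.
have [_ cok] := pr_cokernel (conj pd ex) sur.
exists X, p; split=> // [T h /cok[u [uE _]]|T u up]; first by exists u.
have [|w [_ uniq]] := cok _ (u \oc p); first by rewrite up ccomp0l.
by rewrite -(uniq u) // -(uniq 0) // ccomp0l up.
Qed.

(** On projectives, g kills z exactly when the lift g0 z factors through the relations d. So a weak
    kernel of (g0, d) on the sum of Q0 and P1 projects onto the kernel of g. *)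
Lemma pr_cover_kernel Q0 X (g : chom Q0 X) : pr Q0 ->
  exists W (w : chom W Q0), pr W /\ pr_exact w g.
Proof.
move=> pQ0; have [P1 [P0 [d [p [pP1 pP0 [pd _ _ psur pex]]]]]] := ep_present EP X.
have [g0 gE] := psur _ g pQ0.
have [B pB [iA [iB [pA [pB_ [b1 b2 b3 b4 b5]]]]]] := ep_biproduct EP pQ0 pP1.
have [W [f [pW mf wk]]] := ep_weak_kernel EP (g0 \oc pA + d \oc pB_) pB pP0.
exists W, (pA \oc f); split=> //; split.
  have E : g0 \oc pA \oc f = - (d \oc pB_ \oc f).
    by apply/eqP; rewrite -addr_eq0 -ccompDl mf.
  by rewrite gE -ccompA (ccompA p) (ccompA p) E ccompNr !ccompA -!(ccompA p d) pd !ccomp0l oppr0.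
move=> Q h pQ gh.
have [|v vE] := pex _ (g0 \oc h) pQ; first by rewrite -ccompA -gE.
have [|u uE] := wk _ (iA \oc h - iB \oc v) pQ.
  rewrite ccompDl !ccompBr !ccompA -(ccompA pA) -(ccompA pA iB) -(ccompA pB_) -(ccompA pB_ iB).
  by rewrite b1 b2 b3 b4 !ccomp0l !ccomp0r !ccomp1l vE subr0 sub0r subrr.
exists u; rewrite ccompA -uE ccompBr -!ccompA b1 b3 ccomp1l ccomp0l.
by rewrite subr0.
Qed.

(** N is presented by a cover W of the kernel of g p, modulo a cover V of the kernel of W -> Y. *)
Lemma pr_kernel_exists Y Z (g : chom Y Z) :
  exists N (n : chom N Y), pr_inj n /\ pr_exact n g.
Proof.
have [Q1 [Q0 [d [p [pQ1 pQ0 [pd _ _ psur _]]]]]] := ep_present EP Y.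
have [W [w [pW [gw wex]]]] := pr_cover_kernel (g \oc p) pQ0.
have [V [v [pV [pwv vex]]]] := pr_cover_kernel (p \oc w) pW.
have [N [q [qv fac epi qsur _]]] := presentation_exists v pV pW.
have [n nE] := fac _ _ pwv.
exists N, n; split.
  move=> Q a pQ na; have [b bE] := qsur _ a pQ.
  have [|c cE] := vex _ b pQ; first by rewrite nE ccompA -bE.
  by rewrite bE cE -ccompA qv ccomp0l.
split; first by apply: epi; rewrite ccompA -nE -ccompA.
move=> Q z pQ gz; have [y yE] := psur _ z pQ.
have [|b bE] := wex _ y pQ; first by rewrite ccompA -yE.
by exists (q \oc b); rewrite -ccompA -nE yE bE ccompA.
Qed.

(** C has the generators of Y; its relations are those of Y together with the lifted generators of
    X. *)
Lemma pr_cokernel_exists X Y (f : chom X Y) :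
  exists C (c : chom Y C), pr_exact f c /\ pr_surj c.
Proof.
have [Q1 [Q0 [d [p [pQ1 pQ0 [pd _ epi psur _]]]]]] := ep_present EP X.
have [P1 [P0 [d' [p' [pP1 pP0 [pd' fac' _ psur' pex']]]]]] := ep_present EP Y.
have [f0 fE] := psur' _ (f \oc p) pQ0.
have [B pB [iA [iB [pA [pB_ [b1 b2 b3 b4 b5]]]]]] := ep_biproduct EP pQ0 pP1.
set m := f0 \oc pA + d' \oc pB_.
have miA : m \oc iA = f0 by rewrite ccompDl !ccompA b1 b4 ccomp1r ccomp0r addr0.
have miB : m \oc iB = d' by rewrite ccompDl !ccompA b2 b3 ccomp1r ccomp0r add0r.
have [C [q [qm _ _ qsur qex]]] := presentation_exists m pB pP0.
have [|c cE] := fac' _ q; first by rewrite -miB -ccompA qm ccomp0l.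
exists C, c; split; last first.
  by move=> Q b pQ; have [y ->] := qsur _ b pQ; exists (p' \oc y); rewrite cE ccompA.
split.
  by apply: epi; rewrite ccompA fE -ccompA -cE -miA -ccompA qm ccomp0l.
move=> Q z pQ cz; have [y yE] := psur' _ z pQ.
have [|b bE] := qex _ y pQ; first by rewrite cE ccompA -yE.
exists (p \oc (pA \oc b)); rewrite yE bE ccompDl ccompDr -!ccompA pd' !ccomp0l addr0.
by rewrite fE.
Qed.

Lemma pr_epi X Y (f : chom X Y) : is_epi f -> pr_surj f.
Proof.
move=> epi Q b pQ; have [C [c [[cf ex] _]]] := pr_cokernel_exists f.
apply: (ex _ b pQ); rewrite [c](_ : _ = 0) ?ccomp0l //.
by apply: epi; rewrite cf ccomp0l.
Qed.

Lemma pr_abelian : abelian_cat D.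
Proof.
split; first exact: ep_additive EP.
- move=> Y Z g; have [N [n [inj ex]]] := pr_kernel_exists g.
  by exists N, n; apply: pr_kernel.
- move=> X Y f; have [C [c [ex sur]]] := pr_cokernel_exists f.
  by exists C, c; apply: pr_cokernel.
- move=> X Y f mono; have [C [c [ex sur]]] := pr_cokernel_exists f.
  exists C, c; apply: pr_kernel => // Q a _ fa.
  by apply: mono; rewrite fa ccomp0r.
- move=> Y Z g epi; have [N [n [inj ex]]] := pr_kernel_exists g.
  by exists N, n; apply: pr_cokernel => //; apply: pr_epi.
Qed.

Lemma pr_short_exact X Y Z (f : chom X Y) (g : chom Y Z) :
  short_exact f g <-> [/\ pr_inj f, pr_exact f g & pr_surj g].
Proof.
split=> [[[gf ker] [_ cok]]|[inj ex sur]]; last first.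
  by split; [apply: pr_kernel | apply: pr_cokernel].
split.
- move=> Q a _ fa; have [|u [_ uniq]] := ker _ (f \oc a).
    by rewrite fa ccomp0r.
  by rewrite -(uniq a) // -(uniq 0) // ccomp0r fa.
- by split=> // Q z _ gz; have [u [uE _]] := ker _ z gz; exists u.
- apply: pr_epi => T u v uv; have [|w [_ uniq]] := cok _ (u \oc g).
    by rewrite ccompA gf ccomp0r.
  by rewrite -(uniq u) // -(uniq v).
Qed.

Lemma pr_iso X Y (f : chom X Y) : pr_inj f -> pr_surj f -> is_iso f.
Proof.
move=> inj sur; have [Q1 [Q0 [d [p [pQ1 pQ0 [pd fac epi _ _]]]]]] := ep_present EP Y.
have [a aE] := sur _ p pQ0.
have [|u uE] := fac _ a; first by apply: (inj _ _ pQ1); rewrite -ccompA -aE.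
have fu : f \oc u = cid Y.
  apply/eqP; rewrite -subr_eq0; apply/eqP; apply: epi.
  by rewrite ccompBl ccompA -uE -aE ccomp1l subrr.
exists u; split=> //.
apply/eqP; rewrite -subr_eq0; apply/eqP; apply: pr_eq0 => Q q pQ.
by apply: (inj _ _ pQ); rewrite -ccompA ccompBr -ccompA fu ccomp1l ccomp1r subrr ccomp0l.
Qed.

End EnoughProjectives.

(** * Short exact sequences and images in abelian categories *)

Section AbelianCategories.
Variables (k : comPzRingType) (D : lincat k).
Implicit Types X Y Z T : D.
Hypothesis AB : abelian_cat D.

Lemma is_epi0 X Y (f : chom X Y) :
  is_epi f <-> forall T (u : chom Y T), u \oc f = 0 -> u = 0.
Proof.
split=> [epi T u uf|epi T u v uv]; first by apply: epi; rewrite uf ccomp0l.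
by apply/eqP; rewrite -subr_eq0; apply/eqP; apply: epi; rewrite ccompBl uv subrr.
Qed.

Lemma is_mono0 X Y (f : chom X Y) :
  is_mono f <-> forall T (u : chom T X), f \oc u = 0 -> u = 0.
Proof.
split=> [mono T u fu|mono T u v uv]; first by apply: mono; rewrite fu ccomp0r.
by apply/eqP; rewrite -subr_eq0; apply/eqP; apply: mono; rewrite ccompBr uv subrr.
Qed.

Lemma kernel_mono X Y Z (f : chom X Y) (g : chom Y Z) : is_kernel f g -> is_mono f.
Proof.
move=> [gf ker]; apply/is_mono0 => T u fu.
have [|w [_ uniq]] := ker _ (f \oc u); first by rewrite fu ccomp0r.
by rewrite -(uniq u) // -(uniq 0) // ccomp0r fu.
Qed.

Lemma cokernel_epi X Y Z (f : chom X Y) (g : chom Y Z) : is_cokernel f g -> is_epi g.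
Proof.
move=> [gf cok]; apply/is_epi0 => T u ug.
have [|w [_ uniq]] := cok _ (u \oc g); first by rewrite ug ccomp0l.
by rewrite -(uniq u) // -(uniq 0) // ccomp0l ug.
Qed.

Lemma epi_short_exact Y Z (g : chom Y Z) : is_epi g ->
  exists X (f : chom X Y), short_exact f g.
Proof.
have [_ kers _ _ epis] := AB => epi.
have [N [n [gn ker]]] := kers _ _ g; exists N, n; split=> //; split=> // T h hn.
have [X [f [gf cok]]] := epis _ _ _ epi; apply: cok.
by have [u [-> _]] := ker _ _ gf; rewrite -ccompA hn ccomp0l.
Qed.

Lemma mono_short_exact X Y (f : chom X Y) : is_mono f ->
  exists Z (g : chom Y Z), short_exact f g.
Proof.
have [_ _ coks monos _] := AB => mono.
have [C [c [cf cok]]] := coks _ _ f; exists C, c; split=> //; split=> // T h ch.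
have [Z [g [gf ker]]] := monos _ _ _ mono; apply: ker.
by have [u [-> _]] := cok _ _ gf; rewrite ccompA ch ccomp0r.
Qed.

(* If k is the kernel of t with t e = 0, then n k is the kernel of a morphism
   that vanishes on f, hence on n; so k is split epi and t = 0. *)
Lemma cokernel_image X Y C N (f : chom X Y) (c : chom Y C) (n : chom N Y) :
  is_cokernel f c -> is_kernel n c -> exists2 e : chom X N, is_epi e & f = n \oc e.
Proof.
have [_ kers _ monos _] := AB => -[cf cok] ker.
have [e [eE _]] := ker.2 _ _ cf; exists e => //; apply/is_epi0 => T t te.
have [N' [m kerm]] := kers _ _ t; have [e' [e'E _]] := kerm.2 _ _ te.
have mono_n := kernel_mono ker; have mono_m := kernel_mono kerm.
have mono_nm : is_mono (n \oc m).
  by move=> S u v; rewrite !ccompA => /mono_n; apply: mono_m.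
have [G [g kerg]] := monos _ _ _ mono_nm.
have gf : g \oc f = 0 by rewrite eE e'E -(ccompA n) -ccompA kerg.1 ccomp0l.
have [s [sE _]] := cok _ _ gf.
have gn : g \oc n = 0 by rewrite sE ccompA ker.1 ccomp0r.
have [w [wE _]] := kerg.2 _ _ gn.
have mw : m \oc w = cid N by apply: mono_n; rewrite -ccompA -wE ccomp1r.
by rewrite -[t]ccomp1r -mw -ccompA kerm.1 ccomp0l.
Qed.

End AbelianCategories.

(** * The exact structure of B' *)

Section ExactStructure.
Variables (k : comPzRingType) (A K : dgcat k) (R : pretriangulation A).
Variables (E : linfun (H0 K) (H0 A)) (P I : H0 K -> Prop).
Implicit Types (q J : H0 K) (Z V Q : A).
Notation H := (H0 A).
Notation hom := (@chom k H).
Notation iso X Y := (@isomorphic k H X Y).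
Notation kk := (in_ob E xpredT).
Notation pp := (in_ob E P).

Hypothesis EFF : fully_faithful E.
Hypothesis OP : orthogonal_pair kk pp.
Hypothesis IP : forall J, I J -> P J.
Hypothesis P_biproduct : forall q q', P q -> P q' ->
  exists2 z : H0 K, P z & is_biproduct q q' z.
Variable d : nat.
Notation B := (Bn R E I).
Variables (D : lincat k) (G : linfun D (H0 A)).
Implicit Types X Y T : D.
Hypothesis GFF : fully_faithful G.
Hypothesis GB : forall X, B d.+1 (G X).
Hypothesis GS : forall Z, B d.+1 Z -> exists X, G X = Z.

Definition weak_kernels_on_P := forall q q' (g : chom q q'), P q -> P q' ->
  exists w (f : chom w q), [/\ P w, g \oc f = 0
    & forall t (h : chom t q), P t -> g \oc h = 0 -> exists u, h = f \oc u].

(** Says that Z, restricted to P, is the module presented by f; for objects Z of B this is how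
    density of F is used. *)
Definition P_cokernel q1 q0 (f : chom q1 q0) Z (p : hom (E q0) Z) :=
  [/\ p \oc lf_hom E f = 0,
      forall q (b : hom (E q) Z), P q -> exists z : chom q q0, b = p \oc lf_hom E z
    & forall q (z : chom q q0), P q -> p \oc lf_hom E z = 0 -> exists w, z = f \oc w].

Definition P_cokernels := forall q1 q0 (f : chom q1 q0), P q1 -> P q0 ->
  exists Z (p : hom (E q0) Z), B d.+1 Z /\ P_cokernel f p.

Definition exact_abelian :=
  [/\ forall (Y Z : A) (n : int), (n < 0)%R -> B d.+1 Y -> B d.+1 Z -> vanishing Y Z n,
      abelian_cat D
    & forall (X Y Z : D) (f : chom X Y) (g : chom Y Z),
        @tri k A (G X) (G Y) (G Z) (lf_hom G f) (lf_hom G g) <-> short_exact f g].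

Definition inE Z := exists2 q, P q & Z = E q.
Definition is_P X := inE (G X).

Lemma Bn_E n (X : H0 K) : B n (E X).
Proof.
split; first by apply: (st_mono_le OP (leq0n n)); exact: in_obE.
by move=> i J i0 IJ; apply: (orth_kp OP) => //; [exact/in_obE/IP | exact: in_obE].
Qed.

Lemma Bn_inE n Z : inE Z -> B n Z.
Proof. by case=> q _ ->; apply: Bn_E. Qed.

Lemma Bn_le n m Z : (n <= m)%N -> B n Z -> B m Z.
Proof. by move=> nm [sZ vZ]; split=> //; apply: (st_mono_le OP nm). Qed.

Lemma Bn_extends n (X Z Y : A) : B n X -> B n Y -> extends X Z Y -> B n Z.
Proof.
move=> [sX vX] [sY vY] e; split; first exact: (st_extends OP sX sY e).
move=> i J i0 IJ; have [f [g t]] := e.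
by apply: (tri_van_mid_r t); [apply: vX | apply: vY].
Qed.

Lemma Bn_resolve n Z : B n.+1 Z -> exists V Q (j : hom V Q) (p : hom Q Z),
  [/\ inE Q, tri j p & B n V].
Proof.
move=> BZ; have [V [Q [[q Pq [y [y' yy']]] [j [p t]] sV]]] := st_resolve OP BZ.1.
have t' := tri_isoM t yy'.
exists V, (E q), (y \oc j), (p \oc y'); split=> //; first by exists q.
exact: (Bn_kernel OP IP Pq sV t' BZ).
Qed.

Lemma st_P_cover n V : st R kk n V -> exists V' Q (j : hom V' Q) (p : hom Q V),
  [/\ inE Q, tri j p & st R kk n V'].
Proof.
move=> sV; have [V' [Q [[q Pq [y [y' yy']]] [j [p t]] sV']]] := st_unresolve OP sV.
exists V', (E q), (y \oc j), (p \oc y'); split=> //; first by exists q.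
exact: tri_isoM.
Qed.

Lemma inE_van1 n Q V : inE Q -> st R kk n V -> vanishing Q V 1.
Proof. by move=> [q Pq ->]; apply: (st_van OP) => //; exact: in_obE. Qed.

Lemma condition_b_vanP Z : @nonneg k A K E -> @condition_b k K P I d -> B d.+1 Z ->
  vanP E P Z.
Proof.
move=> NN cb BZ; have [X [DD [p [PX r]]]] := resolution_exists EFF OP BZ.1.
have PX' i : (i <= d)%N -> P (X i) by move=> ?; apply: PX.
apply: (exact_on_P_vanP R EFF OP NN PX' r).1.
apply: (cb _ _ (resolves_complex EFF NN PX' r)).1.
exact: (resolves_exact_on_I EFF OP IP NN PX' r BZ).
Qed.

Lemma G_eq0 X Y (f : chom X Y) : lf_hom G f = 0 <-> f = 0.
Proof.
have [inj _] := GFF X Y; have G0 := linf0 (@lf_linear _ _ _ G X Y).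
by split=> [|-> //]; rewrite -G0 => /inj.
Qed.

Lemma G_inj X Y : injective (@lf_hom k _ _ G X Y).
Proof. by have [] := GFF X Y. Qed.

Lemma G_surj X Y (h : hom (G X) (G Y)) : exists f : chom X Y, lf_hom G f = h.
Proof. by have [_] := GFF X Y. Qed.

Lemma G_biproduct X Y T : @is_biproduct k H (G X) (G Y) (G T) -> is_biproduct X Y T.
Proof.
move=> [i [j [p [q [b1 b2 b3 b4 b5]]]]].
have [i' iE] := G_surj i; have [j' jE] := G_surj j.
have [p' pE] := G_surj p; have [q' qE] := G_surj q; subst i j p q.
exists i', j', p', q'; split; apply: G_inj; rewrite ?lf_id.
- by rewrite lf_comp.
- by rewrite lf_comp.
- by rewrite lf_comp b3 (G_eq0 0).2.
- by rewrite lf_comp b4 (G_eq0 0).2.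
- by rewrite (linfD (@lf_linear _ _ _ G _ _)) !lf_comp.
Qed.

(** * From (a), (b) and (c) to an abelian category *)

Section Sufficiency.
Hypothesis NN : @nonneg k A K E.
Hypothesis WK : weak_kernels_on_P.
Hypothesis vanB : forall Z, B d.+1 Z -> vanP E P Z.
Hypothesis PC : P_cokernels.

Lemma B_vanishing n (Y Z : A) (i : int) : (i < 0)%R -> st R kk n Y -> B d.+1 Z ->
  @vanishing k A Y Z i.
Proof.
move=> i0 sY BZ; have -> : i = - `|i|%N%:Z by lia.
by apply: (vanishing_st_vanP OP NN sY BZ.1 (vanB BZ)); lia.
Qed.

Lemma B_additive : additive_cat D.
Proof.
split.
  have [O [O1 _ iO] O0] := pp_zero OP.
  have [X eX] := GS (Bn_E d.+1 O1); exists X; apply/G_eq0.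
  rewrite lf_id eX; have [f [g [gf fg]]] := iO.
  by rewrite -fg [f](zero_hom_l f O0) ccomp0l.
move=> X Y; have [Z b] := biproduct_exists R (G X) (G Y).
have BZ := Bn_extends (GB X) (GB Y) (biproduct_extends R b).
by have [T eT] := GS BZ; subst Z; exists T; apply: G_biproduct.
Qed.

Lemma inE_biproduct Q Q' : inE Q -> inE Q' -> exists2 Z, inE Z & @is_biproduct k H Q Q' Z.
Proof.
move=> [q Pq ->] [q' Pq' ->].
have [z Pz [i [j [p [p' [b1 b2 b3 b4 b5]]]]]] := P_biproduct Pq Pq'.
exists (E z); first by exists z.
exists (lf_hom E i), (lf_hom E j), (lf_hom E p), (lf_hom E p').
have E0 (X Y : H0 K) : lf_hom E (0 : chom X Y) = 0 by apply/(E_eq0 EFF).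
split; rewrite -!lf_comp.
+ by rewrite b1 lf_id.
+ by rewrite b2 lf_id.
+ by rewrite b3.
+ by rewrite b4.
+ by rewrite -(linfD (@lf_linear _ _ _ E _ _)) b5 lf_id.
Qed.

Lemma inE_cokernel Q1 Q0 (f : hom Q1 Q0) : inE Q1 -> inE Q0 ->
  exists Z (p : hom Q0 Z), [/\ B d.+1 Z, p \oc f = 0,
    forall Q (b : hom Q Z), inE Q -> exists z, b = p \oc z
    & forall Q (z : hom Q Q0), inE Q -> p \oc z = 0 -> exists w, z = f \oc w].
Proof.
move=> [q1 Pq1 E1] [q0 Pq0 E0]; subst Q1 Q0.
have [f0 fE] := E_surj EFF f; subst f.
have [Z [p [BZ [pf sur ex]]]] := PC f0 Pq1 Pq0.
exists Z, p; split=> // [Q b [q Pq eQ]|Q z [q Pq eQ] pz]; subst Q.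
  by have [z ->] := sur _ b Pq; exists (lf_hom E z).
have [z0 zE] := E_surj EFF z; subst z.
have [w ->] := ex _ _ Pq pz.
by exists (lf_hom E w); rewrite lf_comp.
Qed.

Lemma inE_weak_kernel Q1 Q0 (g : hom Q1 Q0) : inE Q1 -> inE Q0 ->
  exists W (f : hom W Q1), [/\ inE W, g \oc f = 0
    & forall Q (h : hom Q Q1), inE Q -> g \oc h = 0 -> exists u, h = f \oc u].
Proof.
move=> [q1 Pq1 E1] [q0 Pq0 E0]; subst Q1 Q0.
have [g0 gE] := E_surj EFF g; subst g.
have [w [f [Pw gf wk]]] := WK g0 Pq1 Pq0.
exists (E w), (lf_hom E f); split; first by exists w.
  by rewrite -lf_comp gf; apply/(E_eq0 EFF).
move=> Q h [q Pq eQ]; subst Q; have [h0 hE] := E_surj EFF h; subst h.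
rewrite -lf_comp => /(E_eq0 EFF) gh.
have [u ->] := wk _ _ Pq gh.
by exists (lf_hom E u); rewrite lf_comp.
Qed.

Lemma B_enough_projectives : enough_projectives is_P.
Proof.
split.
- exact: B_additive.
- move=> X Y PX PY; have [Z PZ b] := inE_biproduct PX PY.
  have [T eT] := GS (Bn_inE d.+1 PZ); subst Z.
  by exists T => //; apply: G_biproduct.
- move=> X; have [V [Q0 [j [p [PQ t BV]]]]] := Bn_resolve (GB X).
  have [V' [Q1 [j' [q [PQ' t' sV']]]]] := st_P_cover BV.1.
  have [Y0 e0] := GS (Bn_inE d.+1 PQ); subst Q0.
  have [Y1 e1] := GS (Bn_inE d.+1 PQ'); subst Q1.
  have [dd dE] := G_surj (j \oc q); have [p0 pE] := G_surj p; subst p.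
  exists Y1, Y0, dd, p0; split=> //; split.
  + by apply/G_eq0; rewrite lf_comp dE -ccompA (tri_comp t) ccomp0l.
  + move=> T h hd; have [|u uE] := tri_colift t (z := lf_hom G h).
      apply: (tri_coinj t'); first exact: (B_vanishing _ sV' (GB T)).
      by rewrite ccompA -dE -lf_comp hd (G_eq0 0).2.
    have [u0 u0E] := G_surj u; exists u0; apply: G_inj.
    by rewrite lf_comp u0E.
  + move=> T u up; apply/G_eq0; apply: (tri_coinj t).
      exact: (B_vanishing _ BV.1 (GB T)).
    by rewrite -lf_comp up (G_eq0 0).2.
  + move=> T b PT; have [z zE] := tri_surj t (inE_van1 PT BV.1) (lf_hom G b).
    have [z0 z0E] := G_surj z; exists z0; apply: G_inj.
    by rewrite lf_comp z0E.
  + move=> T z PT pz; have [|a aE] := tri_lift t (z := lf_hom G z).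
      by rewrite -lf_comp pz (G_eq0 0).2.
    have [b bE] := tri_surj t' (inE_van1 PT sV') a.
    have [b0 b0E] := G_surj b; exists b0; apply: G_inj.
    by rewrite lf_comp b0E dE aE bE ccompA.
- move=> X1 X0 f P1 P0.
  have [Z [p [BZ pf sur ex]]] := inE_cokernel (lf_hom G f) P1 P0.
  have [X eX] := GS BZ; subst Z; have [p0 pE] := G_surj p; subst p.
  exists X, p0; split.
  + by apply/G_eq0; rewrite lf_comp.
  + move=> T b PT; have [z zE] := sur _ (lf_hom G b) PT.
    by have [z0 z0E] := G_surj z; exists z0; apply: G_inj; rewrite lf_comp z0E.
  + move=> T z PT pz; have [|w wE] := ex _ (lf_hom G z) PT.
      by rewrite -lf_comp pz (G_eq0 0).2.
    by have [w0 w0E] := G_surj w; exists w0; apply: G_inj; rewrite lf_comp w0E.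
- move=> X1 X0 g P1 P0.
  have [W [f [PW gf wk]]] := inE_weak_kernel (lf_hom G g) P1 P0.
  have [X eX] := GS (Bn_inE d.+1 PW); subst W; have [f0 fE] := G_surj f; subst f.
  exists X, f0; split=> //; first by apply/G_eq0; rewrite lf_comp.
  move=> T h PT gh; have [|u uE] := wk _ (lf_hom G h) PT.
    by rewrite -lf_comp gh (G_eq0 0).2.
  by have [u0 u0E] := G_surj u; exists u0; apply: G_inj; rewrite lf_comp u0E.
Qed.

Lemma B_conflation (X Y Z : D) (f : chom X Y) (g : chom Y Z) :
  @tri k A (G X) (G Y) (G Z) (lf_hom G f) (lf_hom G g) <-> short_exact f g.
Proof.
have EP := B_enough_projectives.
split=> [t|se].
  apply/(pr_short_exact EP); split.
  - move=> T a PT fa; apply/G_eq0; apply: (tri_inj t).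
      by apply: (B_vanishing _ (GB T).1 (GB Z)).
    by rewrite -lf_comp fa (G_eq0 0).2.
  - split; first by apply/G_eq0; rewrite lf_comp (tri_comp t).
    move=> T z _ gz; have [|a aE] := tri_lift t (z := lf_hom G z).
      by rewrite -lf_comp gz (G_eq0 0).2.
    by have [a0 a0E] := G_surj a; exists a0; apply: G_inj; rewrite lf_comp a0E.
  - move=> T b PT; have [z zE] := tri_surj t (inE_van1 PT (GB X).1) (lf_hom G b).
    by have [z0 z0E] := G_surj z; exists z0; apply: G_inj; rewrite lf_comp z0E.
have [inj [gf ex] sur] := (pr_short_exact EP f g).1 se.
have [V [Q [i [p [PQ t BV]]]]] := Bn_resolve (GB Z).
have [Y0 e0] := GS (Bn_inE d.+1 PQ); subst Q.
have [p0 pE] := G_surj p; subst p.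
have [u uE] := sur _ p0 PQ; subst p0.
have [V0 eV] := GS (Bn_le (leqnSn d) BV); subst V.
have [i0 iE] := G_surj i; subst i.
have gui : g \oc (u \oc i0) = 0.
  by apply/G_eq0; rewrite -ccompA lf_comp (tri_comp t).
have [a [aE _]] := se.1.2 _ _ gui.
have [W [f' [g' [w [t' wi gw fac]]]]] := tri_pushout R (lf_hom G a) t.
have BW : B d.+1 W by apply: (Bn_extends (GB X) (GB Z)); exists f', g'.
have [|phi phif phiw] := fac (G Y) (lf_hom G f) (lf_hom G u).
  by rewrite -!lf_comp aE.
have [W0 eW] := GS BW; subst W.
have [f1 fE] := G_surj f'; have [g1 gE] := G_surj g'; have [w1 wE] := G_surj w.
have [phi1 phiE] := G_surj phi; subst f' g' w phi.
(* The pushout property does not determine morphisms, so this needs an argument: the difference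
   vanishes on X, hence factors through Z as c. Then c vanishes on the cover of Z, and c = 0 since
   Ext^{-1}(V, Z) = 0. *)
have gphi : g \oc phi1 = g1.
  apply/eqP; rewrite -subr_eq0; apply/eqP/G_eq0.
  have [|c cE] := tri_colift t' (z := lf_hom G (g \oc phi1 - g1)).
    rewrite (linfB (@lf_linear _ _ _ G _ _)) ccompBl (tri_comp t') subr0.
    by rewrite lf_comp ccompA phif -lf_comp gf (G_eq0 0).2.
  rewrite cE [c](_ : _ = 0) ?ccomp0l //.
  apply: (tri_coinj t); first by apply: (B_vanishing _ BV.1 (GB Z)).
  rewrite -gw -ccompA -cE (linfB (@lf_linear _ _ _ G _ _)) ccompBl gw.
  by rewrite lf_comp ccompA phiw -lf_comp subrr.
have phif1 : phi1 \oc f1 = f by apply: G_inj; rewrite lf_comp.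
have isophi : is_iso phi1.
  apply: (pr_iso EP).
    move=> T b PT phib.
    have [|x xE] := tri_lift t' (z := lf_hom G b).
      by rewrite -lf_comp -gphi ccompA phib ccomp0r (G_eq0 0).2.
    have [x0 x0E] := G_surj x; subst x; rewrite -lf_comp in xE.
    have {}xE := G_inj xE; rewrite xE [x0](_ : _ = 0) ?ccomp0r //.
    by apply: (inj _ _ PT); rewrite -phif1 ccompA -xE.
  move=> T y PT.
  have [y' y'E] := tri_surj t' (inE_van1 PT (GB X).1) (lf_hom G (g \oc y)).
  have [y0 y0E] := G_surj y'; subst y'; rewrite -lf_comp in y'E.
  have {}y'E := G_inj y'E.
  have [|x xE] := ex _ (y - phi1 \oc y0) PT.
    by rewrite ccompBr -(ccompA g phi1) gphi y'E subrr.
  exists (y0 + f1 \oc x); rewrite ccompDr -ccompA phif1 -xE.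
  by rewrite addrC subrK.
have [psi [p1 p2]] := isophi.
have inv : is_inverse (lf_hom G phi1) (lf_hom G psi).
  by split; rewrite -lf_comp ?p1 ?p2 lf_id.
have := tri_isoM t' inv.
by rewrite -!lf_comp phif1 -gphi ccompA p2 ccomp1r.
Qed.

Lemma exact_abelian_suff : exact_abelian.
Proof.
split.
- by move=> Y Z n n0 BY BZ; apply: (B_vanishing n0 BY.1 BZ).
- exact: (pr_abelian B_enough_projectives).
- exact: B_conflation.
Qed.

End Sufficiency.

(** * From an abelian category to (a), (b) and (c) *)

Section Necessity.
Hypothesis EA : exact_abelian.

Lemma EA_abelian : abelian_cat D.
Proof. by have [] := EA. Qed.

Lemma EA_conflation (X Y Z : D) (f : chom X Y) (g : chom Y Z) :
  @tri k A (G X) (G Y) (G Z) (lf_hom G f) (lf_hom G g) <-> short_exact f g.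
Proof. by have [_ _] := EA; apply. Qed.

Lemma EA_nonneg : @nonneg k A K E.
Proof. by have [van _ _] := EA => X Y n n0; apply: van => //; apply: Bn_E. Qed.

Lemma EA_vanP Z : B d.+1 Z -> vanP E P Z.
Proof. by have [van _ _] := EA => BZ q i i0 Pq; apply: van => //; [lia | apply: Bn_E]. Qed.

(** An epimorphism and its kernel N form a conflation, hence a triangle, and Ext^1(Q, N) = 0. *)
Lemma EA_epi_surj (X Y : D) (e : chom X Y) Q (b : hom Q (G Y)) : is_epi e -> inE Q ->
  exists z, b = lf_hom G e \oc z.
Proof.
move=> /(epi_short_exact EA_abelian)[N [n /EA_conflation t]] PQ.
exact: (tri_surj t (inE_van1 PQ (GB N).1)).
Qed.

Lemma EA_cover X : exists X0 (p : chom X0 X), is_P X0 /\ is_epi p.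
Proof.
have [V [Q [j [p [PQ t BV]]]]] := Bn_resolve (GB X).
have [X0 e0] := GS (Bn_inE d.+1 PQ); subst Q.
have [V0 eV] := GS (Bn_le (leqnSn d) BV); subst V.
have [p0 pE] := G_surj p; have [j0 jE] := G_surj j; subst p j.
exists X0, p0; split=> //.
by have [_ /cokernel_epi] := (EA_conflation _ _).1 t.
Qed.

Lemma EA_weak_kernel Q1 Q0 (g : hom Q1 Q0) : inE Q1 -> inE Q0 ->
  exists W (f : hom W Q1), [/\ inE W, g \oc f = 0
    & forall Q (h : hom Q Q1), inE Q -> g \oc h = 0 -> exists u, h = f \oc u].
Proof.
move=> P1 P0; have [X1 e1] := GS (Bn_inE d.+1 P1); have [X0 e0] := GS (Bn_inE d.+1 P0).
subst Q1 Q0; have [g0 gE] := G_surj g; subst g.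
have [_ kers _ _ _] := EA_abelian.
have [N [n [gn ker]]] := kers _ _ g0.
have [X [p [PX epi]]] := EA_cover N.
exists (G X), (lf_hom G (n \oc p)); split=> //.
  by rewrite -lf_comp -ccompA gn ccomp0l (G_eq0 0).2.
move=> Q h PQ gh; have [T eT] := GS (Bn_inE d.+1 PQ); subst Q.
have [h0 hE] := G_surj h; subst h.
have [|a [aE _]] := ker T h0; first by apply/G_eq0; rewrite lf_comp.
have [z zE] := EA_epi_surj (lf_hom G a) epi PQ.
by exists z; rewrite aE !lf_comp zE ccompA.
Qed.

Lemma EA_weak_kernels : weak_kernels_on_P.
Proof.
move=> q q' g Pq Pq'.
have [||W [f [[w Pw eW] gf wk]]] := @EA_weak_kernel _ _ (lf_hom E g); [by exists q | by exists q' |].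
subst W; have [f0 fE] := E_surj EFF f; subst f.
exists w, f0; split=> //; first by apply/(E_eq0 EFF); rewrite lf_comp.
move=> t h Pt gh; have [|u uE] := wk _ (lf_hom E h) (ex_intro2 _ _ t Pt erefl).
  by rewrite -lf_comp gh (E_eq0 EFF 0).2.
have [u0 u0E] := E_surj EFF u; exists u0; apply: (E_inj EFF).
by rewrite lf_comp u0E.
Qed.

(** Exactness at Q0 holds because f maps by an epimorphism onto the kernel of its cokernel, and
    morphisms from P lift along epimorphisms. *)
Lemma EA_cokernel Q1 Q0 (f : hom Q1 Q0) : inE Q1 -> inE Q0 ->
  exists Z (p : hom Q0 Z), [/\ B d.+1 Z, p \oc f = 0,
    forall Q (b : hom Q Z), inE Q -> exists z, b = p \oc z
    & forall Q (z : hom Q Q0), inE Q -> p \oc z = 0 -> exists w, z = f \oc w].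
Proof.
move=> P1 P0; have [X1 e1] := GS (Bn_inE d.+1 P1); have [X0 e0] := GS (Bn_inE d.+1 P0).
subst Q1 Q0; have [f0 fE] := G_surj f; subst f.
have [_ kers coks _ _] := EA_abelian.
have [C [c cokc]] := coks _ _ f0; have [N [n kern]] := kers _ _ c.
have [e epi fE] := cokernel_image EA_abelian cokc kern.
exists (G C), (lf_hom G c); split; first exact: GB.
- by rewrite -lf_comp cokc.1 (G_eq0 0).2.
- by move=> Q b PQ; apply: EA_epi_surj => //; apply: cokernel_epi cokc.
move=> Q z PQ cz; have [T eT] := GS (Bn_inE d.+1 PQ); subst Q.
have [z0 zE] := G_surj z; subst z.
have [|a [aE _]] := kern.2 T z0; first by apply/G_eq0; rewrite lf_comp.
have [w wE] := EA_epi_surj (lf_hom G a) epi PQ.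
by exists w; rewrite aE lf_comp wE fE lf_comp ccompA.
Qed.

Lemma EA_cokernels : P_cokernels.
Proof.
move=> q1 q0 f Pq1 Pq0.
have [||Z [p [BZ pf sur ex]]] := @EA_cokernel _ _ (lf_hom E f); [by exists q1 | by exists q0 |].
exists Z, p; split=> //; split=> // [q b Pq|q z Pq pz].
  have [z ->] := sur _ b (ex_intro2 _ _ q Pq erefl).
  by have [z0 <-] := E_surj EFF z; exists z0.
have [w wE] := ex _ _ (ex_intro2 _ _ q Pq erefl) pz.
have [w0 w0E] := E_surj EFF w; exists w0; apply: (E_inj EFF).
by rewrite lf_comp w0E.
Qed.

(* A morphism that is injective on morphisms from P is a monomorphism, hence a
   kernel, hence the first morphism of a conflation. *)
Lemma EA_inj_cone V Q (j : hom V Q) : B d.+1 V -> B d.+1 Q ->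
  (forall (T : A) (a : hom T V), inE T -> j \oc a = 0 -> a = 0) ->
  exists Z (p : hom Q Z), tri j p /\ B d.+1 Z.
Proof.
move=> BV BQ inj; have [V0 eV] := GS BV; have [Q0 eQ] := GS BQ; subst V Q.
have [j0 jE] := G_surj j; subst j.
have mono : is_mono j0.
  apply/is_mono0 => T u ju; have [X [p [PX /is_epi0 epi]]] := EA_cover T.
  apply: epi; apply/G_eq0; apply: (inj _ _ PX).
  by rewrite -lf_comp -ccompA ju ccomp0l (G_eq0 0).2.
have [C [c /EA_conflation t]] := mono_short_exact EA_abelian mono.
by exists (G C), (lf_hom G c).
Qed.

(** Parallel to [resolve_exact_on_I], with the cone supplied by [EA_inj_cone]. That lemma places Z
    at level d + 1 only, so the level m + 1 is read off the construction and just the Ext condition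
    is taken from it. *)
Lemma resolve_exact_on_P m (X : nat -> H0 K) (DX : forall i, chom (X i.+1) (X i)) :
  (m <= d)%N -> @P_complex k K P m X DX -> @exact_on_P k K P m X DX ->
  exists Z p, B m.+1 Z /\ @resolves k A K E m.+1 X DX Z p.
Proof.
have NN := EA_nonneg.
elim: m X DX => [|m IH] X DX m_d [PX DD] exP.
  have [|Z [p [t BZ]]] := EA_inj_cone (j := lf_hom E (DX 0%N)) (Bn_E _ _) (Bn_E _ _).
    move=> T a [q Pq eT]; subst T; have [a0 <-] := E_surj EFF a; rewrite -lf_comp => /(E_eq0 EFF) Da.
    by apply/(E_eq0 EFF); apply: (exP q Pq).1.
  have e1 : extends (E (X 1%N)) (E (X 0%N)) Z by exists (lf_hom E (DX 0%N)), p.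
  exists Z, p; split.
    split; last exact: BZ.2.
    by apply: (st_cone OP (in_obE _ (PX 0%N isT)) _ e1); exact: in_obE.
  exists (E (X 1%N)), (lf_hom E (DX 0%N)), (Defs.cid _); split=> //; first by rewrite ccomp1r.
  exact: is_iso_id.
have [|||V [q [BV r]]] := IH (fun i => X i.+1) (fun i => DX i.+1); first exact: ltnW.
- by split=> i i_m; [apply: (PX i.+1) | apply: (DD i.+1)].
- by move=> q Pq; have [inj ex] := exP q Pq; split=> // i i_m; apply: (ex i.+1).
have [V' [j' [q' [t' DE r']]]] := r.
have PX' i : (i < m)%N -> P (X i.+2) by move=> i_m; apply: PX; lia.
have PX1 i : (i < m.+1)%N -> P (X i.+1) by move=> i_m; apply: PX.
have [|j jE] := tri_colift t' (z := lf_hom E (DX 0%N)).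
  apply: (@resolves_epi k A K R E P OP m (fun i => X i.+2) (fun i => DX i.+2) V' q' (X 0%N) _ NN PX' r').
  by rewrite ccompA -DE -lf_comp DD // (E_eq0 EFF 0).2.
have BV' : B d.+1 V by apply: Bn_le BV; lia.
have [|Z [p [t BZ]]] := EA_inj_cone (j := j) BV' (Bn_E _ _).
  move=> T a [q0 Pq eT] ja; subst T; have [b bE] := resolves_surj R OP a Pq PX1 r.
  have [b0 b0E] := E_surj EFF b; subst b.
  have [_ ex] := exP q0 Pq; have [|u uE] := (ex 0%N isT b0).1.
    by apply/(E_eq0 EFF); rewrite lf_comp jE ccompA -bE.
  by rewrite bE uE lf_comp DE ccompA -!(ccompA q) (tri_comp t') !ccomp0l.
have e1 : extends V (E (X 0%N)) Z by exists j, p.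
exists Z, p; split; last by exists V, j, q.
split; last exact: BZ.2.
exact: (st_cone OP (in_obE _ (PX 0%N isT)) BV.1 e1).
Qed.

Lemma EA_condition_b : @condition_b k K P I d.
Proof.
move=> X DX cx; have NN := EA_nonneg; have [PX _] := cx; split=> ex.
  have [Z [p [BZ r]]] := resolve_exact_on_I R EFF OP IP NN cx ex.
  by apply: (exact_on_P_vanP R EFF OP NN PX r).2; apply: EA_vanP.
have [Z [p [BZ r]]] := resolve_exact_on_P (leqnn d) cx ex.
exact: (resolves_exact_on_I EFF OP IP NN PX r BZ).
Qed.

End Necessity.

(** * Completing morphisms of P to complexes *)

Section Completability.
Hypothesis NN : @nonneg k A K E.
Hypothesis CB : @condition_b k K P I d.

Lemma resolves_P_cokernel m (X : nat -> H0 K) (DX : forall i, chom (X i.+1) (X i)) Z p :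
  (forall i, (i <= m)%N -> P (X i)) -> @resolves k A K E m.+1 X DX Z p ->
  P_cokernel (DX 0%N) p.
Proof.
move=> PX r; have [V [j [q [t DE r']]]] := r.
have PX1 i : (i < m)%N -> P (X i.+1) by move=> i_m; apply: PX.
split.
- by rewrite DE -ccompA (tri_comp t) ccomp0l.
- move=> q0 b Pq; have [z ->] := @resolves_surj k A K R E P OP m.+1 X DX Z p q0 b Pq PX r.
  by have [z0 <-] := E_surj EFF z; exists z0.
move=> q0 z Pq pz; have [a aE] := tri_lift t pz.
have [b bE] := @resolves_surj k A K R E P OP m (fun i => X i.+1) (fun i => DX i.+1) V q q0 a Pq PX1 r'.
have [w wE] := E_surj EFF b; exists w; apply: (E_inj EFF).
by rewrite lf_comp DE wE aE bE ccompA.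
Qed.

Lemma completable_P_cokernels : @completable k K P d -> P_cokernels.
Proof.
move=> cp q1 q0 f Pq1 Pq0; have [X [DX [eD cx exP]]] := cp _ _ f Pq1 Pq0.
have [Z [p [BZ r]]] := resolve_exact_on_I R EFF OP IP NN cx ((CB cx).2 exP).
(* The last differential equals f only as a dependent pair, so the conclusion is stated for arrows
   before rewriting. *)
pose goal (a : arrow K) := exists Z (p : hom (E (projT1 a).2) Z),
  B d.+1 Z /\ P_cokernel (projT2 a) p.
have : goal (Arrow (DX 0%N)).
  by exists Z, p; split=> //; apply: resolves_P_cokernel r; have [] := cx.
by rewrite eD.
Qed.

(** The kernels V0 of p and V1 of the lift g of f are prescribed by f. Schanuel's lemma puts them at
    levels d and d - 1 up to complements in P; the complement of V1 is then removed by
    [st_summand_st] or by closure of K under summands, and a resolution of V1 continues the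
    complex. *)
Lemma P_cokernels_completable :
  (2 <= d)%N \/ (d = 1%N /\ @closed_under_summands k H kk) ->
  P_cokernels -> @completable k K P d.
Proof.
move=> d_ge PC q1 q0 f Pq1 Pq0.
have [Z [p [BZ [pf sur ex]]]] := PC _ _ f Pq1 Pq0.
have vZ := condition_b_vanP NN CB BZ.
have van1_iso V : (forall q, P q -> @vanishing k A (E q) V 1) ->
    forall Q, pp Q -> vanishing Q V 1.
  by move=> v Q [q Pq iq]; apply: (@vanishing_iso_l k A V (E q));
    [apply: isomorphic_sym | apply: v].
have orthE q q' : P q -> @vanishing k A (E q) (E q') 1.
  by move=> Pq; apply: (orth_pk OP) => //; exact: in_obE.
have [V0 [j t]] := tri_cocone R p.
have v0 Q : pp Q -> vanishing Q V0 1.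
  apply: van1_iso => q Pq; apply: (van_of_tri_surj t); last exact: orthE.
  by move=> b; have [z ->] := sur _ b Pq; exists (lf_hom E z).
have s0 : st_summand R kk pp d V0.
  apply: (@st_summand_kernel k A R kk pp OP d V0 (E q0) Z (in_obE E Pq0) _ v0).
    by exists j, p.
  exact: (st_st_summand OP BZ.1).
have [g gE] := tri_lift t (z := lf_hom E f) pf.
have injj q (a : hom (E q) V0) : P q -> j \oc a = 0 -> a = 0.
  by move=> Pq; apply: (tri_inj t); apply: (vZ q 1%N).
have surg q (b : hom (E q) V0) : P q -> exists z, b = g \oc z.
  move=> Pq; have [a aE] := E_surj EFF (j \oc b).
  have [|w wE] := ex _ a Pq; first by rewrite aE -ccompA (tri_comp t) ccomp0l.
  exists (lf_hom E w); apply/eqP; rewrite -subr_eq0; apply/eqP; apply: injj => //.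
  by rewrite ccompBr -ccompA -gE -lf_comp -wE aE subrr.
have [V1 [j1 t1]] := tri_cocone R g.
have v1 Q : pp Q -> vanishing Q V1 1.
  apply: van1_iso => q Pq; apply: (van_of_tri_surj t1); last exact: orthE.
  by move=> b; apply: surg.
have [d' dE] : exists d', d = d'.+1.
  by case: d_ge => [|[-> _]]; [case: (d) => // n _; exists n | exists 0%N].
have s1 : st_summand R kk pp d' V1.
  apply: (@st_summand_kernel k A R kk pp OP d' V1 (E q1) V0 (in_obE E Pq1) _ v1).
    by exists j1, g.
  by rewrite -dE.
have sV1 : st R kk d' V1.
  case: d_ge => [d2|[d1 cl]].
    by case: d' dE s1 => [|n] dE s1; [lia | apply: (st_summand_st OP s1)].
  have d0 : d' = 0%N by lia.
  rewrite d0 in s1 *; have [Q' [W [PQ' b kW]]] := s1.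
  exact: cl b kW.
have [X [DX [h [PX r]]]] := resolution_exists EFF OP sV1.
have [d1 d1E] := E_surj EFF (j1 \oc h).
pose X' i := if i is i'.+1 then (if i' is i''.+1 then X i'' else q1) else q0.
pose DX' i : chom (X' i.+1) (X' i) :=
  if i is i'.+1 then
    (if i' is i''.+1 return chom (X' i'.+2) (X' i'.+1) then DX i'' else d1) else f.
have r' : @resolves k A K E d'.+2 X' DX' Z p.
  by exists V0, j, g; split=> //; exists V1, j1, h.
have PX' i : (i <= d'.+1)%N -> P (X' i).
  by case: i => [|[|i]] // i_d; apply: PX.
exists X', DX'; rewrite dE; split=> //.
  exact: (resolves_complex EFF NN PX' r').
exact: (exact_on_P_vanP R EFF OP NN PX' r').2.
Qed.

End Completability.
End ExactStructure.

(** * Comparison with the twisted complexes of K *)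

Section DgFunctors.
Variables (k : comPzRingType) (A B : dgcat k) (F : dgfun A B) (X Y : A) (n : int).

(* Full faithfulness in the degrees that determine H^n: the truncation is not full on
   cochains of degree n = 0, only on cocycles. *)
Definition bijective_near :=
  [/\ forall m, injective (@df_hom k A B F X Y m),
      forall g : dhom (F X) (F Y) n, (forall m (e : n + 1 = m), diff e g = 0) ->
        exists f, df_hom F f = g
    & forall m (e : m + 1 = n) (h : dhom (F X) (F Y) m), exists f, df_hom F f = h].

Hypothesis bij : bijective_near.

Lemma df_hom_closed (f : dhom X Y n) m (e : n + 1 = m) :
  diff e (df_hom F f) = 0 <-> diff e f = 0.
Proof.
have [inj _ _] := bij; have F0 := linf0 (@df_lin k A B F X Y m).
by rewrite -df_diff; split=> [|->]; [rewrite -{1}F0 => /inj | ].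
Qed.

Lemma df_hom_exact (f : dhom X Y n) m (e : m + 1 = n) :
  (exists w, df_hom F f = diff e w) <-> exists w, f = diff e w.
Proof.
have [inj _ sur] := bij; split=> [[w]|[w ->]]; last by exists (df_hom F w); rewrite df_diff.
by have [v <-] := sur _ e w; rewrite -df_diff => /inj ->; exists v.
Qed.

Lemma vanishing_dgfun : vanishing (F X) (F Y) n <-> vanishing X Y n.
Proof.
have [inj sur _] := bij; have e : n - 1 + 1 = n by rewrite subrK.
split=> /(vanishingP _ _ e erefl) v; apply/(vanishingP _ _ e erefl) => z z0.
  by apply/df_hom_exact; apply: v; apply/df_hom_closed.
have [|f fz] := sur z; first by move=> m e'; subst m.
by rewrite -fz; apply/df_hom_exact; apply: v; apply/df_hom_closed; rewrite fz.
Qed.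

End DgFunctors.

Lemma H0fun_bijective (k : comPzRingType) (A B : dgcat k) (F : dgfun A B) (X Y : A) :
  bijective_near F X Y 0 ->
  injective (@lf_hom k _ _ (H0fun F) X Y) /\
  forall h, exists f : @chom k (H0 A) X Y, lf_hom (H0fun F) f = h.
Proof.
move=> bij; have [inj sur sur1] := bij.
have mapE (f : dhom X Y 0) (f0 : D0 f = 0) (Ff0 : D0 (df_hom F f) = 0) :
    lf_hom (H0fun F) (hcl f0) = hcl Ff0.
  rewrite /hcl; apply: etrans (cls_map _ _) _; congr cls; exact: cval_inj.
have Fcl (f : dhom X Y 0) : D0 f = 0 -> D0 (df_hom F f) = 0.
  by move=> f0; apply/(df_hom_closed bij).
split=> [x y|h].
  have [f [f0 ->]] := hclP x; have [g [g0 ->]] := hclP y.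
  rewrite (mapE _ f0 (Fcl _ f0)) (mapE _ g0 (Fcl _ g0)) => /hcl_eq h.
  apply/hcl_eq; apply/(df_hom_exact bij).
  by rewrite (linfB (@df_lin k A B F X Y 0)).
have [g [g0 ->]] := hclP h.
have [|f fg] := sur g; first by move=> m e; apply: D0_closed.
have f0 : D0 f = 0 by apply/(df_hom_closed bij); rewrite fg.
by exists (hcl f0); rewrite (mapE _ f0 (Fcl _ f0)); apply: hcl_irr.
Qed.

Section Embeddings.
Variables (k : comPzRingType) (K : dgcat k).

(** Composition with the unit moves between the indices n and n + 0 - 0, in both directions. *)
Lemma stalk_hom_inj (X Y : K) n : injective (@stalk_hom k K X Y n).
Proof.
move=> f g /(congr1 (fun h => h tt tt)); rewrite /stalk_hom.
have e : 0 + (n + 0 - 0) = n by lia.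
have E (h : dhom X Y n) : dcomp e (dunit Y erefl) (dcomp (deg_stalk n) (dunit Y erefl) h) = h.
  by rewrite -(dcompA (add0r 0) (add0r n) _ e) (dunit_comp _ _ _ erefl) dcomp1l.
by move=> /(congr1 (dcomp e (dunit Y erefl))); rewrite !E.
Qed.

Lemma stalk_hom_surj (X Y : K) n (g : @dhom k (pretr K) (stalk X) (stalk Y) n) :
  exists f, stalk_hom f = g.
Proof.
have e : 0 + (n + 0 - 0) = n by lia.
exists (dcomp e (dunit Y erefl) (g tt tt : dhom X Y (n + 0 - 0))).
apply: famP => -[] []; rewrite /stalk_hom.
have e1 : 0 + (n + 0 - 0) = n + 0 - 0 by rewrite add0r.
rewrite -(dcompA (add0r 0) e1 e (deg_stalk n)) (dunit_comp _ _ _ erefl).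
exact: (@dcomp1l k K X Y 0 (n + 0 - 0) erefl e1 (g tt tt)).
Qed.

Lemma embed_bijective (X Y : K) n : bijective_near (embed K) X Y n.
Proof.
split; first exact: stalk_hom_inj.
- by move=> g _; apply: stalk_hom_surj.
- by move=> m _ h; apply: stalk_hom_surj.
Qed.

Lemma embed_fully_faithful : fully_faithful (H0fun (embed K)).
Proof. by move=> X Y; apply/H0fun_bijective/embed_bijective. Qed.

Variable S : K -> Prop.

Lemma trunc_bijective (X Y : trunc_le0 (fullsub S)) n : (n <= 0)%R ->
  bijective_near (dgfun_comp (fullsub_incl S) (trunc_incl (fullsub S))) X Y n.
Proof.
move=> n0; split.
- by move=> m f g; exact: (@tval_inj k (fullsub S) X Y m f g).
- move=> g g0.
  have gP : g \in @trunc_pred k (fullsub S) X Y n.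
    have [n1|n1] : n < 0 \/ n = 0 by lia.
      by rewrite unfold_in n1.
    by rewrite unfold_in; apply/or3P/Or32; apply/andP; split; [exact/eqP | exact/eqP/g0].
  by exists (@Trunc k (fullsub S) X Y n g gP).
- move=> m e h.
  have hP : h \in @trunc_pred k (fullsub S) X Y m.
    by rewrite unfold_in (_ : m < 0) //; lia.
  by exists (@Trunc k (fullsub S) X Y m h hP).
Qed.

Lemma trunc_vanishing_pos (A : dgcat k) (X Y : A) (n : int) : (0 < n)%R ->
  @vanishing k (trunc_le0 A) X Y n.
Proof.
move=> n0; have e : n - 1 + 1 = n by rewrite subrK.
apply/(vanishingP _ _ e erefl) => z _; exists 0; rewrite diff0.
by apply: tval_inj; apply: tval_pos.
Qed.

End Embeddings.

Section TrianglesOfTwistedComplexes.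
Variables (k : comPzRingType) (K : dgcat k).
Notation R := (pretr_pretriangulation K).
Notation T := (tr K).

Lemma triangle_tri (X Y Z : T) (f : chom X Y) (g : chom Y Z) h :
  triangle f g h -> @tri k (pretr K) X Y Z f g.
Proof.
move=> [f0 [-> [c [[c' [c1 c2]] cg _]]]].
have t := tri_isoR R (tri_mcone R f0) (is_iso_inverse (conj c1 c2)).
have -> : g = c' \oc ci (mconeP R f0); last exact: t.
rewrite -[g]ccomp1l -c1 ccompA cg; congr (_ \oc _).
exact: cls_hcl.
Qed.

Lemma tri_triangle (X Y Z : T) (f : chom X Y) (g : chom Y Z) :
  @tri k (pretr K) X Y Z f g -> exists h, triangle f g h.
Proof.
have [f0 ->] := clsP f => t.
have [c isoc cg] := tri_cone_unique R t (tri_mcone R f0).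
exists ((cls (cone_proj f0) : chom (Defs.cone f0 : T) (Sigma 1 X : T)) \oc c).
exists f0; split=> //; exists c; split=> //.
by rewrite cg; apply: esym; apply: cls_hcl.
Qed.

Lemma ext_vanishE (X Y : T) (i : nat) :
  ext_vanish X Y i <-> @vanishing k (pretr K) X Y i%:Z.
Proof. exact: (vanishing_shf_r R Y X (add0r i%:Z)). Qed.

Notation E := (H0fun (embed K)).

Lemma star_K_st n Z : @star_K k K n Z <-> st R (in_ob E xpredT) n Z.
Proof.
elim: n Z => [|n IH] Z /=.
  by split=> [[X iX]|[X _ iX]]; exists X.
split.
  move=> [X [Y [f [g [h [sX [C [[C0 iC] iY]] t]]]]]].
  exists X, Y; split; first exact/IH.
    by exists C => //; exists C0.
  by exists f, g; apply: triangle_tri t.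
move=> [X [Y [sX [C [C0 _ iC] iY] [f [g t]]]]].
have [h t'] := tri_triangle t.
exists X, Y, f, g, h; split=> //; first exact/IH.
by exists C; split=> //; exists C0.
Qed.

Variables (P I : K -> Prop).

Lemma in_B_Bn n Z : in_B I n Z <-> Bn R E I n Z.
Proof.
rewrite /in_B /Bn star_K_st; split=> -[sZ v]; split=> // i J i0 IJ.
  exact/ext_vanishE/v.
by apply/ext_vanishE; apply: v.
Qed.

End TrianglesOfTwistedComplexes.

(** * Finitely presented modules as cokernels on P *)

Section CokernelModules.
Variables (k : comPzRingType) (C T : lincat k) (F : linfun C T).
Variables (P1 P0 : C) (f : chom P1 P0) (Z : T) (q : chom (F P0) Z).

Definition restr_cokernel :=
  [/\ q \oc lf_hom F f = 0,
      forall Q (b : chom (F Q) Z), exists z : chom Q P0, b = q \oc lf_hom F z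
    & forall Q (z : chom Q P0), q \oc lf_hom F z = 0 -> exists w, z = f \oc w].

(** The restriction of Z and the module M are cokernels of the same f, so lifting along q and then
    applying p does not depend on the chosen lift. *)
Lemma restr_cokernel_isomorphic (M : rmodule C) (p : rm_morph (representable P0) M) :
  restr_cokernel ->
  (forall X, (forall m : M X, exists g, m = p X g) /\
      exact_at (fun g : chom X P1 => f \oc g) (p X)) ->
  rm_isomorphic (restr_hom F Z) M.
Proof.
move=> [qf sur ex] pP.
have pB X (z z' : chom X P0) : p X (z - z') = p X z - p X z'.
  exact: (linfB (@rm_map_linear _ _ _ _ p X)).
have key X (z z' : chom X P0) : p X z = p X z' <-> q \oc lf_hom F z = q \oc lf_hom F z'.
  split=> [E|E].
    have [|w wE] := ((pP X).2 (z - z')).1; first by rewrite pB E subrr.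
    apply/eqP; rewrite -subr_eq0 -ccompBr -(linfB (@lf_linear _ _ _ F _ _)) wE.
    by rewrite lf_comp -ccompA qf ccomp0l.
  have [|w wE] := ex X (z - z').
    by rewrite (linfB (@lf_linear _ _ _ F _ _)) ccompBr E subrr.
  apply/eqP; rewrite -subr_eq0 -pB; apply/eqP; apply/(pP X).2.
  by exists w.
pose phi X (b : chom (F X) Z) : M X := p X (sval (boolp.cid (sur X b))).
have phiE X z : phi X (q \oc lf_hom F z) = p X z.
  by rewrite /phi; case: boolp.cid => z' /= E; apply/key.
have phi_lin X : linear (phi X).
  move=> a x y; have [z ->] := sur X x; have [t ->] := sur X y.
  rewrite !phiE -ccomp_linr -lf_linear phiE.
  exact: (rm_map_linear p).
have phi_nat X Y (m : restr_hom F Z Y) (g : chom X Y) :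
    phi X (rm_act m g) = rm_act (phi Y m) g.
  have [z ->] := sur Y m; rewrite phiE -(rm_map_nat p).
  apply: etrans (_ : phi X (q \oc lf_hom F (z \oc g)) = _); last exact: phiE.
  by congr (phi X _); rewrite lf_comp -ccompA.
exists (@RMMorph k C (restr_hom F Z) M phi phi_lin phi_nat) => X.
exists (fun m => q \oc lf_hom F (sval (boolp.cid ((pP X).1 m)))) => [b|m] /=.
  have [z ->] := sur X b; rewrite phiE.
  by case: boolp.cid => z' /= /key.
by case: boolp.cid => z /= ->; rewrite phiE.
Qed.

(** By Yoneda, q' is the preimage of c under phi, and naturality carries the three properties
    over. *)
Lemma restr_cokernel_of_isomorphic (W : T) (c : chom (F P0) W) (X : T)
    (phi : rm_morph (restr_hom F X) (restr_hom F W)) :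
  (forall Q, bijective (phi Q)) ->
  c \oc lf_hom F f = 0 ->
  (forall Q (b : chom (F Q) W), exists z : chom Q P0, b = c \oc lf_hom F z) ->
  (forall Q (z : chom Q P0), c \oc lf_hom F z = 0 -> exists w, z = f \oc w) ->
  exists q' : chom (F P0) X, [/\ q' \oc lf_hom F f = 0,
      forall Q (b : chom (F Q) X), exists z : chom Q P0, b = q' \oc lf_hom F z
    & forall Q (z : chom Q P0), q' \oc lf_hom F z = 0 -> exists w, z = f \oc w].
Proof.
move=> bij cf sur ex; have [psi _ psiK] := bij P0.
have inj Q := bij_inj (bij Q).
have phiE Q (z : chom Q P0) : phi Q (psi c \oc lf_hom F z) = c \oc lf_hom F z.
  by apply: etrans (rm_map_nat phi (psi c) z) _; rewrite psiK.
have phi0 Q : phi Q 0 = 0 by apply: (linf0 (@rm_map_linear _ _ _ _ phi Q)).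
exists (psi c); split.
- by apply: inj; rewrite phiE cf phi0.
- move=> Q b; have [z zE] := sur Q (phi Q b); exists z.
  by apply: inj; rewrite phiE.
- move=> Q z qz; apply: ex; rewrite -phiE qz.
  exact: phi0.
Qed.

End CokernelModules.

Section LinearFunctors.
Variables (k : comPzRingType) (C D : lincat k) (F : linfun C D).

Lemma lf0 (X Y : C) : lf_hom F (0 : chom X Y) = 0.
Proof. exact: linf0 (@lf_linear _ _ _ F X Y). Qed.

Lemma lf_biproduct (X Y Z : C) : is_biproduct X Y Z -> is_biproduct (F X) (F Y) (F Z).
Proof.
move=> [i [j [p [q [b1 b2 b3 b4 b5]]]]].
exists (lf_hom F i), (lf_hom F j), (lf_hom F p), (lf_hom F q).
split; rewrite -!lf_comp ?b1 ?b2 ?b3 ?b4 ?lf_id ?lf0 //.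
by rewrite -(linfD (@lf_linear _ _ _ F _ _)) b5 lf_id.
Qed.

End LinearFunctors.

(** * Translation to precluster tilting triples *)

Section PreclusterTilting.
Variables (k : comPzRingType) (K : dgcat k) (P I : K -> Prop) (d : nat).
Hypothesis KPI : precluster_tilting_triple P I d.
Notation R := (pretr_pretriangulation K).
Notation T := (tr K).
Notation E := (H0fun (embed K)).
Notation kk := (in_ob E xpredT).
Notation pp := (in_ob E P).

Lemma in_K_in_ob (Z : T) : in_K Z <-> kk Z.
Proof. by split=> [[X iX]|[X _ iX]]; exists X. Qed.

Lemma precluster_biproduct (q q' : H0 K) : P q -> P q' ->
  exists2 z : H0 K, P z & is_biproduct q q' z.
Proof.
move=> Pq Pq'; have [z bz] := (pct_additive KPI).2 q q'.
by have [_ Pb _] := pct_P_additive KPI; exists z => //; apply: Pb bz.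
Qed.

Lemma precluster_orthogonal_pair : @orthogonal_pair k (pretr K) kk pp.
Proof.
have [[O PO O0] _ _] := pct_P_additive KPI.
have iso_ob S (X Y : T) : isomorphic X Y -> in_ob E S X -> in_ob E S Y.
  move=> iXY [X0 SX iX]; exists X0 => //.
  by apply: isomorphic_trans iX; apply: isomorphic_sym.
have orth (Q X : T) (n : int) : (0 < n)%R -> pp Q -> kk X ->
    @vanishing k (pretr K) Q X n /\ @vanishing k (pretr K) X Q n.
  move=> n0 [q Pq iQ] [x _ iX].
  case: n n0 => // i i0; have [v1 v2] := pct_orthogonal KPI x i0 Pq.
  move/ext_vanishE: v1 => v1; move/ext_vanishE: v2 => v2.
  have iQ' := isomorphic_sym iQ; have iX' := isomorphic_sym iX.
  by split; [apply: (vanishing_iso_l iQ'); apply: (vanishing_iso_r iX')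
    | apply: (vanishing_iso_l iX'); apply: (vanishing_iso_r iQ')].
split.
- exact: iso_ob.
- exact: iso_ob.
- by move=> X [q _ iX]; exists q.
- exists (E O); first exact: in_obE.
  by rewrite /is_zero_object -lf_id O0 lf0.
- move=> X Y Z [q Pq iX] [q' Pq' iY] b.
  have [z Pz bz] := precluster_biproduct Pq Pq'.
  exists z => //; apply: biproduct_unique (biproduct_iso b iX iY) _.
  exact: lf_biproduct.
- move=> X Z Y kX kY [f [g t]]; apply/in_K_in_ob; apply: (pct_ext_closed KPI).
  have [h t'] := tri_triangle t.
  by exists X, Y, f, g, h; split=> //; apply/in_K_in_ob.
- by move=> Q X n n0 pQ kX; apply: (orth _ _ _ n0 pQ kX).1.
- by move=> Q X n n0 pQ kX; apply: (orth _ _ _ n0 pQ kX).2.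
- move=> X [x _ iX]; have [X' [Q [PQ [f [g [h t]]]]]] := pct_cover KPI x.
  exists (E X'), (E Q); split; [exact: in_obE | exact: in_obE |].
  apply: (extends_iso R (isomorphic_refl _) (isomorphic_refl _) (isomorphic_sym iX)).
  by exists f, g; apply: triangle_tri t.
Qed.

Notation J := (H0fun (fullsub_incl P)).

Lemma fullsub_incl_fully_faithful : fully_faithful J.
Proof.
move=> X Y; apply: H0fun_bijective; split=> [m f g //|g _|m _ h]; first by exists g.
by exists h.
Qed.

Lemma P_inclE (q q' : H0P P) (f : chom q q') : lf_hom (P_incl P) f = lf_hom E (lf_hom J f).
Proof.
have [z ->] := clsP f; rewrite /= !cls_map; congr cls.
exact: cval_inj.
Qed.

Lemma condition_aE : condition_a P <-> nonneg E /\ weak_kernels_on_P P.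
Proof.
have JFF := fullsub_incl_fully_faithful.
have nn : concentrated_in_nonneg_degrees K <-> nonneg E.
  split=> nn X Y n n0; apply/(vanishing_dgfun (embed_bijective X Y n)); exact: nn.
split=> -[/nn ? wk]; split=> //.
  move=> q q' g Pq Pq'.
  have [g0 gE] := (JFF (exist _ q Pq) (exist _ q' Pq')).2 g.
  have [[w Pw] [f [gf fac]]] := wk _ _ g0.
  exists w, (lf_hom J f); split=> //.
    by rewrite -gE; apply: etrans (esym (lf_comp J g0 f)) _; rewrite gf lf0.
  move=> t h Pt; have [h0 <-] := (JFF (exist _ t Pt) (exist _ q Pq)).2 h.
  rewrite -gE => gh; have [|u ->] := fac _ h0.
    by apply: (JFF _ _).1; rewrite lf0 lf_comp.
  by exists (lf_hom J u); rewrite lf_comp.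
move=> [q Pq] [q' Pq'] g; have [w [f [Pw gf fac]]] := wk _ _ (lf_hom J g) Pq Pq'.
have [f0 fE] := (JFF (exist _ w Pw) (exist _ q Pq)).2 f; subst f.
exists (exist _ w Pw), f0; split.
  by apply: (JFF _ _).1; rewrite lf_comp gf lf0.
move=> [t Pt] h gh; have [|u uE] := fac t (lf_hom J h) Pt.
  by apply: etrans (esym (lf_comp J g h)) _; rewrite gh lf0.
have [u0 u0E] := (JFF (exist _ t Pt) (exist _ w Pw)).2 u; subst u.
by exists u0; apply: (JFF _ _).1; rewrite lf_comp.
Qed.

(** The module presented by a morphism of P is represented on P by its cone W in [tr K], because
    Ext^1(P, P) = 0. Density replaces W by an object of B'. *)
Lemma F_denseE : F_dense P I d <-> P_cokernels R E P I d.
Proof.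
have JFF := fullsub_incl_fully_faithful; have EFF := @embed_fully_faithful k K.
have OP := precluster_orthogonal_pair.
have PJ (q q' : H0P P) (z : chom (sval q : H0 K) (sval q')) :
    exists2 z0 : chom q q', lf_hom J z0 = z & lf_hom (P_incl P) z0 = lf_hom E z.
  by have [z0 <-] := (JFF q q').2 z; exists z0 => //; rewrite P_inclE.
split=> [dense q1 q0 f Pq1 Pq0|PC M [P1 [P0 [f [p pP]]]]].
  pose Q1 : H0P P := exist _ q1 Pq1; pose Q0 : H0P P := exist _ q0 Pq0.
  have [f0 fE f0E] := PJ Q1 Q0 f.
  have [W [c t]] := tri_cone R (lf_hom (P_incl P) f0).
  have sur Q (b : chom (P_incl P Q) W) : exists z : chom Q Q0, b = c \oc lf_hom (P_incl P) z.
    have [|z ->] := tri_surj t _ b.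
      by apply: (orth_pk OP) => //; apply: in_obE; [exact: svalP | ].
    have [z1 <-] := (EFF (sval Q) q0).2 z.
    by have [z0 _ <-] := PJ Q Q0 z1; exists z0.
  have cf : c \oc lf_hom (P_incl P) f0 = 0 by apply: tri_comp t.
  have ex Q (z : chom Q Q0) : c \oc lf_hom (P_incl P) z = 0 -> exists w, z = f0 \oc w.
    move=> /(tri_lift t)[w]; have [w1 <-] := (EFF (sval Q) q1).2 w.
    have [w0 _ <-] := PJ Q Q1 w1; rewrite -lf_comp !P_inclE => /(EFF _ _).1/(JFF _ _).1 ->.
    by exists w0.
  pose p X (u : representable Q0 X) : restr_hom (P_incl P) W X := c \oc lf_hom (P_incl P) u.
  have p_lin X : linear (p X).
    move=> a u v; apply: etrans (congr1 (ccomp c) (@lf_linear _ _ _ (P_incl P) _ _ a u v)) _.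
    exact: ccomp_linr.
  have p_nat X Y (m : representable Q0 Y) (g : chom X Y) : p X (rm_act m g) = rm_act (p Y m) g.
    apply: etrans _ (esym (ccompA c (lf_hom (P_incl P) m) (lf_hom (P_incl P) g))).
    by congr (c \oc _); apply: (lf_comp (P_incl P)).
  have [|X [phi bij]] := dense (restr_hom (P_incl P) W).
    exists Q1, Q0, f0, (@RMMorph _ _ (representable Q0) (restr_hom (P_incl P) W) p p_lin p_nat).
    move=> X; split=> [|y]; first exact: sur.
    split=> [|[x ->]]; first exact: ex.
    apply: etrans (congr1 (ccomp c) (lf_comp (P_incl P) f0 x)) _.
    by apply: etrans (esym (ccompA _ _ _)) _; rewrite cf; apply: ccomp0l.
  have [q' [q'f qsur qex]] := restr_cokernel_of_isomorphic bij cf sur ex.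
  exists (B'_incl I d X), q'; split; first exact/in_B_Bn/svalP.
  split=> [|q b Pq|q z Pq qz].
  - by rewrite -f0E.
  - have [z ->] := qsur (exist _ q Pq) b; exists (lf_hom J z).
    have zE := P_inclE z; exact (congr1 (ccomp q') zE).
  - have [z0 zE z0E] := PJ (exist _ q Pq) Q0 z.
    have [|w wE] := qex _ z0; first by rewrite z0E.
    by exists (lf_hom J w); rewrite -zE wE lf_comp fE.
have [Z [q [BZ [qf sur ex]]]] := PC _ _ (lf_hom J f) (svalP P1) (svalP P0).
exists (exist _ Z ((in_B_Bn I d.+1 Z).2 BZ)).
apply: (@restr_cokernel_isomorphic _ _ _ (P_incl P) P1 P0 f Z q M p _ pP); split.
- by rewrite P_inclE.
- move=> Q b; have [z ->] := sur _ b (svalP Q).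
  by have [z0 _ <-] := PJ Q P0 z; exists z0.
- move=> Q z; rewrite P_inclE => /(ex _ _ (svalP Q))[w zw].
  have [w0 wE _] := PJ Q P1 w.
  by exists w0; apply: (JFF _ _).1; rewrite lf_comp wE.
Qed.

Notation G := (B'_incl I d).

Lemma B'_incl_fully_faithful : fully_faithful G.
Proof. by move=> X Y; apply: H0fun_bijective; apply: trunc_bijective. Qed.

Lemma B'_incl_Bn X : Bn R E I d.+1 (G X).
Proof. exact/in_B_Bn/svalP. Qed.

Lemma B'_incl_surj Z : Bn R E I d.+1 Z -> exists X, G X = Z.
Proof. by move=> /in_B_Bn BZ; exists (exist _ Z BZ). Qed.

Lemma B'_abelianE : B'_abelian I d <-> exact_abelian R E I d G.
Proof.
have van (X Y : B' I d) n : (n < 0)%R ->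
    @vanishing k (pretr K) (G X) (G Y) n <-> @vanishing k (B' I d) X Y n.
  by move=> n0; apply: vanishing_dgfun; apply: trunc_bijective; lia.
have confl (X Y Z : H0 (B' I d)) (f : chom X Y) (g : chom Y Z) :
    conflation f g <-> @tri k (pretr K) (G X) (G Y) (G Z) (lf_hom G f) (lf_hom G g).
  by split=> [[h]|]; [apply: triangle_tri | apply: tri_triangle].
split=> -[v ab se]; split=> //.
- move=> Y Z n n0 /B'_incl_surj[Y' <-] /B'_incl_surj[Z' <-].
  by apply/(van _ _ _ n0); apply: v; lia.
- by move=> X Y Z f g; rewrite -confl.
- move=> X Y n n0; have [n1|n1] : n < 0 \/ 0 < n by lia.
    by apply/(van _ _ _ n1); apply: v => //; apply: B'_incl_Bn.
  exact: trunc_vanishing_pos.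
- by move=> X Y Z f g; rewrite confl.
Qed.

End PreclusterTilting.

Theorem proposition3p5 (k : comPzRingType) (K : dgcat k) (P I : K -> Prop)
  (d : nat) (KPI : precluster_tilting_triple P I d) :
  (B'_abelian I d <-> [/\ condition_a P, condition_b P I d & F_dense P I d]) /\
  ((2 <= d)%N \/ (d = 1%N /\ closed_under_summands (@in_K k K)) ->
   condition_a P -> condition_b P I d -> (completable P d <-> F_dense P I d)).
Proof.
have EFF := @embed_fully_faithful k K.
have OP := precluster_orthogonal_pair KPI; have IP := pct_IP KPI.
have GFF := @B'_incl_fully_faithful k K I d.
have GB := @B'_incl_Bn k K I d; have GS := @B'_incl_surj k K I d.
rewrite (propext (B'_abelianE I d)) (propext (condition_aE P)) (propext (F_denseE KPI)); split; first split=> [EA|[[NN WK] CB PC]].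
- split; [split | |].
  + exact: (EA_nonneg OP IP EA).
  + exact: (EA_weak_kernels EFF OP IP GFF GB GS EA).
  + exact: (EA_condition_b EFF OP IP GFF GB GS EA).
  + exact: (EA_cokernels EFF OP IP GFF GB GS EA).
- apply: (exact_abelian_suff EFF OP IP _ GFF GB GS NN WK _ PC).
    exact: (precluster_biproduct KPI).
  by move=> Z; apply: (condition_b_vanP EFF OP IP NN CB).
- move=> dP [NN _] CB; split.
    exact: (completable_P_cokernels (pretr_pretriangulation K) EFF OP IP NN CB).
  apply: (P_cokernels_completable EFF OP IP NN CB).
  case: dP => [|[d1 cs]]; [by left | right; split=> //].
  by move=> X Y Z b /in_K_in_ob kZ; apply/in_K_in_ob; apply: cs b kZ.
Qed.
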